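(* Let $K$ be a semilocal commutative Hausdorff topological ring, let $F$ be a subring of $K$, let $(A,\sigma,u,\Lambda)$ be a unitary $F$-algebra and let $(P,[f])$ be a unimodular quadratic space over $(A,\sigma,u,\Lambda)$. Assume that: (0) $\mathbb{F}_2$ is not an epimorphic image of $K$; (1) $K^\times$ is open in $K$ and the map $a\mapsto a^{-1}:K^\times\to K^\times$ is continuous; (2) $F$ is dense in $K$ and $F\cap K^\times=F^\times$; (3) $A$ is a finitely generated projective $F$-module and $\Lambda$ is an $F$-summand of $A$. Topologize the finitely generated projective $K$-module $\mathrm{End}_{A_K}(P_K)$ canonically (see context) and give $O([f_K])$ the subspace topology. View $O([f])$ as a subgroup of $O([f_K])$ via $\phi\mapsto\phi_K$. Then the closure of $O([f])$ in $O([f_K])$ satisfies $$\overline{O([f])}\supseteq \ker \Delta_{\mathcal{I}(P_K),[f_K]}.$$ In particular, $[O([f_K]):\overline{O([f])}]$ is a finite power of $2$.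
   Context: Quadratic spaces. Rings are associative and unital; $\mathrm{Cent}(A)$ is the center and $A^\times$ the unit group of $A$. Let $(A,\sigma)$ be a ring with involution and $u\in\mathrm{Cent}(A)$ with $u^\sigma u=1$. For a finitely generated projective right $A$-module $P$, $P^*=\mathrm{Hom}_A(P,A)$ is a right $A$-module via $(\psi a)x=a^\sigma(\psi x)$; for $f\in \mathrm{Hom}_A(P,Q)$, $f^*:Q^*\to P^*$ is $f^*\psi=\psi\circ f$; $\omega_P:P\to P^{**}$ is $(\omega_Px)\phi=(\phi x)^\sigma u$. For $f\in\mathrm{Hom}_A(P,P^* )$ write $\tilde f(x,y)=(fx)y$. A form parameter is an additive group $\Lambda$ with $\Lambda^{\min}(u)=\{a-a^\sigma u: a\in A\}\subseteq\Lambda\subseteq\Lambda^{\max}(u)=\{a\in A: a^\sigma u=-a\}$ and $a^\sigma\Lambda a\subseteq\Lambda$ for all $a\in A$; then $(A,\sigma,u,\Lambda)$ is called a unitary ring. Set $\Lambda_P=\{f\in\mathrm{Hom}_A(P,P^* ): f=-f^*\omega_P,\ \tilde f(x,x)\in\Lambda\ \forall x\in P\}$. A quadratic space over $(A,\sigma,u,\Lambda)$ is a pair $(P,[f])$ with $P$ finitely generated projective over $A$ and $[f]$ the class of $f\in\mathrm{Hom}_A(P,P^* )$ modulo $\Lambda_P$; it is unimodular if $h_f=f+f^*\omega_P:P\to P^*$ is bijective. An isometry $(P,[f])\to(P',[f'])$ is an isomorphism $\phi:P\to P'$ with $[\phi^*f'\phi]=[f]$; $O([f])$ is the group of self-isometries.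 For a commutative ring $F$, a unitary $F$-algebra is a unitary ring $(A,\sigma,u,\Lambda)$ with $A$ an $F$-algebra, $\sigma$ $F$-linear and $\Lambda$ an $F$-submodule. For a commutative $F$-algebra $T$, its scalar extension to $T$ is $(A_T,\sigma_T,u_T,\Lambda_T)$ with $A_T=A\otimes_FT$, $\sigma_T=\sigma\otimes\mathrm{id}$, $u_T=u\otimes 1$, $\Lambda_T$ the image of $\Lambda\otimes_F T$ in $A_T$; $P_T=P\otimes_FT$, $\phi_T=\phi\otimes\mathrm{id}_T$, and $f_T$ is determined by $\tilde f_T(x\otimes k,x'\otimes k')=\tilde f(x,x')\otimes kk'$. Dickson maps. A ring $B$ is semilocal if $B/\mathrm{Jac}(B)$ is semisimple artinian. A unitary ring $(A,\sigma,u,\Lambda)$ is simple artinian if $A$ is artinian and has no nontrivial two-sided ideals $I$ with $I^\sigma=I$. A simple artinian unitary ring is split-orthogonal if $A\cong \mathrm{M}_n(L)$ for a field $L=\mathrm{Cent}(A)$ and some $n$, $\sigma|_L=\mathrm{id}_L$, and either $\mathrm{char}\,L\ne2$, $\sigma$ is orthogonal and $u=1$; or $\mathrm{char}\,L\neq 2$, $\sigma$ is symplectic and $u=-1$; or $\mathrm{char}\,L=2$ and $\Lambda=\Lambda^{\min}(u)$. For a unimodular quadratic space $(P,[f])$ with $P\neq0$ over a split-orthogonal unitary ring with center $L$, put $E=\mathrm{End}_A(P)$; the Dickson map $\Delta_{[f]}:O([f])\to\mathbb{Z}/2\mathbb{Z}$ is the group homomorphism $\Delta_{[f]}(\psi)=\frac{\dim_L(1-\psi)E}{\deg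 E}+2\mathbb{Z}$. Now let $(B,\tau,v,\Gamma)$ be a unitary ring with $B$ semilocal and $(Q,[g])$ a unimodular quadratic space over it. The induced unitary ring on $B/\mathrm{Jac}(B)$ (with the images of $\tau,v,\Gamma$) factors as a finite product $\prod_{i=1}^t(B_i,\tau_i,v_i,\Gamma_i)$ of simple artinian unitary rings; correspondingly $Q/Q\,\mathrm{Jac}(B)=\prod_iQ_i$, $g$ induces unimodular quadratic spaces $(Q_i,[g_i])$ over $(B_i,\tau_i,v_i,\Gamma_i)$, and each $\phi\in O([g])$ induces $\phi_i\in O([g_i])$. Let $\mathcal{I}(Q)$ be the set of $i$ such that $(B_i,\tau_i,v_i,\Gamma_i)$ is split-orthogonal and $Q_i\neq0$, and define $\Delta_{\mathcal{I}(Q),[g]}:O([g])\to(\mathbb{Z}/2\mathbb{Z})^{\mathcal{I}(Q)}$ by $\phi\mapsto(\Delta_{[g_i]}(\phi_i))_{i}$. In the claim this is applied to $B=A_K$ (which is semilocal) and $(Q,[g])=(P_K,[f_K])$. Topology. A finitely generated projective $K$-module $M$ is topologized by choosing a $K$-module embedding of $M$ as a direct summand of some $K^n$ and giving $M$ the subspace topology of the product topology; this is independent of choices. *)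

(* Defs.v *)
From HB Require Import structures.
From mathcomp Require Import all_boot all_order all_algebra generic_quotient.
From mathcomp Require Import all_classical.
From mathcomp Require Import topology tvs.

Set Implicit Arguments.
Unset Strict Implicit.
Unset Printing Implicit Defensive.

Import GRing.Theory.

Local Open Scope classical_set_scope.
Local Open Scope quotient_scope.
Local Open Scope ring_scope.

HB.mixin Record TopologicalZmodule_isTopologicalRing K
    & TopologicalZmodule K & GRing.PzRing K := {
  mulr_continuous : continuous (fun x : K * K => x.1 * x.2)
}.

#[short(type="comTopologicalRingType")]
HB.structure Definition ComTopologicalRing :=
  {K of TopologicalZmodule K & GRing.ComPzRing K
      & TopologicalZmodule_isTopologicalRing K}.

(* Right modules over [A] are left modules over the converse ring [A^c]. *)
Definition rscale (A : pzRingType) (M : lmodType A^c) (x : M) (a : A) : M :=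
  (a : A^c) *: x.

Notation "x *> a" := (rscale x a) (at level 40, left associativity) : ring_scope.

Section RightModuleTheory.
Variables (A : pzRingType) (M : lmodType A^c).
Implicit Types (x y : M) (a b : A).

Lemma rscaleA x a b : x *> a *> b = x *> (a * b).
Proof. by rewrite /rscale scalerA. Qed.
Lemma rscale1 x : x *> 1 = x.
Proof. exact: (@scale1r A^c). Qed.
Lemma rscaleDl x y a : (x + y) *> a = x *> a + y *> a.
Proof. exact: scalerDr. Qed.
Lemma rscaleDr x a b : x *> (a + b) = x *> a + x *> b.
Proof. exact: (@scalerDl A^c). Qed.
Lemma linear_rscale (N : lmodType A^c) (h : {linear M -> N}) x a :
  h (x *> a) = h x *> a.
Proof. exact: linearZ. Qed.

End RightModuleTheory.

Definition fg_projective (R : pzRingType) (M : lmodType R) : Prop :=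
  exists (n : nat) (i : {linear M -> 'rV[R]_n}) (r : {linear 'rV[R]_n -> M}),
    cancel i r.

Definition central (A : pzRingType) (a : A) : Prop := forall b, a * b = b * a.

Definition invertible (A : pzRingType) (a : A) : Prop :=
  exists b, a * b = 1 /\ b * a = 1.

Definition inverse (A : pzRingType) (a : A) : A :=
  xget 0 [set b | a * b = 1 /\ b * a = 1].

(* The library's [algType] excludes the zero ring, which may occur here. *)
Record algebra_over (F : comPzRingType) (A : pzRingType) := AlgebraOver {
  alg_map :> {rmorphism F -> A};
  alg_map_central : forall c, central (alg_map c)
}.

(* The F-modules underlying an F-algebra and a right module over it. *)
Definition alg_module (F : comPzRingType) (A : pzRingType)
  (iota : algebra_over F A) : Type := A.

Definition res_module (F : comPzRingType) (A : pzRingType)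
  (iota : algebra_over F A) (P : lmodType A^c) : Type := P.

Section Restriction.
Variables (F : comPzRingType) (A : pzRingType) (iota : algebra_over F A).

HB.instance Definition _ := GRing.Zmodule.copy (alg_module iota) A.

Let alg_scale (c : F) (a : alg_module iota) : alg_module iota :=
  iota c * (a : A).
Fact alg_scaleA c d a : alg_scale c (alg_scale d a) = alg_scale (c * d) a.
Proof. by rewrite /alg_scale rmorphM mulrA. Qed.
Fact alg_scale1 : left_id 1 alg_scale.
Proof. by move=> a; rewrite /alg_scale rmorph1 mul1r. Qed.
Fact alg_scaleDr : right_distributive alg_scale +%R.
Proof. by move=> c a b; rewrite /alg_scale mulrDr. Qed.
Fact alg_scaleDl a : {morph alg_scale^~ a : c d / c + d}.
Proof. by move=> c d; rewrite /alg_scale rmorphD mulrDl. Qed.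
HB.instance Definition _ := GRing.Zmodule_isLmodule.Build F (alg_module iota)
  alg_scaleA alg_scale1 alg_scaleDr alg_scaleDl.

Variable P : lmodType A^c.

HB.instance Definition _ := GRing.Zmodule.copy (res_module iota P) P.

Let res_scale (c : F) (x : res_module iota P) : res_module iota P :=
  (x : P) *> iota c.
Fact res_scaleA c d x : res_scale c (res_scale d x) = res_scale (c * d) x.
Proof. by rewrite /res_scale rscaleA -rmorphM mulrC. Qed.
Fact res_scale1 : left_id 1 res_scale.
Proof. by move=> x; rewrite /res_scale rmorph1 rscale1. Qed.
Fact res_scaleDr : right_distributive res_scale +%R.
Proof. by move=> c x y; rewrite /res_scale rscaleDl. Qed.
Fact res_scaleDl x : {morph res_scale^~ x : c d / c + d}.
Proof. by move=> c d; rewrite /res_scale rmorphD rscaleDr. Qed.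
HB.instance Definition _ := GRing.Zmodule_isLmodule.Build F (res_module iota P)
  res_scaleA res_scale1 res_scaleDr res_scaleDl.

End Restriction.

Definition endo (A : pzRingType) (P : lmodType A^c) : Type := {linear P -> P}.

Section Endomorphisms.
Variables (A : pzRingType) (P : lmodType A^c).

HB.instance Definition _ := gen_eqMixin (endo P).
HB.instance Definition _ := gen_choiceMixin (endo P).

Lemma endoP (g h : endo P) : g =1 h -> g = h.
Proof.
case: g h => g [[gB] [gZ]] [h [[hB] [hZ]]] /= /funext /= eq_gh.
move: gB gZ; rewrite {}eq_gh => gB gZ.
by rewrite (Prop_irrelevance gB hB) (Prop_irrelevance gZ hZ).
Qed.

Let endo_zero : endo P := (\0 : {linear P -> P}).
Let endo_opp (g : endo P) : endo P := (\- g : {linear P -> P}).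
Let endo_add (g h : endo P) : endo P := (g \+ h : {linear P -> P}).

Fact endo_addA : associative endo_add.
Proof. by move=> f g h; apply/endoP => x /=; rewrite addrA. Qed.
Fact endo_addC : commutative endo_add.
Proof. by move=> f g; apply/endoP => x /=; rewrite addrC. Qed.
Fact endo_add0 : left_id endo_zero endo_add.
Proof. by move=> f; apply/endoP => x /=; rewrite add0r. Qed.
Fact endo_addN : left_inverse endo_zero endo_opp endo_add.
Proof. by move=> f; apply/endoP => x /=; rewrite addNr. Qed.
HB.instance Definition _ := GRing.isZmodule.Build (endo P)
  endo_addA endo_addC endo_add0 endo_addN.

End Endomorphisms.

(* For a K-algebra A, the K-module End_A(P) with (h c)(x) = h(x) c. *)
Definition endo_module (K : comPzRingType) (A : pzRingType)
  (iota : algebra_over K A) (P : lmodType A^c) : Type := endo P.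

Section EndoModule.
Variables (K : comPzRingType) (A : pzRingType) (iota : algebra_over K A).
Variable P : lmodType A^c.

Let cscale (c : K) (h : {linear P -> P}) (x : P) : P := h x *> iota c.
Fact cscale_is_linear c h : linear (cscale c h).
Proof.
move=> a x y; rewrite /cscale linearP rscaleDl; congr (_ + _).
by rewrite -![a *: _]/(_ *> (a : A)) !rscaleA alg_map_central.
Qed.
HB.instance Definition _ c h := GRing.isLinear.Build A^c P P *:%R
  (cscale c h) (cscale_is_linear c h).

HB.instance Definition _ := GRing.Zmodule.copy (endo_module iota P) (endo P).

Let endo_scale (c : K) (h : endo_module iota P) : endo_module iota P :=
  cscale c h : {linear P -> P}.
Fact endo_scaleA c d h : endo_scale c (endo_scale d h) = endo_scale (c * d) h.
Proof.
by apply/endoP => x; rewrite /= /cscale /= rscaleA -rmorphM mulrC.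
Qed.
Fact endo_scale1 : left_id 1 endo_scale.
Proof. by move=> h; apply/endoP => x; rewrite /= /cscale rmorph1 rscale1. Qed.
Fact endo_scaleDr : right_distributive endo_scale +%R.
Proof. by move=> c g h; apply/endoP => x; rewrite /= /cscale rscaleDl. Qed.
Fact endo_scaleDl h : {morph endo_scale^~ h : c d / c + d}.
Proof.
by move=> c d; apply/endoP => x; rewrite /= /cscale rmorphD rscaleDr.
Qed.
HB.instance Definition _ := GRing.Zmodule_isLmodule.Build K (endo_module iota P)
  endo_scaleA endo_scale1 endo_scaleDr endo_scaleDl.

End EndoModule.

(* The tensor product M ⊗_F T, where T is an F-algebra via j: formal sums of
   pairs, two of them being identified when every F-balanced biadditive map
   takes the same value on them; see tens_lift for the universal property. *)
Section Tensor.
Variables (F T : comPzRingType) (j : {rmorphism F -> T}) (M : lmodType F).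

Definition balanced (G : zmodType) (b : M -> T -> G) : Prop :=
  [/\ forall m m' t, b (m + m') t = b m t + b m' t,
      forall m t t', b m (t + t') = b m t + b m t' &
      forall c m t, b (c *: m) t = b m (j c * t)].

Definition formal_eval (G : zmodType) (b : M -> T -> G) (s : seq (M * T)) : G :=
  \sum_(p <- s) b p.1 p.2.

Definition tens_eq (s s' : seq (M * T)) : bool :=
  `[< forall (G : zmodType) (b : M -> T -> G), balanced b ->
        formal_eval b s = formal_eval b s' >].

Fact tens_eq_equiv : equiv_class_of tens_eq.
Proof.
split.
- by move=> s; apply/asboolP.
- by move=> s s'; apply/asboolP/asboolP => h G b /h.
- move=> s s' s'' /asboolP h /asboolP h'; apply/asboolP => G b bb.
  by rewrite h // h'.
Qed.
Canonical tens_eq_equiv_rel := EquivRelPack tens_eq_equiv.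

Definition tensor : Type := {eq_quot tens_eq}.
HB.instance Definition _ := Choice.on tensor.
HB.instance Definition _ := EqQuotient.on tensor.

Definition tens (m : M) (t : T) : tensor := \pi_tensor [:: (m, t)].

Definition tens_lift (G : zmodType) (b : M -> T -> G) (X : tensor) : G :=
  formal_eval b (repr X).

Lemma tens_lift_pi G b s : @balanced G b ->
  tens_lift b (\pi_tensor s) = formal_eval b s.
Proof.
move=> bb; rewrite /tens_lift.
have /eqmodP/asboolP : repr (\pi_tensor s) = s %[mod tensor] by rewrite reprK.
exact.
Qed.

Lemma tensor_eqP (s s' : seq (M * T)) :
  (forall (G : zmodType) (b : M -> T -> G), balanced b ->
     formal_eval b s = formal_eval b s') -> \pi_tensor s = \pi_tensor s'.
Proof. by move=> h; apply/eqmodP/asboolP. Qed.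

Lemma balancedNl G b m t : @balanced G b -> b (- m) t = - b m t.
Proof.
case=> bD _ _; apply: (addrI (b m t)); rewrite -bD !subrr.
by apply: (addrI (b 0 t)); rewrite -bD !addr0.
Qed.

Let tens_zero : tensor := \pi_tensor [::].
Let tens_opp (X : tensor) : tensor :=
  \pi_tensor [seq (- p.1, p.2) | p <- repr X].
Let tens_add (X Y : tensor) : tensor := \pi_tensor (repr X ++ repr Y).

Let formal_cat G b s s' :
  @formal_eval G b (s ++ s') = formal_eval b s + formal_eval b s'.
Proof. exact: big_cat. Qed.

Let tensor_ext (X Y : tensor) :
  (forall (G : zmodType) (b : M -> T -> G), balanced b ->
     tens_lift b X = tens_lift b Y) -> X = Y.
Proof. by move=> h; rewrite -[X]reprK -[Y]reprK; apply: tensor_eqP. Qed.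

Let lift_zero G b : @balanced G b -> tens_lift b tens_zero = 0.
Proof. by move=> bb; rewrite tens_lift_pi // /formal_eval big_nil. Qed.
Let lift_add G b X Y : @balanced G b ->
  tens_lift b (tens_add X Y) = tens_lift b X + tens_lift b Y.
Proof. by move=> bb; rewrite tens_lift_pi // formal_cat. Qed.
Let lift_opp G b X : @balanced G b ->
  tens_lift b (tens_opp X) = - tens_lift b X.
Proof.
move=> bb; rewrite tens_lift_pi // /formal_eval big_map -sumrN.
by apply: eq_bigr => p _ /=; rewrite balancedNl.
Qed.

Fact tens_addA : associative tens_add.
Proof. by move=> X Y Z; apply: tensor_ext => G b bb; rewrite !lift_add // addrA. Qed.
Fact tens_addC : commutative tens_add.
Proof. by move=> X Y; apply: tensor_ext => G b bb; rewrite !lift_add // addrC. Qed.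
Fact tens_add0 : left_id tens_zero tens_add.
Proof. by move=> X; apply: tensor_ext => G b bb; rewrite lift_add // lift_zero // add0r. Qed.
Fact tens_addN : left_inverse tens_zero tens_opp tens_add.
Proof.
move=> X; apply: tensor_ext => G b bb.
by rewrite lift_add // lift_opp // lift_zero // addNr.
Qed.
HB.instance Definition _ := GRing.isZmodule.Build tensor
  tens_addA tens_addC tens_add0 tens_addN.

Lemma tens_liftE G b m t : @balanced G b -> tens_lift b (tens m t) = b m t.
Proof. by move=> bb; rewrite tens_lift_pi // /formal_eval big_seq1. Qed.

Lemma tens_liftD G b X Y : @balanced G b ->
  tens_lift b (X + Y) = tens_lift b X + tens_lift b Y.
Proof. exact: lift_add. Qed.

Lemma eq_tens_lift (G : zmodType) (b b' : M -> T -> G) X : b =2 b' ->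
  tens_lift b X = tens_lift b' X.
Proof. by move=> e; apply: eq_bigr => p _. Qed.

Lemma tens_lift_add (G : zmodType) (b b' : M -> T -> G) X :
  tens_lift (fun m t => b m t + b' m t) X = tens_lift b X + tens_lift b' X.
Proof. exact: big_split. Qed.

Lemma tens_balanced : balanced tens.
Proof.
split=> [m m' t|m t t'|c m t]; apply: tensor_ext => G b bb;
  rewrite ?tens_liftD // !tens_liftE //; by case: bb.
Qed.

Lemma tensDl m m' t : tens (m + m') t = tens m t + tens m' t.
Proof. by case: tens_balanced. Qed.
Lemma tensDr m t t' : tens m (t + t') = tens m t + tens m t'.
Proof. by case: tens_balanced. Qed.
Lemma tensZ c m t : tens (c *: m) t = tens m (j c * t).
Proof. by case: tens_balanced. Qed.

Lemma tens_sum (X : tensor) : X = \sum_(p <- repr X) tens p.1 p.2.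
Proof.
apply: tensor_ext => G b bb; rewrite {1}/tens_lift /formal_eval.
elim: (repr X) => [|p s IHs]; first by rewrite !big_nil lift_zero.
by rewrite !big_cons tens_liftD // -IHs tens_liftE.
Qed.

Lemma tensor_ind (Q : tensor -> Prop) :
  Q 0 -> (forall X Y, Q X -> Q Y -> Q (X + Y)) -> (forall m t, Q (tens m t)) ->
  forall X, Q X.
Proof.
move=> Q0 QD Qt X; rewrite [X]tens_sum.
by elim/big_ind: _ => // p _; apply: Qt.
Qed.

End Tensor.

Section TensorMaps.
Variables (F T : comPzRingType) (j : {rmorphism F -> T}).

Definition tens_map (M N : lmodType F) (g : M -> N) (X : tensor j M) :
  tensor j N := tens_lift (fun m t => tens j (g m) t) X.

Lemma tens_map_balanced (M N : lmodType F) (g : M -> N) : linear g ->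
  balanced j (fun m t => tens j (g m) t).
Proof.
move=> gL; pose gl := GRing.isLinear.Build _ _ _ _ g gL.
pose h : {linear M -> N} := HB.pack g gl.
by split=> *; rewrite -?[g]/(h : _ -> _) ?linearD ?linearZ ?tensDl ?tensDr ?tensZ.
Qed.

Lemma tens_mapE (M N : lmodType F) (g : M -> N) m t : linear g ->
  tens_map g (tens j m t) = tens j (g m) t.
Proof. by move=> gL; rewrite /tens_map tens_liftE //; apply: tens_map_balanced. Qed.

Lemma tens_mapD (M N : lmodType F) (g : M -> N) X Y : linear g ->
  tens_map g (X + Y) = tens_map g X + tens_map g Y.
Proof. by move=> gL; rewrite /tens_map tens_liftD //; apply: tens_map_balanced. Qed.

Variables (M1 M2 M3 : lmodType F).

Definition bilinear_map (b : M1 -> M2 -> M3) : Prop :=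
  (forall y, linear (b^~ y)) /\ (forall x, linear (b x)).

Definition tens_map2 (b : M1 -> M2 -> M3) (X : tensor j M1) (Y : tensor j M2) :
    tensor j M3 :=
  tens_lift (fun m t => tens_lift (fun n t' => tens j (b m n) (t * t')) Y) X.

Variable b : M1 -> M2 -> M3.
Hypothesis bb : bilinear_map b.

Let bDl m m' n : b (m + m') n = b m n + b m' n.
Proof. by have := bb.1 n 1 m m'; rewrite !scale1r. Qed.
Let bDr m n n' : b m (n + n') = b m n + b m n'.
Proof. by have := bb.2 m 1 n n'; rewrite !scale1r. Qed.
Let b0l n : b 0 n = 0.
Proof. by apply: (addrI (b 0 n)); rewrite -bDl !addr0. Qed.
Let b0r m : b m 0 = 0.
Proof. by apply: (addrI (b m 0)); rewrite -bDr !addr0. Qed.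
Let bZl c m n : b (c *: m) n = c *: b m n.
Proof. by have := bb.1 n c m 0; rewrite /= b0l !addr0. Qed.
Let bZr c m n : b m (c *: n) = c *: b m n.
Proof. by have := bb.2 m c n 0; rewrite b0r !addr0. Qed.

Let inner_balanced m t :
  balanced j (fun n t' => tens j (b m n) (t * t')).
Proof.
split=> [n n' k|n k k'|c n k]; first by rewrite bDr tensDl.
  by rewrite mulrDr tensDr.
by rewrite bZr tensZ mulrCA.
Qed.

Let outer_balanced (Y : tensor j M2) : balanced j
  (fun m t => tens_lift (fun n t' => tens j (b m n) (t * t')) Y).
Proof.
split=> [m m' t|m t t'|c m t].
- apply: (etrans _ (tens_lift_add _ _ _)).
  by apply: eq_tens_lift => n k; rewrite bDl tensDl.
- apply: (etrans _ (tens_lift_add _ _ _)).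
  by apply: eq_tens_lift => n k; rewrite mulrDl tensDr.
- by apply: eq_tens_lift => n k; rewrite bZl tensZ mulrA.
Qed.

Lemma tens_map2E m t n t' :
  tens_map2 b (tens j m t) (tens j n t') = tens j (b m n) (t * t').
Proof. by rewrite /tens_map2 !tens_liftE. Qed.

Lemma tens_map2Dl X X' Y :
  tens_map2 b (X + X') Y = tens_map2 b X Y + tens_map2 b X' Y.
Proof. by rewrite /tens_map2 tens_liftD. Qed.

Lemma tens_map2Dr X Y Y' :
  tens_map2 b X (Y + Y') = tens_map2 b X Y + tens_map2 b X Y'.
Proof.
apply: (etrans _ (tens_lift_add _ _ _)).
by apply: eq_tens_lift => m t; rewrite tens_liftD.
Qed.

Lemma tens_map20l Y : tens_map2 b 0 Y = 0.
Proof. by apply: (addrI (tens_map2 b 0 Y)); rewrite -tens_map2Dl !addr0. Qed.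

Lemma tens_map20r X : tens_map2 b X 0 = 0.
Proof. by apply: (addrI (tens_map2 b X 0)); rewrite -tens_map2Dr !addr0. Qed.

End TensorMaps.

Definition ext_ring (F T : comPzRingType) (j : {rmorphism F -> T})
  (A : pzRingType) (iota : algebra_over F A) : Type :=
  tensor j (alg_module iota).

Definition ext_module (F T : comPzRingType) (j : {rmorphism F -> T})
  (A : pzRingType) (iota : algebra_over F A) (P : lmodType A^c) : Type :=
  tensor j (res_module iota P).

Section ScalarExtension.
Variables (F T : comPzRingType) (j : {rmorphism F -> T}).
Variables (A : pzRingType) (iota : algebra_over F A).
Local Notation AF := (alg_module iota).
Local Notation AT := (ext_ring j iota).
Local Notation tensA a t := (tens j (a : AF) t : AT).

HB.instance Definition _ := GRing.Zmodule.copy AT (tensor j AF).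

Let amul (a b : AF) : AF := (a : A) * (b : A).
Let amul_bilinear : bilinear_map amul.
Proof.
split=> [b c a a'|a c b b']; rewrite /amul.
  by rewrite mulrDl -[c *: a]/(iota c * a) -mulrA.
rewrite mulrDr -[c *: b]/(iota c * b) mulrA -alg_map_central -mulrA.
by [].
Qed.

Let ext_one : AT := tensA 1 1.
Let ext_mul : AT -> AT -> AT := tens_map2 amul.

Fact ext_mulDl : left_distributive ext_mul +%R.
Proof. by move=> X Y Z; apply: tens_map2Dl. Qed.
Fact ext_mulDr : right_distributive ext_mul +%R.
Proof. by move=> X Y Z; apply: tens_map2Dr. Qed.
Let ext_mul0l Z : ext_mul 0 Z = 0. Proof. exact: tens_map20l. Qed.
Let ext_mul0r Z : ext_mul Z 0 = 0. Proof. exact: tens_map20r. Qed.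
Fact ext_mulA : associative ext_mul.
Proof.
move=> X Y Z; elim/tensor_ind: X => [|X X' hX hX'|a t].
- by rewrite !ext_mul0l.
- by rewrite !ext_mulDl hX hX'.
elim/tensor_ind: Y => [|Y Y' hY hY'|b s].
- by rewrite !(ext_mul0l, ext_mul0r).
- by rewrite !(ext_mulDl, ext_mulDr) hY hY'.
elim/tensor_ind: Z => [|Z Z' hZ hZ'|c r].
- by rewrite !ext_mul0r.
- by rewrite !ext_mulDr hZ hZ'.
by rewrite /ext_mul !tens_map2E // /amul !mulrA.
Qed.
Fact ext_mul1l : left_id ext_one ext_mul.
Proof.
move=> X; elim/tensor_ind: X => [|X X' hX hX'|a t].
- exact: ext_mul0r.
- by rewrite ext_mulDr hX hX'.
by rewrite /ext_mul tens_map2E // /amul !mul1r.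
Qed.
Fact ext_mul1r : right_id ext_one ext_mul.
Proof.
move=> X; elim/tensor_ind: X => [|X X' hX hX'|a t].
- exact: ext_mul0l.
- by rewrite ext_mulDl hX hX'.
by rewrite /ext_mul tens_map2E // /amul !mulr1.
Qed.
HB.instance Definition _ := GRing.Zmodule_isPzRing.Build AT
  ext_mulA ext_mul1l ext_mul1r ext_mulDl ext_mulDr.

Lemma ext_mulE (a b : A) (s t : T) :
  tensA a s * tensA b t = tensA (a * b) (s * t).
Proof. exact: tens_map2E. Qed.

Definition ext_scalar (t : T) : AT := tensA 1 t.
Fact ext_scalar_is_zmod_morphism : zmod_morphism ext_scalar.
Proof.
move=> s t; apply/eqP; rewrite eq_sym subr_eq; apply/eqP.
by rewrite /ext_scalar -tensDr subrK.
Qed.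
Fact ext_scalar_is_monoid_morphism : monoid_morphism ext_scalar.
Proof. by split=> // s t; rewrite /ext_scalar ext_mulE mulr1. Qed.
HB.instance Definition _ := GRing.isZmodMorphism.Build T AT ext_scalar
  ext_scalar_is_zmod_morphism.
HB.instance Definition _ := GRing.isMonoidMorphism.Build T AT ext_scalar
  ext_scalar_is_monoid_morphism.
Fact ext_scalar_central t : central (ext_scalar t).
Proof.
move=> X; elim/tensor_ind: X => [|X X' hX hX'|a s].
- by rewrite mulr0 mul0r.
- by rewrite mulrDr mulrDl hX hX'.
by rewrite /ext_scalar !ext_mulE mul1r mulr1 mulrC.
Qed.
Definition ext_algebra : algebra_over T AT := AlgebraOver ext_scalar_central.

Variable P : lmodType A^c.
Local Notation PF := (res_module iota P).
Local Notation PT := (ext_module j iota P).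
Local Notation tensP x k := (tens j (x : PF) k : PT).

HB.instance Definition _ := GRing.Zmodule.copy PT (tensor j PF).

Let pmul (x : PF) (a : AF) : PF := (x : P) *> (a : A).
Let pmul_bilinear : bilinear_map pmul.
Proof.
split=> [a c x y|x c a b]; rewrite /pmul.
  rewrite rscaleDl -[c *: x]/((x : P) *> iota c) rscaleA alg_map_central.
  by rewrite -rscaleA.
rewrite rscaleDr -[c *: a]/(iota c * a) alg_map_central -rscaleA.
by [].
Qed.

Let ext_scale (X : AT^c) (Y : PT) : PT := tens_map2 pmul Y (X : AT).
Fact ext_scaleDr : right_distributive ext_scale +%R.
Proof. by move=> X Y Z; apply: tens_map2Dl. Qed.
Fact ext_scaleDl Y : {morph ext_scale^~ Y : X X' / X + X'}.
Proof. by move=> X X'; apply: tens_map2Dr. Qed.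
Let ext_scale0l Y : ext_scale 0 Y = 0. Proof. exact: tens_map20r. Qed.
Let ext_scale0r X : ext_scale X 0 = 0. Proof. exact: tens_map20l. Qed.
Fact ext_scaleA X X' Y : ext_scale X (ext_scale X' Y) = ext_scale (X * X') Y.
Proof.
elim/tensor_ind: Y => [|Y Y' hY hY'|x k].
- by rewrite !ext_scale0r.
- by rewrite !ext_scaleDr hY hY'.
change (ext_scale X (ext_scale X' (tensP x k)) =
  ext_scale ((X' : AT) * (X : AT)) (tensP x k)).
elim/tensor_ind: X => [|X Y hX hY|a t].
- by rewrite mulr0 !ext_scale0l.
- by rewrite mulrDr !ext_scaleDl hX hY.
elim/tensor_ind: X' => [|X Y hX hY|b s].
- by rewrite mul0r !ext_scale0l ext_scale0r.
- by rewrite mulrDl !ext_scaleDl ext_scaleDr hX hY.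
by rewrite ext_mulE /ext_scale !tens_map2E // /pmul rscaleA mulrA.
Qed.
Fact ext_scale1 : left_id 1 ext_scale.
Proof.
move=> Y; elim/tensor_ind: Y => [|Y Y' hY hY'|x k].
- exact: ext_scale0r.
- by rewrite ext_scaleDr hY hY'.
rewrite -[1 : AT^c]/(ext_one : AT) /ext_scale tens_map2E //.
by rewrite /pmul rscale1 mulr1.
Qed.
HB.instance Definition _ := GRing.Zmodule_isLmodule.Build AT^c PT
  ext_scaleA ext_scale1 ext_scaleDr ext_scaleDl.

Lemma ext_rscaleE (x : P) (k : T) (a : A) (t : T) :
  tensP x k *> tensA a t = tensP (x *> a) (k * t).
Proof. exact: tens_map2E. Qed.

Definition ext_map (h : {linear P -> P}) : PT -> PT :=
  tens_map (h : PF -> PF).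

Let res_linear (h : {linear P -> P}) : linear (h : PF -> PF).
Proof.
move=> c x y; rewrite -[c *: x]/((x : P) *> iota c) linearD linear_rscale.
by [].
Qed.

Lemma ext_mapE (h : {linear P -> P}) (x : P) (k : T) :
  ext_map h (tensP x k) = tensP (h x) k.
Proof. exact: tens_mapE. Qed.

Fact ext_map_is_linear h : linear (ext_map h).
Proof.
have hD X Y : ext_map h (X + Y) = ext_map h X + ext_map h Y by apply: tens_mapD.
have h0 : ext_map h 0 = 0 by apply: (addrI (ext_map h 0)); rewrite -hD !addr0.
suff hZ (X : AT) (Y : PT) : ext_map h (Y *> X) = ext_map h Y *> X.
  by move=> X Y Z; rewrite hD; congr (_ + _); apply: hZ.
elim/tensor_ind: Y => [|Y Y' hY hY'|x k].
- by rewrite h0 /rscale scaler0 h0.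
- by rewrite rscaleDl !hD rscaleDl hY hY'.
elim/tensor_ind: X => [|X X' hX hX'|a t].
- by rewrite /rscale !(@scale0r AT^c) h0.
- by rewrite !rscaleDr hD hX hX'.
by rewrite ext_rscaleE !ext_mapE ext_rscaleE linear_rscale.
Qed.
HB.instance Definition _ h := GRing.isLinear.Build AT^c PT PT *:%R
  (ext_map h) (ext_map_is_linear h).

Definition ext_endo (h : {linear P -> P}) : {linear PT -> PT} := ext_map h.

Definition ext_invol (sigma : A -> A) : AT -> AT :=
  tens_map (sigma : AF -> AF).

Definition ext_unit (u : A) : AT := tensA u 1.

Definition ext_param (Lambda : set A) : set AT :=
  [set X | exists s : seq (A * T), (forall p, p \in s -> Lambda p.1) /\
     X = \sum_(p <- s) tensA p.1 p.2].

Definition ext_form (f : P -> P -> A) : PT -> PT -> AT :=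
  tens_map2 (f : PF -> PF -> AF).

End ScalarExtension.

Arguments ext_endo {F T} j {A} iota {P} h.
Arguments ext_invol {F T} j {A} iota sigma _.
Arguments ext_unit {F T} j {A} iota u.
Arguments ext_param {F T} j {A} iota Lambda _.
Arguments ext_form {F T} j {A} iota {P} f _ _.

Section RingNotions.
Variable B : pzRingType.
Implicit Types (I J : set B).

Definition additive_subgroup I : Prop :=
  I 0 /\ forall a b, I a -> I b -> I (a - b).

Definition right_ideal I : Prop :=
  additive_subgroup I /\ forall a b, I a -> I (a * b).

Definition two_sided_ideal I : Prop :=
  right_ideal I /\ forall a b, I a -> I (b * a).

Definition maximal_right_ideal I : Prop :=
  [/\ right_ideal I, I <> setT &
      forall J, right_ideal J -> I `<=` J -> J = I \/ J = setT].

Definition jacobson : set B :=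
  [set b | forall I, maximal_right_ideal I -> I b].

Definition right_artinian : Prop :=
  forall I : nat -> set B, (forall n, right_ideal (I n)) ->
    (forall n, I n.+1 `<=` I n) ->
    exists N, forall n, (N <= n)%N -> I n = I N.

Definition semisimple : Prop :=
  forall I, right_ideal I -> exists J, [/\ right_ideal J,
    I `&` J = [set 0] & forall b, exists x y, [/\ I x, J y & b = x + y]].

End RingNotions.

Definition artinian (B : pzRingType) : Prop :=
  right_artinian B /\ right_artinian B^c.

(* The ring S plays the role of B / Jac(B). *)
Definition semilocal (B : pzRingType) : Prop :=
  exists (S : pzRingType) (p : {rmorphism B -> S}),
    [/\ forall s, exists b, p b = s,
        forall b, p b = 0 <-> jacobson b,
        semisimple S & artinian S].

Section UnitaryRings.
Variables (A : pzRingType) (sigma : A -> A) (u : A) (Lambda : set A).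

Definition involution : Prop :=
  [/\ {morph sigma : a b / a + b}, forall a b, sigma (a * b) = sigma b * sigma a,
      sigma 1 = 1 & involutive sigma].

Definition Lambda_min : set A := [set a - sigma a * u | a in setT].
Definition Lambda_max : set A := [set a | sigma a * u = - a].

Definition form_parameter : Prop :=
  [/\ additive_subgroup Lambda, Lambda_min `<=` Lambda, Lambda `<=` Lambda_max &
      forall a x, Lambda x -> Lambda (sigma a * x * a)].

Definition unitary_ring : Prop :=
  [/\ involution, central u, sigma u * u = 1 & form_parameter].

Definition unitary_algebra (F : comPzRingType) (iota : algebra_over F A) :=
  [/\ unitary_ring, forall c a, sigma (iota c * a) = iota c * sigma a &
      forall c x, Lambda x -> Lambda (iota c * x)].

Definition simple_artinian_unitary : Prop :=
  [/\ unitary_ring, artinian A, (1 : A) <> 0 &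
      forall I : set A, two_sided_ideal I -> sigma @` I = I ->
        I = [set 0] \/ I = setT].

(* Given an isomorphism theta of A with a matrix algebra, sigma is the adjoint
   involution of the bilinear form with Gram matrix G. *)
Definition adjoint_to (L : fieldType) (n : nat) (theta : A -> 'M[L]_n)
    (G : 'M[L]_n) : Prop :=
  G \in unitmx /\ forall a, theta (sigma a) = invmx G *m (theta a)^T *m G.

Definition orthogonal_involution (L : fieldType) (n : nat)
    (theta : A -> 'M[L]_n) : Prop :=
  exists2 G : 'M[L]_n, G^T = G & adjoint_to theta G.

(* The condition on G means "alternating" only when 2 is invertible in L, which
   is the only case in which this notion is used. *)
Definition symplectic_involution (L : fieldType) (n : nat)
    (theta : A -> 'M[L]_n) : Prop :=
  exists2 G : 'M[L]_n, G^T = - G & adjoint_to theta G.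

Definition split_orthogonal : Prop :=
  simple_artinian_unitary /\
  exists (L : fieldType) (n : nat) (theta : {rmorphism A -> 'M[L]_n}),
    [/\ (0 < n)%N, bijective theta, forall z, central z -> sigma z = z &
        [\/ [/\ 2%N \notin [pchar L], orthogonal_involution theta & u = 1],
            [/\ 2%N \notin [pchar L], symplectic_involution theta & u = - 1] |
            2%N \in [pchar L] /\ Lambda = Lambda_min]].

End UnitaryRings.

Section QuadraticSpaces.
Variables (A : pzRingType) (sigma : A -> A) (u : A) (Lambda : set A).
Variable P : lmodType A^c.

(* Elements of P^* = Hom_A(P, A) are functions P -> A satisfying [dual]; elements
   of Hom_A(P, P^* ) are functions P -> (P -> A) satisfying [dual_hom]. *)
Definition dual (phi : P -> A) : Prop :=
  (forall x y, phi (x + y) = phi x + phi y) /\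
  (forall x a, phi (x *> a) = phi x * a).

Definition dual_scale (phi : P -> A) (a : A) : P -> A :=
  fun x => sigma a * phi x.

Definition dual_hom (f : P -> P -> A) : Prop :=
  [/\ forall x, dual (f x), forall x y, f (x + y) = f x \+ f y &
      forall x a, f (x *> a) = dual_scale (f x) a].

Definition omega (x : P) : (P -> A) -> A := fun phi => sigma (phi x) * u.

(* The composite of omega : P -> P^** with f^* : P^** -> P^*. *)
Definition form_transpose (f : P -> P -> A) (x : P) : P -> A := omega x \o f.

Definition Lambda_forms (f : P -> P -> A) : Prop :=
  [/\ dual_hom f, forall x, f x = \- form_transpose f x &
      forall x, Lambda (f x x)].

(* f represents the class [f] modulo [Lambda_forms]. *)
Definition quadratic_space (f : P -> P -> A) : Prop :=
  fg_projective P /\ dual_hom f.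

Definition hermitian_form (f : P -> P -> A) (x : P) : P -> A :=
  f x \+ form_transpose f x.

Definition unimodular (f : P -> P -> A) : Prop :=
  forall phi, dual phi -> exists! x, hermitian_form f x = phi.

Definition isometry_group (f : P -> P -> A) : set {linear P -> P} :=
  [set phi | bijective phi /\
             Lambda_forms (fun x => (f (phi x) \o phi) \- f x)].

End QuadraticSpaces.

Section ScalarExtensionTheory.
Variables (F T : comPzRingType) (j : {rmorphism F -> T}).
Variables (A : pzRingType) (iota : algebra_over F A).
Variables (sigma : A -> A) (u : A) (Lambda : set A).
Hypothesis unitaryA : unitary_algebra sigma u Lambda iota.
Local Notation tensA a t := (tens j (a : alg_module iota) t : ext_ring j iota).

Lemma ext_involE a t : ext_invol j iota sigma (tensA a t) = tensA (sigma a) t.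
Proof.
case: unitaryA => -[[sD _ _ _] _ _ _] sZ _; apply: tens_mapE => c x y.
by rewrite sD sZ.
Qed.

Lemma ext_formE (P : lmodType A^c) (f : P -> P -> A) x k y k' :
  dual_hom sigma f ->
  ext_form j iota f (tens j (x : res_module iota P) k)
                    (tens j (y : res_module iota P) k')
  = tensA (f x y) (k * k').
Proof.
case: unitaryA => -[[_ _ s1 _] _ _ _] sZ _ [fd fD fZ]; apply: tens_map2E.
split=> [z c x1 x2|z c x1 x2].
- rewrite -[c *: x1]/((x1 : P) *> iota c) fD fZ /= /dual_scale.
  by have := sZ c 1; rewrite !(s1, mulr1) => ->.
- rewrite -[c *: x1]/((x1 : P) *> iota c) (fd z).1 (fd z).2.
  by rewrite -alg_map_central.
Qed.

End ScalarExtensionTheory.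

Section Dickson.
Variables (A : pzRingType) (P : lmodType A^c).

(* Dimension over Cent(A) of a Cent(A)-subspace W of End_A(P); it is set to 0
   when there is no finite basis. *)
Definition center_basis (W : set {linear P -> P}) (d : nat)
    (e : 'I_d -> {linear P -> P}) : Prop :=
  [/\ forall i, W (e i),
      forall h, W h -> exists c : 'I_d -> A, (forall i, central (c i)) /\
        forall x, h x = \sum_i e i x *> c i &
      forall c : 'I_d -> A, (forall i, central (c i)) ->
        (forall x, \sum_i e i x *> c i = 0) -> forall i, c i = 0].

Definition center_dim (W : set {linear P -> P}) : nat :=
  xget 0%N [set d | exists e, @center_basis W d e].

(* deg E is the square root of dim_L E. *)
Definition degree : nat := xget 0%N [set m | (m ^ 2)%N = center_dim setT].

(* dim_L (1 - psi)E / deg E mod 2, where E = End_A(P). *)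
Definition dickson (psi : P -> P) : 'Z_2 :=
  (center_dim [set h | exists e : {linear P -> P},
                 forall x, h x = e x - psi (e x)] %/ degree)%:R.

End Dickson.

Section DicksonSemilocal.
Variables (B : pzRingType) (tau : B -> B) (v : B) (Gamma : set B).
Variables (Q : lmodType B^c) (g : Q -> Q -> B).

Definition module_jacobson : set Q :=
  [set x | exists s : seq (Q * B), (forall p, p \in s -> jacobson p.2) /\
     x = \sum_(p <- s) p.1 *> p.2].

(* The factorizations B / Jac(B) = prod_i B_i and Q / Q Jac(B) = prod_i Q_i,
   given by their projections B -> B_i and Q -> Q_i. *)
Record factorization := Factorization {
  fact_size : nat;
  fact_ring : 'I_fact_size -> pzRingType;
  fact_invol : forall i, fact_ring i -> fact_ring i;
  fact_unit : forall i, fact_ring i;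
  fact_param : forall i, set (fact_ring i);
  fact_proj : forall i, {rmorphism B -> fact_ring i};
  fact_simple : forall i,
    simple_artinian_unitary (@fact_invol i) (fact_unit i) (@fact_param i);
  fact_proj_surj : forall y : forall i, fact_ring i,
    exists b, forall i, fact_proj i b = y i;
  fact_proj_ker : forall b, (forall i, fact_proj i b = 0) <-> jacobson b;
  fact_involE : forall i b, fact_invol (fact_proj i b) = fact_proj i (tau b);
  fact_unitE : forall i, fact_unit i = fact_proj i v;
  fact_paramE : forall y : forall i, fact_ring i,
    (forall i, fact_param (y i)) <->
    (exists2 b, Gamma b & forall i, fact_proj i b = y i);
  fact_module : forall i, lmodType (fact_ring i)^c;
  fact_mproj : forall i, Q -> fact_module i;
  fact_mprojD : forall i x y,
    fact_mproj i (x + y) = fact_mproj i x + fact_mproj i y;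
  fact_mprojZ : forall i x b,
    fact_mproj i (x *> b) = fact_mproj i x *> fact_proj i b;
  fact_mproj_surj : forall y : forall i, fact_module i,
    exists x, forall i, fact_mproj i x = y i;
  fact_mproj_ker : forall x,
    (forall i, fact_mproj i x = 0) <-> module_jacobson x;
  fact_form : forall i, fact_module i -> fact_module i -> fact_ring i;
  fact_formE : forall i x y,
    fact_form (fact_mproj i x) (fact_mproj i y) = fact_proj i (g x y)
}.

Arguments fact_ring D i : clear implicits, rename.
Arguments fact_invol D i _ : clear implicits, rename.
Arguments fact_unit D i : clear implicits, rename.
Arguments fact_param D i : clear implicits, rename.
Arguments fact_module D i : clear implicits, rename.
Arguments fact_mproj D i _ : clear implicits, rename.

Variable D : factorization.

Definition dickson_index : Type :=
  {i : 'I_(fact_size D) |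
    split_orthogonal (fact_invol D i) (fact_unit D i) (fact_param D i) /\
    exists x : fact_module D i, x <> 0}.

(* The endomorphism of Q_i induced by phi. *)
Definition induced (phi : Q -> Q) (i : 'I_(fact_size D))
    (y : fact_module D i) : fact_module D i :=
  fact_mproj D i (phi (xget 0 [set x | fact_mproj D i x = y])).

Definition dickson_map (phi : Q -> Q) (i : dickson_index) : 'Z_2 :=
  dickson (@induced phi (sval i)).

Definition dickson_kernel : set {linear Q -> Q} :=
  [set phi | isometry_group tau v Gamma g phi /\
             forall i, dickson_map phi i = 0].

End DicksonSemilocal.

(* Closure of S for the canonical topology of a finitely generated projective
   K-module M: the topology induced from K^n by a split embedding i, so that
   x lies in the closure of S iff i x lies in the closure of i(S). *)
Definition fgp_closure (K : comTopologicalRingType) (M : lmodType K)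
    (S : set M) : set M :=
  [set x | exists (n : nat) (i : {linear M -> 'rV[K]_n})
             (r : {linear 'rV[K]_n -> M}),
     cancel i r /\ closure (i @` S) (i x)].

Definition is_summand (F : comPzRingType) (M : lmodType F) (N : set M) : Prop :=
  let submodule (X : set M) := X 0 /\ forall c x y, X x -> X y -> X (c *: x + y) in
  submodule N /\ exists N' : set M,
    [/\ submodule N', N `&` N' = [set 0] &
        forall x, exists y z, [/\ N y, N' z & x = y + z]].

Definition left_cosets (A : pzRingType) (P : lmodType A^c)
    (G H : set {linear P -> P}) : set (set {linear P -> P}) :=
  [set [set (r \o h : {linear P -> P}) | h in H] | r in G].

(* Main.v *)
From HB Require Import structures.
Require Import Defs.
From mathcomp Require Import all_boot all_order all_algebra generic_quotient.
From mathcomp Require Import all_classical.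
From mathcomp Require Import topology tvs.

Set Implicit Arguments.
Unset Strict Implicit.
Unset Printing Implicit Defensive.

Import GRing.Theory.

Local Open Scope classical_set_scope.
Local Open Scope quotient_scope.
Local Open Scope ring_scope.

(** Let E be the endomorphism ring of P_K with the adjoint involution of the hermitian form h of
    f_K, and let eps in E represent f_K, that is f_K(x, y) = h(x, eps y), so that eps + eps^* = 1.
    Lambda-forms become a form parameter of E, and isometries become the unitary elements phi for
    which phi^* eps phi - eps lies in it ([hs_isoP]). The records [hspace] and [rational_form] keep
    the hermitian data and the F-structure of E.

    The mechanism is a parametrisation of isometries in the spirit of Cayley and Wall. Let i be the
    row (1, 1, 0, 0) over E. If g is an invertible 4 by 4 matrix that differs from i^* eps i by a
    Lambda-matrix, then 1 - i g^-1 i^* is an isometry ([transformation_iso]). The admissible g lie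
    in the translate by i^* eps i of the K-span of Lambda-matrices defined over F. As F is dense in
    K, g is a limit of admissible matrices over F. Near g these stay invertible, because
    invertibility is detected by a determinant and K^x is open; their inverses vary continuously by
    Cramer's rule; and the inverses are defined over F because F meets K^x in F^x. So every isometry
    of this shape is a limit of isometries over F ([transformation_dense]).

    It remains to produce enough isometries of this shape. For a = 1 - phi, one completes a to an
    invertible matrix by a border. This succeeds as soon as, modulo the radical J of E, some
    Lambda-form is nondegenerate on the image of a ([bordered_inverse]). Such forms are built over
    each simple factor of A_K modulo its radical ([factor_form]). The only obstruction met is in
    split-orthogonal factors, where the form is taken alternating and the image must have even rank;
    the Dickson invariant is the parity of that rank ([center_dim_image]). The forms are then lifted
    back together ([dickson_transformation]). This proves the inclusion of the kernel.

    For the index, K being semilocal makes the radical of P_K a finite intersection of maximal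
    submodules ([ext_finite_rad]). Modulo the radical, the image of 1 - phi has a complement cut out
    by some of them ([relative_inverse]); the choice is the mask of phi. If phi and psi have the
    same mask, the images of 1 - phi and 1 - psi have a common complement, so the Wall form of phi
    pairs them, and phi psi has the required shape ([transformation_same_mask]). Thus the closure
    contains phi psi whenever the masks agree, and in particular all squares. It is therefore
    normal, and the quotient is an elementary abelian 2-group whose order is bounded by the number
    of masks ([coset_card]). *)

(** * Deciding identities in abelian groups by reflection *)

Inductive zexp := ZVar of nat | ZZero | ZOpp of zexp | ZAdd of zexp & zexp.

Fixpoint zeval (V : zmodType) (env : seq V) e : V :=
  match e with
  | ZVar n => env`_n
  | ZZero => 0
  | ZOpp e => - zeval env e
  | ZAdd e e' => zeval env e + zeval env e'
  end.

Fixpoint zcoef e (i : nat) : int :=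
  match e with
  | ZVar n => (n == i)%:Z
  | ZZero => 0
  | ZOpp e => - zcoef e i
  | ZAdd e e' => zcoef e i + zcoef e' i
  end.

Lemma zevalE (V : zmodType) (env : seq V) e :
  zeval env e = \sum_(i < size env) env`_i *~ zcoef e i.
Proof.
elim: e => [n||e IHe|e IHe e' IHe'] /=.
- have [lt_n|ge_n] := ltnP n (size env).
    rewrite (bigD1 (Ordinal lt_n)) //= eqxx big1 ?addr0 // => i.
    by rewrite -val_eqE eq_sym /= => /negPf ->.
  rewrite nth_default // big1 // => i _; case: eqP => // ni.
  by have := ltn_ord i; rewrite -ni ltnNge ge_n.
- by rewrite big1.
- by rewrite IHe -sumrN; apply: eq_bigr => i _; rewrite mulrNz.
- by rewrite IHe IHe' -big_split; apply: eq_bigr => i _; rewrite mulrzDr.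
Qed.

(** The integer coefficients are closed terms once the expressions are reified, so [zmod] discharges
    the hypothesis by computation. *)
Lemma zmod_eq (V : zmodType) (env : seq V) e e' :
  all (fun i => zcoef e i == zcoef e' i) (iota 0 (size env)) ->
  zeval env e = zeval env e'.
Proof.
move/allP => h; rewrite !zevalE; apply: eq_bigr => i _.
by rewrite (eqP (h i _)) // mem_iota ltn_ord.
Qed.

Ltac zindex x l :=
  match l with
  | cons ?y ?l' => match constr:(Set) with
      | _ => let _ := match constr:(Set) with _ => unify x y end in constr:(0%N)
      | _ => let n := zindex x l' in constr:(S n) end
  end.
Ltac zatoms t l :=
  match t with
  | (?a + ?b)%R => let l := zatoms a l in zatoms b l
  | (- ?a)%R => zatoms a l
  | 0%R => l
  | ?x => match constr:(Set) with
          | _ => let n := zindex x l in l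
          | _ => constr:(cons x l) end
  end.
Ltac zreify t l :=
  match t with
  | (?a + ?b)%R => let a' := zreify a l in let b' := zreify b l in
                   constr:(ZAdd a' b')
  | (- ?a)%R => let a' := zreify a l in constr:(ZOpp a')
  | 0%R => constr:(ZZero)
  | ?x => let n := zindex x l in constr:(ZVar n)
  end.
Ltac zmod :=
  match goal with |- @eq ?V ?a ?b =>
    let l := zatoms a (@nil V) in let l := zatoms b l in
    let a' := zreify a l in let b' := zreify b l in
    refine (@zmod_eq _ l a' b' _); vm_compute; reflexivity
  end.

(** * Endomorphism rings of right modules *)

Section EndoRing.
Variables (A : pzRingType) (P : lmodType A^c).

Let endo_one : endo P := (idfun : {linear P -> P}).
Let endo_mul (g h : endo P) : endo P := (g \o h : {linear P -> P}).

Fact endo_mulA : associative endo_mul.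
Proof. by move=> f g h; apply/endoP. Qed.
Fact endo_mul1 : left_id endo_one endo_mul.
Proof. by move=> f; apply/endoP. Qed.
Fact endo_mulr1 : right_id endo_one endo_mul.
Proof. by move=> f; apply/endoP. Qed.
Fact endo_mulDl : left_distributive endo_mul +%R.
Proof. by move=> f g h; apply/endoP. Qed.
Fact endo_mulDr : right_distributive endo_mul +%R.
Proof. by move=> f g h; apply/endoP => x; rewrite /= linearD. Qed.
HB.instance Definition _ := GRing.Zmodule_isPzRing.Build (endo P)
  endo_mulA endo_mul1 endo_mulr1 endo_mulDl endo_mulDr.

Lemma endoM (g h : endo P) x : (g * h) x = g (h x). Proof. by []. Qed.
Lemma endo1 x : (1 : endo P) x = x. Proof. by []. Qed.
Lemma endo0 x : (0 : endo P) x = 0. Proof. by []. Qed.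
Lemma endoD (g h : endo P) x : (g + h) x = g x + h x. Proof. by []. Qed.
Lemma endoN (g : endo P) x : (- g) x = - g x. Proof. by []. Qed.
Lemma endoB (g h : endo P) x : (g - h) x = g x - h x. Proof. by []. Qed.
Lemma endo_sum (I : Type) (r : seq I) (Q : pred I) (F : I -> endo P) x :
  (\sum_(i <- r | Q i) F i) x = \sum_(i <- r | Q i) F i x.
Proof. by elim/big_rec2: _ => // i y1 y2 _ <-. Qed.

End EndoRing.

Section RightModules.
Variables (A : pzRingType) (M : lmodType A^c).
Implicit Types x y : M.

Lemma rscale0 x : x *> (0 : A) = 0. Proof. exact: (@scale0r A^c). Qed.
Lemma rscale0l (a : A) : (0 : M) *> a = 0. Proof. exact: scaler0. Qed.
Lemma rscaleNl x (a : A) : (- x) *> a = - (x *> a).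
Proof. exact: scalerN. Qed.
Lemma rscaleNr x (a : A) : x *> (- a) = - (x *> a).
Proof. exact: (@scaleNr A^c). Qed.
Lemma rscaleBl x y (a : A) : (x - y) *> a = x *> a - y *> a.
Proof. by rewrite rscaleDl rscaleNl. Qed.
Lemma rscaleBr x (a b : A) : x *> (a - b) = x *> a - x *> b.
Proof. by rewrite rscaleDr rscaleNr. Qed.
Lemma rscale_suml (I : Type) (r : seq I) (Q : pred I) (F : I -> M) (a : A) :
  (\sum_(i <- r | Q i) F i) *> a = \sum_(i <- r | Q i) (F i *> a).
Proof.
by elim/big_rec2: _ => [|i y1 y2 _ <-]; rewrite ?rscale0l ?rscaleDl.
Qed.
Lemma rscale_sumr (I : Type) (r : seq I) (Q : pred I) (F : I -> A) x :
  x *> (\sum_(i <- r | Q i) F i) = \sum_(i <- r | Q i) (x *> F i).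
Proof.
by elim/big_rec2: _ => [|i y1 y2 _ <-]; rewrite ?rscale0 ?rscaleDr.
Qed.
End RightModules.

Section MakeEndo.
Variables (A : pzRingType) (P : lmodType A^c) (g : P -> P).
Hypotheses (gD : forall x y, g (x + y) = g x + g y)
           (gZ : forall x (a : A), g (x *> a) = g x *> a).

Let g_linear : linear g.
Proof. by move=> a x y; rewrite gD; congr (_ + _); apply: gZ. Qed.
HB.instance Definition _ := GRing.isLinear.Build A^c P P *:%R g g_linear.
Definition make_endo : endo P := (g : {linear P -> P}).
Lemma make_endoE x : make_endo x = g x. Proof. by []. Qed.
End MakeEndo.

(** * Calculus in unitary rings *)

Section Involutions.
Variables (A : pzRingType) (sigma : A -> A) (u : A) (Lambda : set A).
Hypothesis uA : unitary_ring sigma u Lambda.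

Lemma involD a b : sigma (a + b) = sigma a + sigma b.
Proof. by case: uA => -[]. Qed.
Lemma involM a b : sigma (a * b) = sigma b * sigma a.
Proof. by case: uA => -[]. Qed.
Lemma invol1 : sigma 1 = 1. Proof. by case: uA => -[]. Qed.
Lemma involK : involutive sigma. Proof. by case: uA => -[]. Qed.
Lemma invol0 : sigma 0 = 0.
Proof. by apply: (addrI (sigma 0)); rewrite -involD !addr0. Qed.
Lemma involN a : sigma (- a) = - sigma a.
Proof. by apply: (addrI (sigma a)); rewrite -involD !subrr invol0. Qed.
Lemma involB a b : sigma (a - b) = sigma a - sigma b.
Proof. by rewrite involD involN. Qed.
Lemma invol_sum (I : Type) (r : seq I) (Q : pred I) (F : I -> A) :
  sigma (\sum_(i <- r | Q i) F i) = \sum_(i <- r | Q i) sigma (F i).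
Proof. by elim/big_rec2: _ => [|i y1 y2 _ <-]; rewrite ?invol0 ?involD. Qed.
Lemma u_central a : u * a = a * u. Proof. by case: uA. Qed.
Lemma mulVu : sigma u * u = 1. Proof. by case: uA. Qed.
Lemma muluV : u * sigma u = 1. Proof. by rewrite u_central mulVu. Qed.
Lemma Vu_central a : sigma u * a = a * sigma u.
Proof. by rewrite -[a]involK -!involM u_central. Qed.

Lemma param0 : Lambda 0. Proof. by case: uA => _ _ _ [[]]. Qed.
Lemma paramB a b : Lambda a -> Lambda b -> Lambda (a - b).
Proof. by case: uA => _ _ _ [[_ h] _ _ _]; apply: h. Qed.
Lemma paramN a : Lambda a -> Lambda (- a).
Proof. by move=> h; rewrite -[- a]add0r; apply: paramB => //; apply: param0. Qed.
Lemma paramD a b : Lambda a -> Lambda b -> Lambda (a + b).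
Proof. by move=> ha hb; rewrite -[b]opprK; apply/paramB/paramN. Qed.
Lemma param_sum (I : Type) (r : seq I) (Q : pred I) (F : I -> A) :
  (forall i, Q i -> Lambda (F i)) -> Lambda (\sum_(i <- r | Q i) F i).
Proof. move=> h; elim/big_ind: _ => //; [exact: param0|exact: paramD]. Qed.
Lemma param_min a : Lambda (a - sigma a * u).
Proof. by case: uA => _ _ _ [_ h _ _]; apply: h; exists a. Qed.
Lemma param_max a : Lambda a -> sigma a * u = - a.
Proof. by case: uA => _ _ _ [_ _ h _]; apply: h. Qed.
Lemma param_conj a x : Lambda x -> Lambda (sigma a * x * a).
Proof. by case: uA => _ _ _ [_ _ _ h]; apply: h. Qed.

(* A matrix that is u-skew off the diagonal and has diagonal in Lambda defines
   an element of Lambda on every vector. *)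
Lemma param_quad n (C : 'I_n -> 'I_n -> A) (v : 'I_n -> A) :
  (forall k, Lambda (C k k)) ->
  (forall k l : 'I_n, (k < l)%N -> C l k = - (sigma (C k l) * u)) ->
  Lambda (\sum_k \sum_l sigma (v k) * C k l * v l).
Proof.
move=> Cd Cs; pose F k l := sigma (v k) * C k l * v l.
have FE (k l : 'I_n) : (k < l)%N -> F l k = - (sigma (F k l) * u).
  move=> kl; rewrite /F Cs // !involM involK mulrN mulNr !mulrA; congr (- _).
  by rewrite -!mulrA u_central.
have -> : \sum_k \sum_l F k l = \sum_k F k k +
    \sum_(k < n) \sum_(l < n | (k < l)%N) (F k l - sigma (F k l) * u).
  transitivity (\sum_(k < n) (F k k + \sum_(l < n | (k < l)%N) F k l
                  + \sum_(l < n | (l < k)%N) F k l)).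
    apply: eq_bigr => k _; rewrite (bigD1 k) //= -addrA; congr (_ + _).
    rewrite (bigID (fun l : 'I_n => (k < l)%N)) /=; congr (_ + _).
      by apply: eq_bigl => l; rewrite neq_ltn orbC; case: ltngtP.
    by apply: eq_bigl => l; rewrite neq_ltn -leqNgt; case: ltngtP.
  rewrite !big_split /= -addrA; congr (_ + _).
  under [X in _ = X]eq_bigr do rewrite big_split /=.
  rewrite big_split /=; congr (_ + _).
  rewrite (exchange_big_dep predT) //=.
  by apply: eq_bigr => k _; apply: eq_bigr => l lk; apply: FE.
apply: paramD; apply: param_sum => k _; first exact: param_conj.
by apply: param_sum => l _; apply: param_min.
Qed.

End Involutions.

(* A quadratic space together with generators x_k and vectors y_k such that the
   functionals h(y_k, -) are the coordinates dual to the x_k. *)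
Record hspace (A : pzRingType) (P : lmodType A^c) := Hspace {
  hs_inv : A -> A; hs_u : A; hs_param : set A;
  hs_form : P -> P -> A;
  hs_dim : nat; hs_x : 'I_hs_dim -> P; hs_y : 'I_hs_dim -> P;
  hs_unitary : unitary_ring hs_inv hs_u hs_param;
  hs_dual : dual_hom hs_inv hs_form;
  hs_basis : forall z,
    z = \sum_k hs_x k *> hermitian_form hs_inv hs_u hs_form (hs_y k) z
}.

(** * The adjoint involution, and isometries as unitary elements *)

Section HermitianSpaces.
Variables (A : pzRingType) (P : lmodType A^c) (X : hspace P).
Local Notation sigma := (hs_inv X).
Local Notation u := (hs_u X).
Local Notation Lambda := (hs_param X).
Local Notation f := (@hs_form _ _ X).
Local Notation x_ := (@hs_x _ _ X).
Local Notation y_ := (@hs_y _ _ X).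
Let uA := hs_unitary X.

Definition hs_h (x y : P) : A := hermitian_form sigma u f x y.
Local Notation h := hs_h.

Let fDr x y z : f x (y + z) = f x y + f x z.
Proof. by case: (hs_dual X) => /(_ x)[]. Qed.
Let fZr x y a : f x (y *> a) = f x y * a.
Proof. by case: (hs_dual X) => /(_ x)[]. Qed.
Let fDl x y z : f (x + y) z = f x z + f y z.
Proof. by case: (hs_dual X) => _ ->. Qed.
Let fZl x y a : f (x *> a) y = sigma a * f x y.
Proof. by case: (hs_dual X) => _ _ ->. Qed.

Lemma hs_hE x y : h x y = f x y + sigma (f y x) * u. Proof. by []. Qed.
Lemma hDr x y z : h x (y + z) = h x y + h x z.
Proof. by rewrite !hs_hE fDr fDl (involD uA) mulrDl addrACA. Qed.
Lemma hDl x y z : h (x + y) z = h x z + h y z.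
Proof. by rewrite !hs_hE fDr fDl (involD uA) mulrDl addrACA. Qed.
Lemma hZr x y a : h x (y *> a) = h x y * a.
Proof.
rewrite !hs_hE fZr fZl (involM uA) (involK uA) mulrDl -!mulrA.
by rewrite (u_central uA).
Qed.
Lemma hZl x y a : h (x *> a) y = sigma a * h x y.
Proof. by rewrite !hs_hE fZr fZl (involM uA) mulrDr mulrA. Qed.
Lemma hNr x y : h x (- y) = - h x y.
Proof. by apply: (addrI (h x y)); rewrite -hDr !subrr -(rscale0 x) hZr mulr0. Qed.
Lemma h0r x : h x 0 = 0.
Proof. by rewrite -(rscale0 x) hZr mulr0. Qed.
Lemma hBr x y z : h x (y - z) = h x y - h x z.
Proof. by rewrite hDr hNr. Qed.
Lemma h0l x : h 0 x = 0.
Proof. by rewrite -(rscale0 x) hZl (invol0 uA) mul0r. Qed.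
Lemma hNl x y : h (- x) y = - h x y.
Proof. by apply: (addrI (h x y)); rewrite -hDl !subrr h0l. Qed.
Lemma hBl x y z : h (x - y) z = h x z - h y z.
Proof. by rewrite hDl hNl. Qed.
Lemma h_sumr (I : Type) (r : seq I) (Q : pred I) (F : I -> P) x :
  h x (\sum_(i <- r | Q i) F i) = \sum_(i <- r | Q i) h x (F i).
Proof. by elim/big_rec2: _ => [|i y1 y2 _ <-]; rewrite ?h0r ?hDr. Qed.
Lemma h_suml (I : Type) (r : seq I) (Q : pred I) (F : I -> P) x :
  h (\sum_(i <- r | Q i) F i) x = \sum_(i <- r | Q i) h (F i) x.
Proof. by elim/big_rec2: _ => [|i y1 y2 _ <-]; rewrite ?h0l ?hDl. Qed.

Lemma hC x y : sigma (h x y) * u = h y x.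
Proof.
rewrite !hs_hE (involD uA) (involM uA) (involK uA) mulrDl addrC; congr (_ + _).
by rewrite (Vu_central uA) -mulrA (mulVu uA) mulr1.
Qed.
Lemma hCV x y : sigma (h x y) = h y x * sigma u.
Proof. by rewrite -(hC x y) -mulrA (muluV uA) mulr1. Qed.

Lemma hbasis z : z = \sum_k x_ k *> h (y_ k) z.
Proof. exact: hs_basis. Qed.

Lemma h_injr x y : (forall z, h z x = h z y) -> x = y.
Proof.
by move=> e; rewrite [x]hbasis [y]hbasis; apply: eq_bigr => k _; rewrite e.
Qed.
Lemma h_injl x y : (forall z, h x z = h y z) -> x = y.
Proof. by move=> e; apply: h_injr => z; rewrite -!(hC _ z) e. Qed.

Lemma hbasis_dual x z : h x z = \sum_k h x (x_ k) * h (y_ k) z.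
Proof.
by rewrite {1}[z]hbasis h_sumr; apply: eq_bigr => k _; rewrite hZr.
Qed.
Lemma hbasis_left z : z = \sum_k y_ k *> sigma (h z (x_ k)).
Proof.
apply: h_injl => w; rewrite h_suml [LHS]hbasis_dual; apply: eq_bigr => k _.
by rewrite hZl (involK uA).
Qed.

Section Operators.
Variable b : P -> P -> A.
Hypothesis bd : dual_hom sigma b.
Let op_fun z := \sum_k y_ k *> (sigma u * b (x_ k) z).
Let op_funD z w : op_fun (z + w) = op_fun z + op_fun w.
Proof.
rewrite /op_fun -big_split /=; apply: eq_bigr => k _.
by case: bd => /(_ (x_ k))[-> _] _ _; rewrite mulrDr rscaleDr.
Qed.
Let op_funZ z a : op_fun (z *> a) = op_fun z *> a.
Proof.
rewrite /op_fun rscale_suml; apply: eq_bigr => k _.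
by case: bd => /(_ (x_ k))[_ ->] _ _; rewrite mulrA rscaleA.
Qed.
(** The operator that represents the form [b] through [h]. In [op_fun] the factor [sigma u] turns
    [h x (y_ k)] into [sigma (h (y_ k) x)], so that the expansion of [x] in the generators [x_]
    reappears. *)
Definition hs_op : endo P := make_endo op_funD op_funZ.
Lemma hs_opE x z : h x (hs_op z) = b x z.
Proof.
have b0 w : b 0 w = 0.
  by apply: (addrI (b 0 w)); rewrite -[b 0 w + b 0 w]/((b 0 \+ b 0) w);
     case: bd => _ <- _; rewrite !addr0.
have bs (F : 'I_(hs_dim X) -> P) w : b (\sum_k F k) w = \sum_k b (F k) w.
  by elim/big_rec2: _ => // k s t _ <-; case: bd => _ ->.
rewrite h_sumr {2}[x]hbasis bs; apply: eq_bigr => k _.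
case: bd => _ _ -> /=; by rewrite hZr /dual_scale hCV mulrA.
Qed.
End Operators.

Section Adjoint.
Variable e : endo P.
Let star_fun z := \sum_k y_ k *> sigma (h z (e (x_ k))).
Let star_funE z w : h (star_fun z) w = h z (e w).
Proof.
rewrite h_suml {2}[w]hbasis linear_sum h_sumr; apply: eq_bigr => k _.
by rewrite hZl (involK uA) linear_rscale hZr.
Qed.
Let star_funD z w : star_fun (z + w) = star_fun z + star_fun w.
Proof. by apply: h_injl => t; rewrite hDl !star_funE hDl. Qed.
Let star_funZ z a : star_fun (z *> a) = star_fun z *> a.
Proof. by apply: h_injl => t; rewrite hZl !star_funE hZl. Qed.
Definition hs_star : endo P := make_endo star_funD star_funZ.
Lemma hs_starE z w : h (hs_star z) w = h z (e w).
Proof. exact: star_funE. Qed.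
End Adjoint.

Local Notation star := hs_star.

Lemma hs_starEr (e : endo P) z w : h z (star e w) = h (e z) w.
Proof. by rewrite -hC hs_starE hC. Qed.

Lemma hs_eps_dual : dual_hom sigma f. Proof. exact: hs_dual. Qed.
Definition hs_eps : endo P := hs_op hs_eps_dual.
Lemma hs_epsE x z : h x (hs_eps z) = f x z. Proof. exact: hs_opE. Qed.

(** This is the group Lambda_P, carried from forms to endomorphisms along the correspondence b(x, y)
    = h(x, e y); see [hs_lamP]. *)
Definition hs_lam : set (endo P) :=
  [set e | star e = - e /\ forall x, Lambda (h x (e x))].

Lemma hs_lamP (e : endo P) (b : P -> P -> A) :
  (forall x y, b x y = h x (e y)) ->
  hs_lam e <-> Lambda_forms sigma u Lambda b.
Proof.
move=> bE; have bd : dual_hom sigma b.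
  split=> [x|x y|x a].
  - by split=> [y z|y a]; rewrite !bE ?linearD ?hDr // linear_rscale hZr.
  - by apply/funext => z /=; rewrite !bE hDl.
  - by apply/funext => z; rewrite /dual_scale !bE hZl.
split=> [[es eL]|[_ es eL]].
  split=> // [x|x]; last by rewrite bE.
  apply/funext => y; rewrite /form_transpose /omega /= !bE hC.
  by rewrite -hs_starEr es hNr opprK.
split=> [|x]; last by rewrite -bE.
apply/endoP => y; apply: h_injr => x; rewrite hs_starEr endoN hNr -bE.
by rewrite es /= /form_transpose /omega /= bE hC opprK.
Qed.

(** Whatever the original [u], the passage to operators produces a unitary ring with sign 1. All
    later matrix computations take place over it. *)
Lemma hs_star_unitary : unitary_ring star 1 hs_lam.
Proof.
have starD a b : star (a + b) = star a + star b.
  by apply/endoP => x; apply: h_injr => z; rewrite endoD hDr !hs_starEr hDl.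
have starM a b : star (a * b) = star b * star a.
  by apply/endoP => x; apply: h_injr => z; rewrite endoM !hs_starEr.
have star1 : star 1 = 1.
  by apply/endoP => x; apply: h_injr => z; rewrite hs_starEr.
have starK : involutive star.
  by move=> a; apply/endoP => x; apply: h_injr => z; rewrite hs_starEr hs_starE.
have starN a : star (- a) = - star a.
  by apply/endoP => x; apply: h_injr => z; rewrite endoN hNr !hs_starEr hNl.
split=> //; [by move=> b; rewrite mul1r mulr1|by rewrite star1 mul1r|].
split=> [|_ [a _ <-]|e [es _]|a e [es eL]].
- split=> [|a b [as_ aL] [bs bL]].
    split=> [|x]; last by rewrite h0r; apply: (param0 uA).
    by apply: (addrI (star 0)); rewrite -starD oppr0 !addr0.
  split=> [|x]; last by rewrite hBr; apply: (paramB uA).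
  by rewrite starD starN as_ bs opprD.
- rewrite mulr1; split=> [|x].
    by rewrite starD starN starK opprB addrC.
  by rewrite hBr hs_starEr -(hC x); apply: (param_min uA).
- by rewrite /Lambda_max /= mulr1.
- split=> [|x]; first by rewrite !starM starK es !(mulrN, mulNr) mulrA.
  by rewrite !endoM hs_starEr; apply: eL.
Qed.

(** In terms of operators, [h] is the sum of the form and its transpose. *)
Lemma hs_eps_star : hs_eps + star hs_eps = 1.
Proof.
apply/endoP => x; apply: h_injr => z; rewrite endoD hDr hs_epsE hs_starEr.
by rewrite -(hC x) hs_epsE -hs_hE.
Qed.

Definition hs_iso : set (endo P) := [set e |
  [/\ star e * e = 1, e * star e = 1 & hs_lam (star e * hs_eps * e - hs_eps)]].

Lemma hs_isoP (e : {linear P -> P}) :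
  isometry_group sigma u Lambda f e <-> hs_iso e.
Proof.
have E x y : ((f (e x) \o e) \- f x) y =
    h x ((star e * hs_eps * e - hs_eps : endo P) y).
  by rewrite endoB hBr !endoM hs_starEr !hs_epsE.
split=> [[be]|[e1 e2 eL]]; last first.
  split; last by apply/(hs_lamP E).
  exists (star e) => x; first by rewrite -[LHS](endoM (star e) e) e1.
  by rewrite -[LHS](endoM e (star e)) e2.
move/(hs_lamP E) => eL; have [es _] := eL.
have {es} e1 : star e * e = 1.
  have U := hs_star_unitary.
  have sw (a b c d : endo P) : a - b = - (c - d) -> a + c = b + d.
    by move=> h; apply/eqP; rewrite -subr_eq0 opprD addrACA h addNr.
  move: es; rewrite (involB U) !(involM U) (involK U) => /sw e'.
  have : star e * ((star hs_eps + hs_eps) * e) = star hs_eps + hs_eps.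
    by rewrite mulrDl mulrDr mulrA -e' !mulrA.
  by rewrite [star hs_eps + _]addrC hs_eps_star mul1r.
split=> //; case: be => g gK gK'; apply/endoP => x.
rewrite endoM endo1 -[RHS]gK'.
by rewrite -[star e x](congr1 (star e) (gK' x)) -[star e _](endoM (star e) e) e1.
Qed.

End HermitianSpaces.

(** * Quotient rings and matrices congruent to 1 modulo a quasi-regular ideal *)

Section QuotientRing.
Variables (E : pzRingType) (J : set E).
Hypothesis idealJ : two_sided_ideal J.

Lemma tideal0 : J 0. Proof. by case: idealJ => -[[]]. Qed.
Lemma tidealB a b : J a -> J b -> J (a - b).
Proof. by case: idealJ => -[[_ h] _] _; apply: h. Qed.
Lemma tidealN a : J a -> J (- a).
Proof. by move=> h; rewrite -[- a]add0r; apply: tidealB => //; apply: tideal0. Qed.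
Lemma tidealD a b : J a -> J b -> J (a + b).
Proof. by move=> ha hb; rewrite -[b]opprK; apply/tidealB/tidealN. Qed.
Lemma tidealMr a b : J a -> J (a * b).
Proof. by case: idealJ => -[_ h] _; apply: h. Qed.
Lemma tidealMl a b : J a -> J (b * a).
Proof. by case: idealJ => _; apply. Qed.
Lemma tideal_sum (I : Type) (r : seq I) (Q : pred I) (F : I -> E) :
  (forall i, Q i -> J (F i)) -> J (\sum_(i <- r | Q i) F i).
Proof. move=> h; elim/big_ind: _ => //; [exact: tideal0|exact: tidealD]. Qed.

Let eqJ (x y : E) : bool := `[< J (x - y) >].
Let eqJ_equiv : equiv_class_of eqJ.
Proof.
split=> [x|x y|y x z].
- by apply/asboolP; rewrite subrr; apply: tideal0.
- by apply/asboolP/asboolP => h; rewrite -opprB; apply: tidealN.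
- move=> /asboolP h1 /asboolP h2; apply/asboolP.
  by rewrite -(subrKA y); apply: tidealD.
Qed.
Let eqJ_rel := EquivRelPack eqJ_equiv.
Local Canonical eqJ_rel.

Let Qt : Type := {eq_quot eqJ}.
Local Notation piQ := (\pi_Qt : E -> Qt).
HB.instance Definition _ := Choice.on Qt.
HB.instance Definition _ := EqQuotient.on Qt.

Let piP x y : piQ x = piQ y <-> J (x - y).
Proof. by split=> [/eqmodP/asboolP|h] //; apply/eqmodP/asboolP. Qed.
Let reprP (x : E) : J (repr (piQ x) - x).
Proof. by apply/piP; rewrite reprK. Qed.
Let piS (X : Qt) : exists x, X = piQ x.
Proof. by exists (repr X); rewrite reprK. Qed.

Let qadd (X Y : Qt) : Qt := piQ (repr X + repr Y).
Let qopp (X : Qt) : Qt := piQ (- repr X).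
Let qmul (X Y : Qt) : Qt := piQ (repr X * repr Y).
Let qaddE x y : qadd (piQ x) (piQ y) = piQ (x + y).
Proof.
by apply/piP; rewrite opprD addrACA; apply: tidealD; apply: reprP.
Qed.
Let qoppE x : qopp (piQ x) = piQ (- x).
Proof. by apply/piP; rewrite -opprD; apply/tidealN/reprP. Qed.
Let qmulE x y : qmul (piQ x) (piQ y) = piQ (x * y).
Proof.
apply/piP; rewrite -(subrKA (repr (piQ x) * y)) -mulrBr -mulrBl.
by apply: tidealD; [apply/tidealMl/reprP|apply/tidealMr/reprP].
Qed.
Let qaddA : associative qadd.
Proof.
by move=> X Y Z; have [[[x ->] [y ->]] [z ->]] := (piS X, piS Y, piS Z);
  rewrite !qaddE addrA.
Qed.
Let qaddC : commutative qadd.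
Proof. by move=> X Y; rewrite /qadd addrC. Qed.
Let qadd0 : left_id (piQ 0) qadd.
Proof. by move=> X; have [x ->] := piS X; rewrite qaddE add0r. Qed.
Let qaddN : left_inverse (piQ 0) qopp qadd.
Proof. by move=> X; have [x ->] := piS X; rewrite qoppE qaddE addNr. Qed.
HB.instance Definition _ := GRing.isZmodule.Build Qt qaddA qaddC qadd0 qaddN.
Let qmulA : associative qmul.
Proof.
by move=> X Y Z; have [[[x ->] [y ->]] [z ->]] := (piS X, piS Y, piS Z);
  rewrite !qmulE mulrA.
Qed.
Let qmul1l : left_id (piQ 1) qmul.
Proof. by move=> X; have [x ->] := piS X; rewrite qmulE mul1r. Qed.
Let qmul1r : right_id (piQ 1) qmul.
Proof. by move=> X; have [x ->] := piS X; rewrite qmulE mulr1. Qed.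
Let qmulDl : left_distributive qmul +%R.
Proof.
move=> X Y Z; have [[[x ->] [y ->]] [z ->]] := (piS X, piS Y, piS Z).
by rewrite -[_ + _]/(qadd _ _) qmulE qaddE !qmulE -[RHS]/(qadd _ _) qaddE mulrDl.
Qed.
Let qmulDr : right_distributive qmul +%R.
Proof.
move=> X Y Z; have [[[x ->] [y ->]] [z ->]] := (piS X, piS Y, piS Z).
by rewrite -[_ + _]/(qadd _ _) qmulE qaddE !qmulE -[RHS]/(qadd _ _) qaddE mulrDr.
Qed.
HB.instance Definition _ := GRing.Zmodule_isPzRing.Build Qt
  qmulA qmul1l qmul1r qmulDl qmulDr.
Let pim (x : E) : Qt := piQ x.
Let pim_additive : zmod_morphism pim.
Proof. by move=> x y; rewrite /pim -qaddE -qoppE. Qed.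
Let pim_mult : monoid_morphism pim.
Proof. by split=> // x y; rewrite /pim -qmulE. Qed.
HB.instance Definition _ := GRing.isZmodMorphism.Build E Qt pim pim_additive.
HB.instance Definition _ := GRing.isMonoidMorphism.Build E Qt pim pim_mult.

Lemma quotient_ring : exists (R : pzRingType) (pi : {rmorphism E -> R}),
  (forall x, pi x = 0 <-> J x) /\ forall y, exists x, pi x = y.
Proof.
exists Qt, (pim : {rmorphism E -> Qt}); split=> [x|y]; last first.
  by have [x ->] := piS y; exists x.
by rewrite -[pim x = 0]/(piQ x = piQ 0) piP subr0.
Qed.

End QuotientRing.

Section MatrixIdeals.
Variables (E : pzRingType) (J : set E).
Hypothesis idealJ : two_sided_ideal J.
Hypothesis quasi_inv : forall j, J j -> exists x, (1 - j) * x = 1.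

(** Gaussian elimination: the first pivot is 1 minus an element of [J], hence right invertible, and
    the Schur complement [d - c *m x *m b] is again congruent to 1 modulo [J]. *)
Lemma mx_right_inverse n (M : 'M[E]_n) : (forall i j, J ((1%:M - M) i j)) ->
  exists X, M *m X = 1%:M.
Proof.
elim: n M => [|n IHn] M JM; first by exists 0; apply/matrixP => -[].
pose M' : 'M_(1 + n) := M.
pose a := ulsubmx M' ; pose b := ursubmx M'; pose c := dlsubmx M'.
pose d := drsubmx M'.
have ME : M' = block_mx a b c d by rewrite submxK.
have JE : forall i j, J ((1%:M - block_mx a b c d) i j) by rewrite -ME.
rewrite scalar_mx_block opp_block_mx add_block_mx !sub0r in JE.
have [x ax] : exists x : 'M_1, a *m x = 1%:M.
  have := JE (lshift n 0) (lshift n 0); rewrite block_mxEul !mxE. move=> /quasi_inv.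
  move=> [x ax]; exists x%:M; rewrite [a]mx11_scalar -scalar_mxM !mxE.
  by rewrite -[RHS](congr1 _ ax) opprB addrCA subrr addr0.
have [] := IHn (d - c *m x *m b).
  move=> i j; rewrite opprB addrCA addrC mxE; apply: tidealD => //.
    by have := JE (rshift 1 i) (rshift 1 j); rewrite block_mxEdr.
  rewrite -mulmxA mxE; apply: tideal_sum => // k _; apply: tidealMr => //.
  have := JE (rshift 1 i) (lshift n k); rewrite block_mxEdl mxE => h.
  by rewrite -[c i k]opprK; apply: tidealN.
move=> y yE.
pose X1 : 'M_(1 + n) := block_mx x (- (x *m b)) 0 1%:M.
pose X2 : 'M_(1 + n) := block_mx 1%:M 0 (- (y *m c *m x)) y.
suff h : M' *m (X1 *m X2) = 1%:M by exists (X1 *m X2).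
rewrite ME mulmxA mulmx_block !mulmx0 !mulmx1 !addr0 !mulmxN !mulmxA.
rewrite ax mul1mx addNr addrC.
rewrite mulmx_block !mul0mx !mulmx1 !mul1mx !addr0 ?mulmx0 ?addr0.
by rewrite mulmxN !mulmxA yE mul1mx subrr add0r -scalar_mx_block.
Qed.

End MatrixIdeals.

(** * Lambda-matrices and the parametrisation of isometries *)

Section MatrixForms.
Variables (E : pzRingType) (star : E -> E) (Lam : set E).
Hypothesis U : unitary_ring star 1 Lam.

Definition adjmx m n (M : 'M[E]_(m, n)) : 'M[E]_(n, m) :=
  \matrix_(i, j) star (M j i).

Lemma adjmxD m n (M N : 'M_(m, n)) : adjmx (M + N) = adjmx M + adjmx N.
Proof. by apply/matrixP => i j; rewrite !mxE (involD U). Qed.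
Lemma adjmxN m n (M : 'M_(m, n)) : adjmx (- M) = - adjmx M.
Proof. by apply/matrixP => i j; rewrite !mxE (involN U). Qed.
Lemma adjmxB m n (M N : 'M_(m, n)) : adjmx (M - N) = adjmx M - adjmx N.
Proof. by rewrite adjmxD adjmxN. Qed.
Lemma adjmxK m n : cancel (@adjmx m n) (@adjmx n m).
Proof. by move=> M; apply/matrixP => i j; rewrite !mxE (involK U). Qed.
Lemma adjmxM m n p (M : 'M_(m, n)) (N : 'M_(n, p)) :
  adjmx (M *m N) = adjmx N *m adjmx M.
Proof.
apply/matrixP => i j; rewrite !mxE (invol_sum U).
by apply: eq_bigr => k _; rewrite !mxE (involM U).
Qed.
Lemma adjmx0 m n : adjmx (0 : 'M_(m, n)) = 0.
Proof. by apply/matrixP => i j; rewrite !mxE (invol0 U). Qed.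
Lemma adjmx_scalar n a : adjmx (a%:M : 'M_n) = (star a)%:M.
Proof.
by apply/matrixP => i j; rewrite !mxE eq_sym; case: eqP; rewrite // (invol0 U).
Qed.
Lemma adjmx1 n : adjmx (1%:M : 'M_n) = 1%:M.
Proof. by rewrite adjmx_scalar (invol1 U). Qed.
Lemma adjmx_block m1 m2 n1 n2 (M : 'M_(m1, n1)) (N : 'M_(m1, n2))
    (M' : 'M_(m2, n1)) (N' : 'M_(m2, n2)) :
  adjmx (block_mx M N M' N') =
  block_mx (adjmx M) (adjmx M') (adjmx N) (adjmx N').
Proof.
apply/matrixP => i j; rewrite mxE; case: (split_ordP i) => k ->;
  case: (split_ordP j) => l ->;
  by rewrite ?(block_mxEul, block_mxEur, block_mxEdl, block_mxEdr) mxE.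
Qed.
Lemma adjmx_row m n1 n2 (M : 'M_(m, n1)) (N : 'M_(m, n2)) :
  adjmx (row_mx M N) = col_mx (adjmx M) (adjmx N).
Proof.
apply/matrixP => i j; rewrite mxE; case: (split_ordP i) => k ->;
  by rewrite ?(row_mxEl, row_mxEr, col_mxEu, col_mxEd) mxE.
Qed.

(** The analogue over n by n matrices of Lambda_P: skew-hermitian matrices with diagonal in
    [Lam]. *)
Definition mx_param n : set 'M[E]_n :=
  [set L | adjmx L = - L /\ forall i, Lam (L i i)].
Local Notation LamM := (@mx_param _).

Lemma mx_param0 n : mx_param (0 : 'M_n).
Proof.
by split=> [|i]; rewrite ?adjmx0 ?oppr0 // mxE; apply: (param0 U).
Qed.
Lemma mx_paramD n (L M : 'M_n) : LamM L -> LamM M -> LamM (L + M).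
Proof.
case=> [hL dL] [hM dM]; split=> [|i]; first by rewrite adjmxD hL hM opprD.
by rewrite mxE; apply: (paramD U).
Qed.
Lemma mx_paramN n (L : 'M_n) : LamM L -> LamM (- L).
Proof.
case=> [hL dL]; split=> [|i]; first by rewrite adjmxN hL.
by rewrite mxE; apply: (paramN U).
Qed.
Lemma mx_paramB n (L M : 'M_n) : LamM L -> LamM M -> LamM (L - M).
Proof. by move=> hL hM; apply/mx_paramD/mx_paramN. Qed.
Lemma mx_param_min n (M : 'M_n) : LamM (M - adjmx M).
Proof.
split=> [|i]; first by rewrite adjmxB adjmxK opprB.
by rewrite !mxE -[star _]mulr1; apply: (param_min U).
Qed.
Lemma mx_param_conj m n (L : 'M_n) (v : 'M_(n, m)) :
  LamM L -> LamM (adjmx v *m L *m v).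
Proof.
case=> [hL dL]; split=> [|i].
  by rewrite !adjmxM adjmxK hL !(mulmxN, mulNmx) mulmxA.
rewrite mxE; under eq_bigr do rewrite mxE mulr_suml.
rewrite exchange_big /=.
under eq_bigr do under eq_bigr do rewrite mxE.
apply: (param_quad U (C := fun k l => L k l) (fun k => v k i)) => //.
move=> k l _; move/matrixP/(_ l k): hL; rewrite !mxE mulr1 => ->.
by rewrite opprK.
Qed.
Lemma mx_param_block n1 n2 (A : 'M_n1) (B : 'M_(n1, n2)) (C : 'M_(n2, n1))
    (D : 'M_n2) :
  LamM A -> LamM D -> C = - adjmx B -> LamM (block_mx A B C D).
Proof.
move=> [hA dA] [hD dD] ->; split=> [|i].
  by rewrite adjmx_block hA hD adjmxN adjmxK opp_block_mx opprK.
by case: (split_ordP i) => k ->; rewrite ?block_mxEul ?block_mxEdr.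
Qed.
Definition mx_iso n (Ep : 'M[E]_n) : set 'M_n := [set F |
  [/\ adjmx F *m F = 1%:M, F *m adjmx F = 1%:M &
      LamM (adjmx F *m Ep *m F - Ep)]].

Section Transformation.
Variables (m n : nat) (Ep : 'M[E]_m) (i : 'M[E]_(m, n)).
Hypothesis EpE : Ep + adjmx Ep = 1%:M.

Let left_unitary F : LamM (adjmx F *m Ep *m F - Ep) -> adjmx F *m F = 1%:M.
Proof.
case=> h _; have sw (a b c d : 'M[E]_m) : a - b = - (c - d) -> a + c = b + d.
  by move=> e; apply/eqP; rewrite -subr_eq0 opprD addrACA e addNr.
move: h; rewrite adjmxB !adjmxM adjmxK => /sw.
rewrite mulmxA -mulmxDl -mulmxDr [adjmx Ep + _]addrC EpE mulmx1.
by move=> ->.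
Qed.

Let transf_param (g G : 'M_n) : g *m G = 1%:M -> G *m g = 1%:M ->
  LamM (g - adjmx i *m Ep *m i) ->
  let F := 1%:M - i *m G *m adjmx i in LamM (adjmx F *m Ep *m F - Ep).
Proof.
move=> gG Gg gP F; pose al := i *m G *m adjmx i.
have alE : adjmx al = i *m adjmx G *m adjmx i.
  by rewrite /al !adjmxM adjmxK mulmxA.
have GgG : adjmx G *m adjmx g = 1%:M by rewrite -adjmxM gG adjmx1.
have E1 : adjmx al *m Ep *m al = adjmx al *m 1%:M -
    adjmx (G *m adjmx i) *m (g - adjmx i *m Ep *m i) *m (G *m adjmx i).
  rewrite alE adjmxM adjmxK mulmx1 mulmxBr mulmxBl opprB.
  have e : i *m adjmx G *m g *m (G *m adjmx i) = i *m adjmx G *m adjmx i.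
    by rewrite -!mulmxA (mulmxA g) gG mul1mx.
  by rewrite e addrC subrK /al !mulmxA.
rewrite /F -/al adjmxB adjmx1 mulmxBl mul1mx mulmxBr mulmx1 mulmxBl E1.
have -> : Ep - adjmx al *m Ep - (Ep *m al - (adjmx al *m 1%:M -
    adjmx (G *m adjmx i) *m (g - adjmx i *m Ep *m i) *m (G *m adjmx i))) - Ep
  = - (Ep *m al - adjmx (Ep *m al)) -
    adjmx (G *m adjmx i) *m (g - adjmx i *m Ep *m i) *m (G *m adjmx i).
  have e : adjmx al *m 1%:M = adjmx al *m Ep + adjmx al *m adjmx Ep.
    by rewrite -EpE mulmxDr.
  rewrite e (adjmxM Ep al); zmod.
apply: mx_paramB; first exact/mx_paramN/mx_param_min.
exact: mx_param_conj.
Qed.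

Lemma transformation_iso (g G : 'M_n) : g *m G = 1%:M -> G *m g = 1%:M ->
  LamM (g - adjmx i *m Ep *m i) -> mx_iso Ep (1%:M - i *m G *m adjmx i).
Proof.
move=> gG Gg gP; have h := transf_param gG Gg gP.
split=> //; first exact: left_unitary.
(* The adjoint of [g] is admissible too, since [g - adjmx g] is minimal. Its transformation is the
   adjoint of the first one, which gives the other unitarity relation. *)
have : LamM (adjmx g - adjmx i *m Ep *m i).
  have -> : adjmx g - adjmx i *m Ep *m i =
      (g - adjmx i *m Ep *m i) - (g - adjmx g) by zmod.
  exact/mx_paramB/mx_param_min.
move/(transf_param (G := adjmx G)); rewrite -!adjmxM gG Gg adjmx1.
move=> /(_ erefl erefl) /left_unitary.
by rewrite !adjmxB !adjmx1 !adjmxM !adjmxK !mulmxA.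
Qed.

End Transformation.

End MatrixForms.

(* With A = 1 - F, the matrix [[A, B], [- B^* F, D]] is inverted by solving
   first modulo the image of A, then on the kernels of A and B. *)
Lemma bordered_right_inverse (R : pzRingType) (A S As Ss F Fi L Mu D Ep : R)
    (P Ps B Bs : R) :
  A = 1 - F -> As = 1 - Fi -> F * Fi = 1 -> Fi * F = 1 ->
  A * S * A = A -> As * Ss * As = As ->
  P = A * S -> Ps = Ss * As -> B = 1 - P -> Bs = 1 - Ps ->
  Ps * L * P * Mu = Ps -> D = Bs * Ep * B + L ->
  exists X Y Z W : R, [/\ A * X + B * Z = 1, A * Y + B * W = 0,
    - (Bs * F) * X + D * Z = 0 & - (Bs * F) * Y + D * W = 1].
Proof.
move=> AE AsE FFi FiF ASA AsSsAs PE PsE BE BsE LP DE.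
have PP : P * P = P by rewrite PE mulrA ASA.
have BP : B * P = 0 by rewrite BE mulrBl mul1r PP subrr.
have BB : B * B = B by rewrite {2}BE mulrBr mulr1 BP subr0.
have [V VE] : exists V, V = 1 - L * P * Mu by exists (1 - L * P * Mu).
have PsV : Ps * V = 0 by rewrite VE mulrBr mulr1 !mulrA LP subrr.
have AsV : As * V = 0 by rewrite -AsSsAs -!mulrA [Ss * _]mulrA -PsE PsV mulr0.
have AV : A * V = 0.
  have -> : A = - (F * As) by rewrite AsE mulrBr mulr1 FFi opprB.
  by rewrite mulNr -mulrA AsV mulr0 oppr0.
have FV : F * V = V.
  by rewrite -[F](subKr 1) -AE mulrBl mul1r AV subr0.
have BsV : Bs * V = V by rewrite BsE mulrBl mul1r PsV subr0.
have DPM : D * P * Mu = L * P * Mu.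
  by rewrite DE !mulrDl -(mulrA _ B P) BP mulr0 mul0r add0r.
have [Z ZE] : exists Z, Z = Bs * F * S - D * B by exists (Bs * F * S - D * B).
exists (S - V * Z), (- V), (B + P * Mu * Z), (P * Mu); split.
- rewrite mulrBr mulrDr !mulrA AV mul0r subr0 BP !mul0r addr0 BB BE -PE.
  by rewrite addrC subrK.
- by rewrite mulrN AV oppr0 mulrA BP mul0r addr0.
- rewrite [D * _]mulrDr mulNr mulrBr !mulrA DPM -(mulrA Bs F V) FV BsV.
  have -> : - (Bs * F * S - V * Z) + (D * B + L * P * Mu * Z) =
            - Z + (V * Z + L * P * Mu * Z).
    have -> : - Z = D * B - Bs * F * S by rewrite ZE opprB.
    zmod.
  by rewrite -mulrDl VE subrK mul1r addNr.
- by rewrite mulrNN -mulrA FV BsV !mulrA DPM VE subrK.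
Qed.

(** * Bordering 1 - phi to an invertible matrix *)

Section Bordered.
Variables (E : pzRingType) (star : E -> E) (Lam : set E).
Hypothesis U : unitary_ring star 1 Lam.
Local Notation adjmx := (adjmx star).
Local Notation LamM := (mx_param star Lam).

(** As [G *m g = 1%:M], conjugation by [g] turns [adjmx G - adjmx G *m E0 *m G] into [g - E0]. The
    former is polynomial in the blocks of [G], so membership can be checked block by block. *)
Lemma bordered_param n (Ep F b lam : 'M[E]_n) (g : 'M_(n + n)) :
  Ep + adjmx Ep = 1%:M -> mx_iso star Lam Ep F -> LamM lam ->
  let G := block_mx (1%:M - F) b (- (adjmx b *m F))
                    (adjmx b *m Ep *m b + lam) in
  G *m g = 1%:M -> LamM (g - block_mx Ep 0 0 0).
Proof.
move=> EpE [F1 F2 FP] lamP G Gg.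
have gG : adjmx g *m adjmx G = 1%:M by rewrite -(adjmxM U) Gg (adjmx1 U).
pose E0 : 'M_(n + n) := block_mx Ep 0 0 0.
have -> : g - E0 = adjmx g *m (adjmx G - adjmx G *m E0 *m G) *m g.
  rewrite mulmxBr mulmxBl gG mul1mx !mulmxA gG mul1mx.
  by rewrite -[E0 *m G *m g]mulmxA Gg mulmx1.
apply: (mx_param_conj U).
have EpB : adjmx Ep = 1%:M - Ep by rewrite -EpE addrC addKr.
have [a aE] : exists a, a = 1%:M - F by exists (1%:M - F).
have aP : adjmx a = 1%:M - adjmx F by rewrite aE (adjmxB U) (adjmx1 U).
rewrite /G /E0 -aE adjmx_block mulmx_block !mulmx0 !addr0 mulmx_block.
rewrite !mul0mx !addr0 opp_block_mx add_block_mx.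
apply: (mx_param_block U).
- have -> : adjmx a - adjmx a *m Ep *m a =
    - (adjmx F *m Ep *m F - Ep) - (Ep *m a - adjmx (Ep *m a)).
    rewrite (adjmxM U) EpB aP aE; rewrite !(mulmxBl, mulmxBr, mul1mx, mulmx1).
    zmod.
  by apply: (mx_paramB U); [apply: (mx_paramN U)|apply: (mx_param_min U)].
- have -> : adjmx (adjmx b *m Ep *m b + lam) - adjmx b *m Ep *m b =
    adjmx lam - (adjmx b *m Ep *m b - adjmx (adjmx b *m Ep *m b)).
    by rewrite (adjmxD U); zmod.
  apply: (mx_paramB U); last exact: (mx_param_min U).
  by have [-> _] := lamP; apply: (mx_paramN U).
- rewrite !(adjmxB U) !(adjmxN U) !(adjmxM U) !(adjmxK U) EpB aE.
  rewrite !(mulmxBl, mulmxBr, mul1mx, mulmx1, mulmxA).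
  zmod.
Qed.

Section Main.
Variables (J : set E) (eps : E).
Hypothesis epsE : eps + star eps = 1.
Hypothesis idealJ : two_sided_ideal J.
Hypothesis starJ : forall j, J j -> J (star j).
Hypothesis quasi_invJ : forall j, J j -> exists x, (1 - j) * x = 1.
Hypothesis fin : forall n (M X : 'M[E]_n), M *m X = 1%:M -> X *m M = 1%:M.

(** Modulo [J] the bordered matrix has a right inverse by [bordered_right_inverse]; it lifts because
    elements of 1 + [J] are right invertible, and [fin] makes it two-sided. The last hypothesis says
    that [lam] is nondegenerate on the image of [p], which modulo [J] is a projection onto the image
    of [a]. *)
Lemma bordered_inverse n (Ep F S lam mu : 'M[E]_n) :
  Ep + adjmx Ep = 1%:M -> mx_iso star Lam Ep F -> LamM lam ->
  let a := 1%:M - F in let p := a *m S in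
  (forall i j, J ((a *m S *m a - a) i j)) ->
  (forall i j, J ((adjmx p *m lam *m p *m mu - adjmx p) i j)) ->
  exists g G : 'M_(n + n), [/\ g *m G = 1%:M, G *m g = 1%:M,
    ulsubmx G = a & LamM (g - block_mx Ep 0 0 0)].
Proof.
move=> EpE FP lamP a p aSa pJ.
pose b := 1%:M - p.
pose G := block_mx (1%:M - F) b (- (adjmx b *m F)) (adjmx b *m Ep *m b + lam).
suff [X GX] : exists X, G *m X = 1%:M.
  exists X, G; split=> //; [exact: fin|by rewrite /G block_mxKul|].
  exact: (bordered_param EpE FP lamP GX).
have [R [pi [piJ pi_surj]]] := quotient_ring idealJ.
have piM (M N : 'M[E]_n) : (forall i j, J ((M - N) i j)) ->
    map_mx pi M = map_mx pi N.
  move=> h; apply/matrixP => i j; have /piJ/eqP := h i j.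
  by rewrite !mxE rmorphB subr_eq0 => /eqP.
have [F1 F2 _] := FP.
have as_ : adjmx a = 1%:M - adjmx F by rewrite (adjmxB U) (adjmx1 U).
have aSa' : forall i j, J ((adjmx a *m adjmx S *m adjmx a - adjmx a) i j).
  move=> i j; have := starJ (aSa j i); rewrite -[star _]/(star _).
  have -> : star ((a *m S *m a - a) j i) = adjmx (a *m S *m a - a) i j by rewrite [RHS]mxE.
  by rewrite (adjmxB U) !(adjmxM U) mulmxA.
have [X' [Y' [Z' [W' [e1 e2 e3 e4]]]]] : exists X Y Z W : 'M[R]_n, [/\
    map_mx pi a *m X + map_mx pi b *m Z = 1%:M,
    map_mx pi a *m Y + map_mx pi b *m W = 0,
    - (map_mx pi (adjmx b) *m map_mx pi F) *m X +
      map_mx pi (adjmx b *m Ep *m b + lam) *m Z = 0 &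
    - (map_mx pi (adjmx b) *m map_mx pi F) *m Y +
      map_mx pi (adjmx b *m Ep *m b + lam) *m W = 1%:M].
  apply: (@bordered_right_inverse 'M[R]_n (map_mx pi a) (map_mx pi S)
    (map_mx pi (adjmx a)) (map_mx pi (adjmx S)) (map_mx pi F)
    (map_mx pi (adjmx F)) (map_mx pi lam) (map_mx pi mu) _ (map_mx pi Ep)
    (map_mx pi p) (map_mx pi (adjmx p))).
  - by rewrite map_mxB map_mx1.
  - by rewrite as_ map_mxB map_mx1.
  - by rewrite -[_ * _]map_mxM F2 map_mx1.
  - by rewrite -[_ * _]map_mxM F1 map_mx1.
  - by rewrite -!mulmxE -!map_mxM; apply: piM.
  - by rewrite -!mulmxE -!map_mxM; apply: piM.
  - by rewrite map_mxM.
  - by rewrite (adjmxM U) map_mxM.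
  - by rewrite map_mxB map_mx1.
  - by rewrite (adjmxB U) (adjmx1 U) map_mxB map_mx1.
  - by rewrite -!mulmxE -!map_mxM; apply: piM.
  - by rewrite map_mxD !map_mxM.
have lift (M : 'M[R]_n) : exists N : 'M[E]_n, map_mx pi N = M.
  have /choice [N NE] : forall ij, exists x, pi x = M ij.1 ij.2.
    by move=> ij; apply: pi_surj.
  by exists (\matrix_(i, j) N (i, j)); apply/matrixP => i j; rewrite !mxE NE.
have [[[X XE] [Y YE]] [[Z ZE] [W WE]]] :=
  ((lift X', lift Y'), (lift Z', lift W')).
have GJ : forall i j, J ((1%:M - G *m block_mx X Y Z W) i j).
  have : map_mx pi (1%:M - G *m block_mx X Y Z W) = 0.
    rewrite map_mxB map_mxM !map_block_mx XE YE ZE WE map_mxN.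
    rewrite (map_mxM pi (adjmx b) F).
    by rewrite mulmx_block e1 e2 e3 e4 -scalar_mx_block map_mx1 subrr.
  by move=> h i j; apply/piJ; move/matrixP/(_ i j): h; rewrite !mxE.
have [V GV] := mx_right_inverse idealJ quasi_invJ GJ.
by exists (block_mx X Y Z W *m V); rewrite mulmxA.
Qed.

Let diag2 (x y : E) : 'M[E]_(1 + 1) := block_mx x%:M 0 0 y%:M.
Let sc1D (x y : E) : x%:M + y%:M = (x + y)%:M :> 'M[E]_1.
Proof. by apply/matrixP => k l; rewrite !mxE !ord1. Qed.
Let sc1N (x : E) : - x%:M = (- x)%:M :> 'M[E]_1.
Proof. by apply/matrixP => k l; rewrite !mxE !ord1. Qed.
Let diag2M x y x' y' : diag2 x y *m diag2 x' y' = diag2 (x * x') (y * y').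
Proof.
by rewrite mulmx_block !(mulmx0, mul0mx, addr0, add0r) -!scalar_mxM.
Qed.
Let diag2B x y x' y' : diag2 x y - diag2 x' y' = diag2 (x - x') (y - y').
Proof. by rewrite opp_block_mx add_block_mx !sc1N !sc1D !subr0. Qed.
Let diag2_adj x y : adjmx (diag2 x y) = diag2 (star x) (star y).
Proof. by rewrite adjmx_block !(adjmx_scalar U) !(adjmx0 U). Qed.
Let diag2E x : x%:M = diag2 x x. Proof. exact: scalar_mx_block. Qed.
Let diag2_in (Q : set E) : Q 0 -> forall x y, Q x -> Q y ->
  forall i j, Q (diag2 x y i j).
Proof.
move=> Q0 x y Qx Qy i j; rewrite /diag2.
by case: (split_ordP i) => k ->; case: (split_ordP j) => l ->;
  rewrite ?(block_mxEul, block_mxEur, block_mxEdl, block_mxEdr) mxE ?ord1.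
Qed.

Definition ring_iso : set E := [set e |
  [/\ star e * e = 1, e * star e = 1 & Lam (star e * eps * e - eps)]].

(* If g inverts to G for diag(phi, psi), then g + E_12 inverts to
   G - G E_12 G, which gives the product phi psi. *)
Lemma product_transformation (phi psi s t : E) (lam mu : 'M[E]_(1 + 1)) :
  ring_iso phi -> ring_iso psi ->
  let a := 1 - phi in let c := 1 - psi in
  let p : 'M_(1 + 1) := block_mx (a * s)%:M 0 0 (c * t)%:M in
  J (a * s * a - a) -> J (c * t * c - c) -> LamM lam ->
  (forall i j, J ((adjmx p *m lam *m p *m mu - adjmx p) i j)) ->
  let i : 'M_(1, (1 + 1) + (1 + 1)) := row_mx (row_mx 1%:M 1%:M) 0 in
  exists g G, [/\ g *m G = 1%:M, G *m g = 1%:M,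
    LamM (g - adjmx i *m eps%:M *m i) &
    (phi * psi)%:M = 1%:M - i *m G *m adjmx i].
Proof.
move=> [phi1 phi2 phiL] [psi1 psi2 psiL] a c p aJ cJ lamP pJ i.
pose Ep := diag2 eps eps; pose F := diag2 phi psi; pose S := diag2 s t.
have J0 := tideal0 idealJ.
have aE : 1%:M - F = diag2 a c by rewrite diag2E diag2B.
have [||//|||g [G [gG Gg ulG gP]]] :=
    @bordered_inverse _ Ep F S lam mu.
- by rewrite diag2_adj add_block_mx !addr0 !sc1D epsE -scalar_mx_block.
- split; rewrite ?diag2_adj ?diag2M ?phi1 ?psi1 ?phi2 ?psi2 -?diag2E //.
  rewrite diag2B; apply: (mx_param_block U); last by rewrite (adjmx0 U) oppr0.
    split=> [|k]; last by rewrite ord1 mxE.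
    by rewrite (adjmx_scalar U) sc1N; congr (_%:M);
       move: (param_max U phiL); rewrite mulr1.
  split=> [|k]; last by rewrite ord1 mxE.
  by rewrite (adjmx_scalar U) sc1N; congr (_%:M);
     move: (param_max U psiL); rewrite mulr1.
- by rewrite aE !diag2M diag2B; apply: diag2_in.
- by rewrite aE diag2M.
pose n : 'M[E]_(1 + 1) := block_mx 0 1%:M 0 0.
pose N : 'M[E]_((1 + 1) + (1 + 1)) := block_mx n 0 0 0.
pose r : 'M[E]_(1, 1 + 1) := row_mx 1%:M 1%:M.
have nan : n *m diag2 a c *m n = 0.
  by rewrite !mulmx_block !(mulmx0, mul0mx, addr0, add0r) -block_mx0.
have ulNGN (n1 n2 : 'M[E]_(1 + 1)) (H : 'M[E]_((1 + 1) + (1 + 1))) :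
    block_mx n1 0 0 0 *m H *m block_mx n2 0 0 0 =
    block_mx (n1 *m ulsubmx H *m n2) 0 0 0.
  rewrite -{1}[H]submxK mulmx_block !(mulmx0, mul0mx, addr0, add0r).
  by rewrite mulmx_block !(mulmx0, mul0mx, addr0, add0r).
have NGN : N *m G *m N = 0 by rewrite ulNGN ulG aE nan block_mx0.
exists (g + N), (G - G *m N *m G); split.
- rewrite mulmxDl !mulmxBr gG !mulmxA gG mul1mx NGN mul0mx subr0.
  by rewrite subrK.
- rewrite mulmxDr !mulmxBl Gg -(mulmxA (G *m N)) Gg mulmx1.
  by rewrite -[G *m N *m G *m N]mulmxA -(mulmxA G) (mulmxA N) NGN mulmx0 subr0
    subrK.
(* All four leading entries of i^* eps i are [eps]. Off the diagonal the 1 of [n] leaves 1 - eps =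
   star eps above and nothing cancels -eps below, so the remainder is skew. *)
- have -> : g + N - adjmx i *m eps%:M *m i =
      (g - block_mx Ep 0 0 0) + block_mx (block_mx 0 (star eps)%:M
         (- eps%:M) 0) 0 0 0.
    have -> : adjmx i *m eps%:M *m i =
        block_mx (block_mx eps%:M eps%:M eps%:M eps%:M) 0 0 0.
      rewrite !adjmx_row !(adjmx1 U) (adjmx0 U) mul_col_mx mul0mx mul_col_row.
      rewrite mulmx0 mul0mx mulmx0; congr block_mx.
      by rewrite mul_col_mx mul_col_row !mul1mx !mulmx1.
    rewrite -!addrA; congr (_ + _).
    rewrite /N /n /Ep /diag2 !(opp_block_mx, add_block_mx, oppr0, addr0, add0r, addNr).
    congr (block_mx (block_mx _ _ _ _) _ _ _).
    by rewrite sc1N sc1D -epsE addrAC subrr add0r.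
  apply: (mx_paramD U) => //; apply: (mx_param_block U).
  + apply: (mx_param_block U); try exact: (mx_param0 U).
    by rewrite (adjmx_scalar U) (involK U).
  + exact: (mx_param0 U).
  + by rewrite (adjmx0 U) oppr0.
- have iE H : i *m H *m adjmx i = r *m ulsubmx H *m adjmx r.
    rewrite -{1}[H]submxK mul_row_block !mul0mx !addr0 adjmx_row (adjmx0 U).
    by rewrite mul_row_col mulmx0 addr0.
  rewrite iE.
  (* The entries of this corner will sum to a + c - a c, which is 1 - phi psi. *)
  have -> : ulsubmx (G - G *m N *m G) = diag2 a c - diag2 a c *m n *m diag2 a c.
    have ulB (H H' : 'M[E]_((1 + 1) + (1 + 1))) :
      ulsubmx (H - H') = ulsubmx H - ulsubmx H'.
      by apply/matrixP => k l; rewrite !mxE.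
    have ulHNH (n1 : 'M[E]_(1 + 1)) (H : 'M[E]_((1 + 1) + (1 + 1))) :
      ulsubmx (H *m block_mx n1 0 0 0 *m H) = ulsubmx H *m n1 *m ulsubmx H.
      rewrite -{1 2}[H]submxK mulmx_block !(mulmx0, mul0mx, addr0, add0r).
      by rewrite mulmx_block !(mulmx0, mul0mx, addr0, add0r) block_mxKul.
    by rewrite ulB ulHNH ulG aE.
  rewrite adjmx_row !(adjmx1 U).
  rewrite !mulmx_block !(mulmx0, mul0mx, addr0, add0r) opp_block_mx add_block_mx.
  rewrite mul_row_block mul_row_col !(mulmx0, mul0mx, addr0, add0r, mul1mx, mulmx1, oppr0).
  rewrite -scalar_mxM !sc1N !sc1D sc1N sc1D.
  by congr (_%:M); rewrite /a /c !(mulrBl, mulrBr, mul1r, mulr1); zmod.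
Qed.

End Main.

End Bordered.

(** * Maximal submodules, radicals and chain conditions *)

Section RightActions.
Variables (B : pzRingType) (M : zmodType) (act : M -> B -> M).

(** The action is an explicit argument because one group is later a module in two ways: P_K over A_K
    and over K. *)
Record right_action : Prop := RightAction {
  actDl : forall x y b, act (x + y) b = act x b + act y b;
  actDr : forall x b c, act x (b + c) = act x b + act x c;
  actA : forall x b c, act (act x b) c = act x (b * c);
  act1 : forall x, act x 1 = x
}.
Hypothesis actP : right_action.

Lemma act0r x : act x 0 = 0.
Proof. by apply: (addrI (act x 0)); rewrite -(actDr actP) !addr0. Qed.
Lemma act0l b : act 0 b = 0.
Proof. by apply: (addrI (act 0 b)); rewrite -(actDl actP) !addr0. Qed.
Lemma actNr x b : act x (- b) = - act x b.
Proof. by apply: (addrI (act x b)); rewrite -(actDr actP) !subrr act0r. Qed.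
Lemma actNl x b : act (- x) b = - act x b.
Proof. by apply: (addrI (act x b)); rewrite -(actDl actP) !subrr act0l. Qed.
Lemma act_suml (I : Type) (r : seq I) (Q : pred I) (F : I -> M) b :
  act (\sum_(i <- r | Q i) F i) b = \sum_(i <- r | Q i) act (F i) b.
Proof.
by elim/big_rec2: _ => [|i y z _ <-]; rewrite ?act0l ?(actDl actP).
Qed.

Definition submodule (Y : set M) : Prop :=
  [/\ Y 0, forall x y, Y x -> Y y -> Y (x - y) & forall x b, Y x -> Y (act x b)].

Definition maximal_submodule (N : set M) : Prop :=
  [/\ submodule N, exists x, ~ N x &
      forall Z, submodule Z -> N `<=` Z -> (exists x, Z x /\ ~ N x) ->
        forall x, Z x].

Definition module_rad : set M :=
  [set x | forall N, maximal_submodule N -> N x].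

Definition generates n (g : 'I_n -> M) : Prop :=
  forall x, exists c : 'I_n -> B, x = \sum_k act (g k) (c k).

Section SubmoduleTheory.
Variable Y : set M.
Hypothesis subY : submodule Y.
Lemma submod0 : Y 0. Proof. by case: subY. Qed.
Lemma submodB x y : Y x -> Y y -> Y (x - y).
Proof. by case: subY => _ + _; apply. Qed.
Lemma submodN x : Y x -> Y (- x).
Proof. by move=> h; rewrite -[- x]add0r; apply: submodB => //; apply: submod0. Qed.
Lemma submodD x y : Y x -> Y y -> Y (x + y).
Proof. by move=> hx hy; rewrite -[y]opprK; apply/submodB/submodN. Qed.
Lemma submodZ x b : Y x -> Y (act x b).
Proof. by case: subY => _ _; apply. Qed.
Lemma submod_sum (I : Type) (r : seq I) (Q : pred I) (F : I -> M) :
  (forall i, Q i -> Y (F i)) -> Y (\sum_(i <- r | Q i) F i).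
Proof. move=> h; elim/big_ind: _ => //; [exact: submod0|exact: submodD]. Qed.
End SubmoduleTheory.

Lemma submoduleI (Y Z : set M) :
  submodule Y -> submodule Z -> submodule (Y `&` Z).
Proof.
move=> subY subZ; split=> [|x y [Yx Zx] [Yy Zy]|x b [Yx Zx]].
- by split; apply: submod0.
- by split; apply: submodB.
- by split; apply: submodZ.
Qed.

Lemma submoduleT : submodule setT. Proof. by []. Qed.

Lemma module_rad_sub : submodule module_rad.
Proof.
split=> [N [subN _ _]|x y hx hy N mN|x b hx N mN].
- exact: submod0.
- by have [subN _ _] := mN; apply: submodB; [|apply: hx|apply: hy].
- by have [subN _ _] := mN; apply: submodZ => //; apply: hx.
Qed.

(** Zorn's lemma; finite generation guarantees that the union of a chain of proper submodules is
    proper. *)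
Lemma exists_maximal n (g : 'I_n -> M) (Y : set M) : generates g ->
  submodule Y -> (exists x, ~ Y x) ->
  exists2 N, maximal_submodule N & Y `<=` N.
Proof.
move=> gen subY [x0 Yx0].
(* Working with the union of [Y] and [Z] lets the empty chain be bounded by [Y] itself. *)
pose P (Z : set M) := submodule (Y `|` Z) /\ ~ forall k, (Y `|` Z) (g k).
have full (Z : set M) : submodule Z -> (forall k, Z (g k)) -> forall x, Z x.
  move=> subZ Zg x; have [c ->] := gen x.
  by apply: submod_sum => // k _; apply: submodZ.
have [|Z [[subZ Zg] Zmax]] := @Zorn_bigcup M P.
  move=> F FP Ftot; set W := \bigcup_(X in F) X.
  have YW x X : F X -> (Y `|` X) x -> (Y `|` W) x.
    by move=> FX [|Xx]; [left|right; exists X].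
  have in1 x : (Y `|` W) x -> Y x \/ exists2 X, F X & X x.
    by case=> [|[X FX Xx]]; [left|right; exists X].
  split.
    split=> [|x y|x b].
    - by left; apply: submod0.
    - move=> /in1[Yx|[X FX Xx]] /in1[Yy|[X' FX' Xy]].
      + by left; apply: submodB.
      + apply: (YW _ X') => //; have [subX' _] := FP _ FX'.
        by apply: submodB => //; [left|right].
      + apply: (YW _ X) => //; have [subX _] := FP _ FX.
        by apply: submodB => //; [right|left].
      + have [XX'|X'X] := Ftot _ _ FX FX'.
          apply: (YW _ X') => //; have [subX' _] := FP _ FX'.
          by apply: submodB => //; right => //; apply: XX'.
        apply: (YW _ X) => //; have [subX _] := FP _ FX.
        by apply: submodB => //; right => //; apply: X'X.
    - move=> /in1[Yx|[X FX Xx]]; first by left; apply: submodZ.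
      apply: (YW _ X) => //; have [subX _] := FP _ FX.
      by apply: submodZ => //; right.
  move=> Wg.
  have [[k Yk]|/forallNP Yg] := pselect (exists k, ~ Y (g k)); last first.
    by apply: Yx0; apply: full => // k; apply: contrapT; apply: Yg.
  have [X0 FX0] : exists X, F X.
    by case/in1: (Wg k) => // -[X FX _]; exists X.
  suff [X FX Xg] : exists2 X, F X & forall k, (Y `|` X) (g k).
    by have [_] := FP _ FX; apply.
  (* Members of a chain are comparable, so finitely many generators already lie in one of them. *)
  have : forall s : seq 'I_n, exists2 X, F X & forall k, k \in s -> (Y `|` X) (g k).
    elim=> [|l s [X FX Xs]]; first by exists X0.
    have [Yl|[X' FX' X'l]] := in1 _ (Wg l).
      by exists X => // m; rewrite inE => /orP[/eqP->|/Xs//]; left.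
    have [XX'|X'X] := Ftot _ _ FX FX'.
      exists X' => // m; rewrite inE => /orP[/eqP->|/Xs[]]; [by right|by left|].
      by move/XX'; right.
    exists X => // m; rewrite inE => /orP[/eqP->|/Xs//].
    by right; apply: X'X.
  move/(_ (enum 'I_n)) => [X FX Xs]; exists X => // m.
  by apply: Xs; rewrite mem_enum.
exists (Y `|` Z); last by move=> x; left.
split=> //; first by apply: contra_notP Zg => /forallNP h k; apply: contrapT; apply: h.
move=> V subV YZV [x [Vx YZx]]; apply: contrapT => /existsNP[y Vy].
have YV : Y `|` V = V by apply/seteqP; split=> z; [case=> // Yz; apply: YZV; left|right].
apply: (Zmax V); last first.
  by rewrite /P YV; split=> // Vg; apply: Vy; apply: full.
split; first by move=> z Zz; apply: YZV; right.
by move=> VZ; apply: YZx; right; apply: VZ.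
Qed.

(** If [Y] were proper it would lie in a maximal submodule, which also contains the radical and
    hence everything. *)
Lemma nakayama n (g : 'I_n -> M) (Y : set M) : generates g -> submodule Y ->
  (forall x, exists2 y, Y y & module_rad (x - y)) -> forall x, Y x.
Proof.
move=> gen subY YR x; apply: contrapT => Yx.
have [|N mN YN] := exists_maximal gen subY; first by exists x.
have [subN [z Nz] _] := mN; apply: Nz; have [y Yy zy] := YR z.
by rewrite -[z](subrK y); apply: submodD; [|apply: zy|apply: YN].
Qed.

(** For [x] outside [N] the quotient by [N] is simple and generated by [x], so the elements carrying
    [x] into [N] form a maximal right ideal, which contains [b]. *)
Lemma maximal_jacobson N x b :
  maximal_submodule N -> jacobson b -> N (act x b).
Proof.
move=> [subN _ Nmax] jb; have [Nx|Nx] := pselect (N x); first exact: submodZ.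
apply: (jb [set c | N (act x c)]); split.
- split=> [|c d /= Nc]; last by rewrite -(actA actP); apply: submodZ.
  split=> [|c d /= Nc Nd]; first by rewrite /= act0r; apply: submod0.
  by rewrite (actDr actP) actNr; apply: submodB.
- move=> e; apply: Nx; have : [set c | N (act x c)] 1 by rewrite e.
  by rewrite /= (act1 actP).
- move=> I [[I0 IB] IM] NI; have [IN|/existsNP[c /not_implyP[Ic Nc]]] :=
    pselect (forall c, I c -> N (act x c)); [left|right].
    by apply/seteqP; split.
  pose Z : set M := [set y | exists2 d, I d & N (y - act x d)].
  have subZ : submodule Z.
    split=> [|y z [d Id Nd] [e Ie Ne]|y e [d Id Nd]].
    - by exists 0 => //; rewrite act0r subr0; apply: submod0.
    - exists (d - e); first exact: IB.
      rewrite (actDr actP) actNr.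
      have -> : y - z - (act x d - act x e) = (y - act x d) - (z - act x e) by zmod.
      exact: submodB.
    - exists (d * e); first exact: IM.
      by rewrite -(actA actP) -actNl -(actDl actP); apply: submodZ.
  have [||d Id Nd] := Nmax Z subZ _ _ x.
  + by move=> y Ny; exists 0 => //; rewrite act0r subr0.
  + by exists (act x c); split=> //; exists c => //; rewrite subrr; apply: submod0.
  have I1 : I 1.
    have -> : (1 : B) = (1 - d) - (0 - d) by zmod.
    apply: (IB); last exact: IB.
    by apply: NI; rewrite /= (actDr actP) actNr (act1 actP).
  by apply/seteqP; split=> // d' _; rewrite -[d']mul1r; apply: IM.
Qed.

(** The Boolean sequence selects the members of the list to be intersected. Masks of a fixed length
    form a finite set, which in the end bounds the index. *)
Fixpoint mask_inter (T : bitseq) (Ms : seq (set M)) : set M :=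
  match T, Ms with
  | b :: T', N :: Ms' => (if b then N else setT) `&` mask_inter T' Ms'
  | _, _ => setT
  end.

Fixpoint all_maximal (Ms : seq (set M)) : Prop :=
  if Ms is N :: Ms' then maximal_submodule N /\ all_maximal Ms' else True.

Definition inter_all (Ms : seq (set M)) : set M :=
  mask_inter (nseq (size Ms) true) Ms.

Lemma mask_inter_sub T Ms : all_maximal Ms -> submodule (mask_inter T Ms).
Proof.
elim: Ms T => [|N Ms IHs] [|b T] //= [mN aMs].
apply: submoduleI; last exact: IHs.
by case: b; [case: mN|apply: submoduleT].
Qed.

(* Greedy choice: N is intersected with the current complement only if it does
   not yet contain the intersection with X. *)
Lemma complement (X : set M) (Ms : seq (set M)) : submodule X -> all_maximal Ms ->
  exists T, [/\ size T = size Ms,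
    forall z, exists x y, [/\ X x, mask_inter T Ms y & z = x + y] &
    X `&` mask_inter T Ms `<=` inter_all Ms].
Proof.
move=> subX aMs.
suff h : forall Y, submodule Y ->
    (forall z, exists x y, [/\ X x, Y y & z = x + y]) ->
    exists T, [/\ size T = size Ms,
      forall z, exists x y, [/\ X x, (Y `&` mask_inter T Ms) y & z = x + y] &
      X `&` (Y `&` mask_inter T Ms) `<=` inter_all Ms].
  have [|T [sT Tz XT]] := h _ submoduleT.
    by move=> z; exists 0, z; rewrite add0r; split=> //; apply: submod0.
  exists T; split=> //; last by move=> x [Xx Tx]; apply: XT.
  by move=> z; have [x [y [Xx [_ Ty] ->]]] := Tz z; exists x, y.
elim: Ms aMs => [|N Ms IHs] /= aMs Y subY XY.
  exists [::]; split=> //= z; have [x [y [Xx Yy ->]]] := XY z.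
  by exists x, y.
have [mN /IHs{}IHs] := aMs; have [subN _ Nmax] := mN.
have [XYN|/existsNP[x0 /not_implyP[[Xx0 Yx0] Nx0]]] :=
    pselect (X `&` Y `<=` N).
  have [T [sT Tz XT]] := IHs Y subY XY; exists (false :: T); split=> /=.
  - by rewrite sT.
  - move=> z; have [x [y [Xx [Yy Ty] ->]]] := Tz z.
    by exists x, y; split.
  - by move=> x [Xx [Yx [_ Tx]]]; split; [apply: XYN|apply: XT].
have [||T [sT Tz XT]] := IHs (Y `&` N); first exact: submoduleI.
  move=> z; have [x [y [Xx Yy ->]]] := XY z.
  pose Z : set M := [set v | exists2 w, (X `&` Y) w & N (v - w)].
  have subZ : submodule Z.
    split=> [|v v' [w [Xw Yw] Nw] [w' [Xw' Yw'] Nw']|v b [w [Xw Yw] Nw]].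
    - exists 0; first by split; apply: submod0.
      by rewrite subr0; apply: submod0.
    - exists (w - w'); first by split; apply: submodB.
      have -> : v - v' - (w - w') = (v - w) - (v' - w') by zmod.
      exact: submodB.
    - exists (act w b); first by split; apply: submodZ.
      by rewrite -actNl -(actDl actP); apply: submodZ.
  have [||w [Xw Yw] Nw] := Nmax Z subZ _ _ y.
  - move=> v Nv; exists 0; first by split; apply: submod0.
    by rewrite subr0.
  - exists x0; split=> //; exists x0 => //.
    by rewrite subrr; apply: submod0.
  exists (x + w), (y - w); split; [exact: submodD| |zmod].
  by split=> //; apply: submodB.
exists (true :: T); split=> /=.
- by rewrite sT.
- move=> z; have [x [y [Xx [[Yy Ny] Ty] ->]]] := Tz z.
  by exists x, y; split.
- by move=> x [Xx [Yx [Nx Tx]]]; split=> //; apply: XT.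
Qed.

(** Otherwise one could forever add a maximal submodule that does not contain the intersection so
    far, giving a strictly decreasing chain above [R0]. *)
Lemma finite_rad (R0 : set M) :
  (forall N, maximal_submodule N -> R0 `<=` N) ->
  (forall Y : nat -> set M, (forall n, submodule (Y n)) ->
    (forall n, Y n.+1 `<=` Y n) -> (forall n, R0 `<=` Y n) ->
    exists n, Y n `<=` Y n.+1) ->
  exists2 Ms, all_maximal Ms & inter_all Ms `<=` module_rad.
Proof.
move=> R0N dcc; apply: contrapT => /forall2NP h.
have /choice [next nextP] : forall Ms, exists N, all_maximal Ms ->
    maximal_submodule N /\ ~ (inter_all Ms `<=` N).
  move=> Ms; have [aMs|] := pselect (all_maximal Ms); last by exists setT.
  have [//|/existsNP[x /not_implyP[Mx Rx]]] := h Ms.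
  have /existsNP[N /not_implyP[mN Nx]] := Rx.
  by exists N => _; split=> // MN; apply: Nx; apply: MN.
pose L n := iter n (fun Ms => next Ms :: Ms) [::].
have aL n : all_maximal (L n).
  elim: n => //= n IHn; split=> //.
  by case: (nextP _ IHn).
have R0L n : R0 `<=` inter_all (L n).
  elim: n => //= n IHn x R0x; split; last exact: IHn.
  by apply: R0N R0x; case: (nextP _ (aL n)).
have [||//|n hn] := dcc (fun n => inter_all (L n)).
- by move=> n; apply: mask_inter_sub.
- by move=> n x [].
by have [_] := nextP _ (aL n); apply=> x /hn[].
Qed.

(** A finitely generated module over the artinian ring B/Jac(B) satisfies the descending chain
    condition. The argument runs through ideals of leading coefficients with respect to the ordered
    generators, and so avoids forming the quotient module. *)
Lemma dcc_semilocal n (g : 'I_n -> M) (Y : nat -> set M) :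
  semilocal B -> generates g -> (forall m, submodule (Y m)) ->
  (forall m, Y m.+1 `<=` Y m) ->
  (forall m x b, jacobson b -> Y m (act x b)) ->
  exists m, Y m `<=` Y m.+1.
Proof.
move=> [S [p [p_surj pJ _ [artS _]]]] gen subY decY jacY.
pose span k (v : M) := exists c : 'I_n -> B,
  v = \sum_(l < n | (l < k)%N) act (g l) (c l).
have spanB k v w : span k v -> span k w -> span k (v - w).
  move=> [c ->] [d ->]; exists (fun l => c l - d l); rewrite -sumrB.
  by apply: eq_bigr => l _; rewrite (actDr actP) actNr.
have spanZ k v b : span k v -> span k (act v b).
  move=> [c ->]; exists (fun l => c l * b); rewrite act_suml.
  by apply: eq_bigr => l _; rewrite (actA actP).
have span0 k : span k 0.
  by exists (fun=> 0); rewrite big1 // => l _; rewrite act0r.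
(* Leading coefficients, at the generator [g k], of those elements of [Y m] that involve only [g k]
   and earlier generators. *)
pose I m (k : 'I_n) : set B :=
  [set c | exists2 v, span k v & Y m (act (g k) c + v)].
pose pI m k : set S := [set s | exists2 c, I m k c & p c = s].
have pI_ideal m k : right_ideal (pI m k).
  split; first split.
  - exists 0; last by rewrite rmorph0.
    by exists 0 => //; rewrite act0r addr0; apply: submod0.
  - move=> _ _ [c [v sv Yv] <-] [d [w sw Yw] <-].
    exists (c - d); last by rewrite rmorphB.
    exists (v - w); first exact: spanB.
    by rewrite (actDr actP) actNr addrACA -opprD; apply: submodB.
  - move=> _ s [c [v sv Yv] <-]; have [b <-] := p_surj s.
    exists (c * b); last by rewrite rmorphM.
    exists (act v b); first exact: spanZ.
    by rewrite -(actA actP) -(actDl actP); apply: submodZ.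
have pI_dec m k : pI m.+1 k `<=` pI m k.
  by move=> _ [c [v sv Yv] <-]; exists c => //; exists v => //; apply: decY.
have /choice [N NP] : forall k, exists N, forall m, (N <= m)%N -> pI m k = pI N k.
  by move=> k; apply: artS.
pose m := \max_k N k.
have pIm k : pI m.+1 k = pI m k.
  by rewrite (NP k m.+1) ?(NP k m) // ?leqW // /m leq_bigmax.
have Im k c : I m k c -> I m.+1 k c.
  move=> Ic; have : pI m k (p c) by exists c.
  rewrite -pIm => -[d [v sv Yv] pd].
  have jcd : jacobson (c - d) by apply/pJ; rewrite rmorphB pd subrr.
  exists v => //; rewrite -[c](subrK d) (actDr actP) -addrA.
  by apply: submodD => //; apply: jacY.
exists m => x Yx.
(* Induction on the number of generators involved: subtracting an element of [Y m.+1] with the same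
   leading coefficient removes the last one. *)
suff h : forall k, (k <= n)%N -> forall v, span k v -> Y m v -> Y m.+1 v.
  apply: (h n) => //; have [c cE] := gen x; exists c; rewrite {1}cE.
  by apply: eq_bigl => l; rewrite ltn_ord.
elim=> [|k IHk] lt_kn v sv Yv.
  by have [c ->] := sv; rewrite big_pred0 //; apply: submod0.
pose k' := Ordinal lt_kn.
have [c cE] := sv.
pose w := \sum_(l < n | (l < k)%N) act (g l) (c l).
have sw : span k w by exists c.
have vE : v = act (g k') (c k') + w.
  rewrite cE (bigD1 k') //=; congr (_ + _); apply: eq_bigl => l.
  by rewrite ltnS [in RHS]ltn_neqAle andbC -val_eqE.
have [w' sw' Yw'] : I m.+1 k' (c k') by apply: Im; exists w => //; rewrite -vE.
rewrite vE -[w](subrK w') addrCA -/k'; apply: submodD => //.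
apply: (IHk (ltnW lt_kn)); first exact: spanB.
have -> : w - w' = v - (act (g k') (c k') + w') by rewrite vE; zmod.
by apply: submodB => //; apply: decY.
Qed.

End RightActions.

Section RadicalMaps.
Variables (B : pzRingType) (M M' : zmodType).
Variables (act : M -> B -> M) (act' : M' -> B -> M') (g : M -> M').
Hypothesis actP' : right_action act'.
Hypotheses (gD : {morph g : x y / x + y})
           (gZ : forall x b, g (act x b) = act' (g x) b).

Let g0 : g 0 = 0.
Proof. by apply: (addrI (g 0)); rewrite -gD !addr0. Qed.
Let gB x y : g (x - y) = g x - g y.
Proof. by apply/eqP; rewrite eq_sym subr_eq -gD subrK. Qed.

(** A maximal submodule of the target that misses [g x] pulls back to a maximal submodule of the
    source that misses [x]. *)
Lemma rad_map x : module_rad act x -> module_rad act' (g x).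
Proof.
move=> Rx N [subN _ Nmax]; apply: contrapT => Ngx.
apply: (Ngx); apply: (Rx [set z | N (g z)]); split.
- split=> [|y z Ny Nz|y b Ny] /=; first by rewrite g0; apply: submod0 subN.
    by rewrite gB; apply: (submodB subN).
  by rewrite gZ; apply: (submodZ subN).
- by exists x.
move=> Z subZ NZ [z [Zz Nz]] w.
pose W : set M' := [set y | exists2 z, Z z & N (y - g z)].
have subW : submodule act' W.
  split=> [|y y' [v Zv Nv] [v' Zv' Nv']|y b [v Zv Nv]].
  - exists 0; first exact: submod0 subZ.
    by rewrite g0 subr0; apply: submod0 subN.
  - exists (v - v'); first exact: (submodB subZ).
    have -> : y - y' - g (v - v') = (y - g v) - (y' - g v') by rewrite gB; zmod.
    exact: (submodB subN).
  - exists (act v b); first exact: (submodZ subZ).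
    by rewrite gZ -(actNl actP') -(actDl actP'); apply: (submodZ subN).
have [||v Zv Nv] := Nmax W subW _ _ (g w).
- by move=> y Ny; exists 0; [apply: submod0 subZ|rewrite g0 subr0].
- by exists (g z); split=> //; exists z => //; rewrite subrr; apply: submod0 subN.
rewrite -[w](subrK v); apply: (submodD subZ) => //.
by apply: NZ; rewrite /= gB.
Qed.

End RadicalMaps.

Lemma mul_action (B : pzRingType) : right_action (fun a b : B => a * b).
Proof.
by split=> [x y b|x b c|x b c|x]; rewrite ?mulrDl ?mulrDr ?mulrA ?mulr1.
Qed.

Lemma rad_jacobson (B : pzRingType) (b : B) :
  module_rad (fun a b : B => a * b) b -> jacobson b.
Proof.
move=> Rb I [[[I0 IB] IM] IT Imax]; apply: Rb; split=> //.
- by apply/existsNP => h; apply: IT; apply/seteqP; split=> // x _; apply: h.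
move=> Z [Z0 ZB ZM] IZ [x [Zx Ix]] y.
by have [|ZI|->//] := Imax Z _ IZ; [split|case: Ix; rewrite -ZI].
Qed.

Lemma rscale_action (A : pzRingType) (M : lmodType A^c) :
  right_action (@rscale A M).
Proof.
split=> [x y b|x b c|x b c|x]; first exact: rscaleDl.
- exact: rscaleDr.
- exact: rscaleA.
- exact: rscale1.
Qed.

(** * The radical of the endomorphism ring *)

Section SpaceRadical.
Variables (A : pzRingType) (P : lmodType A^c) (X : hspace P).
Local Notation act := (@rscale A P).
Local Notation actP := (rscale_action P).
Local Notation h := (hs_h X).
Local Notation x_ := (@hs_x _ _ X).
Local Notation y_ := (@hs_y _ _ X).
Local Notation star := (hs_star X).
Local Notation rad := (module_rad act).

Lemma hs_generates : generates act x_.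
Proof. by move=> z; exists (fun k => h (y_ k) z); apply: hbasis. Qed.

(** The [x_ k] generate without being a basis, so this map need not send [x_ k] to [v k]; still, an
    endomorphism is recovered from its own values on the generators ([of_values_basis]). *)
Definition of_values (v : 'I_(hs_dim X) -> P) : endo P :=
  @make_endo A P (fun z => \sum_k v k *> h (y_ k) z)
    (fun z w => etrans (eq_bigr _ (fun k _ =>
         etrans (congr1 _ (hDr X (y_ k) z w)) (rscaleDr _ _ _))) (big_split _ _ _ _ _))
    (fun z a => etrans (eq_bigr _ (fun k _ =>
         etrans (congr1 _ (hZr X (y_ k) z a)) (esym (rscaleA _ _ _))))
       (esym (rscale_suml _ _ _ _))).

Lemma of_valuesE v z : of_values v z = \sum_k v k *> h (y_ k) z.
Proof. by []. Qed.

Lemma of_values_comp (e : endo P) v :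
  e * of_values v = of_values (fun k => e (v k)).
Proof.
apply/endoP => z; rewrite endoM !of_valuesE linear_sum.
by apply: eq_bigr => k _; rewrite linear_rscale.
Qed.

Lemma of_values_basis (e : endo P) : of_values (fun k => e (x_ k)) = e.
Proof.
rewrite -of_values_comp -[RHS]mulr1; congr (_ * _).
by apply/endoP => z; rewrite of_valuesE -hbasis.
Qed.

Definition rad_ideal : set (endo P) := [set e | forall z, rad (e z)].
Local Notation J := rad_ideal.

Lemma rad_ideal_ideal : two_sided_ideal J.
Proof.
have subR := module_rad_sub act.
split; last first.
  move=> e g Je z; apply: (@rad_map A P P act act g actP _ _ _ (Je z)) => [x y|x b].
    exact: linearD.
  exact: linear_rscale.
split=> [|e g Je z]; last exact: Je.
by split=> [z|e g Je Jg z]; [apply: submod0 subR|apply: (submodB subR)].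
Qed.

(** By Nakayama [1 - j] is surjective; preimages of the generators assemble into a right inverse. *)
Lemma rad_ideal_quasi_inv j : J j -> exists x, (1 - j) * x = 1.
Proof.
move=> Jj; pose Y : set P := [set y | exists z, y = (1 - j) z].
have subY : submodule act Y.
  split=> [|x y [z ->] [w ->]|x b [z ->]].
  - by exists 0; rewrite linear0.
  - by exists (z - w); rewrite (linearB (1 - j)).

  - by exists (z *> b); rewrite linear_rscale.
have /choice [v vE] : forall k, exists z, x_ k = (1 - j) z.
  move=> k; apply: (nakayama hs_generates subY) => x.
  exists ((1 - j) x); first by exists x.
  by rewrite endoB endo1 subKr.
exists (of_values v); rewrite of_values_comp -[RHS]of_values_basis.
by congr of_values; apply/funext => k; rewrite -vE.
Qed.

(** This identifies [J] with the Jacobson radical of the endomorphism ring. If [e z] avoids a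
    maximal [N], each generator is congruent to a multiple of [e z] modulo [N]; the resulting
    endomorphism [x] makes [1 - e * x] map into [N], so it is not surjective. *)
Lemma rad_idealP e :
  J e <-> forall x, exists y, (1 - e * x) * y = 1.
Proof.
split=> [Je x|h z].
  apply: rad_ideal_quasi_inv; exact: (tidealMr rad_ideal_ideal).
move=> N mN; apply: contrapT => Nez; have [subN [w Nw] Nmax] := mN.
pose Z : set P := [set v | exists c, N (v - e z *> c)].
have subZ : submodule act Z.
  split=> [|v v' [c Nc] [c' Nc']|v b [c Nc]].
  - by exists 0; rewrite rscale0 subr0; apply: submod0 subN.
  - exists (c - c'); rewrite rscaleBr.
    have -> : v - v' - (e z *> c - e z *> c') =
              (v - e z *> c) - (v' - e z *> c') by zmod.
    exact: (submodB subN).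
  - exists (c * b); rewrite -rscaleA -rscaleBl.
    exact: (submodZ subN).
have /choice [c cE] : forall k, exists c, N (x_ k - e z *> c).
  move=> k; apply: (Nmax Z subZ) => [v Nv|].
    by exists 0; rewrite rscale0 subr0.
  by exists (e z); split=> //; exists 1; rewrite rscale1 subrr; apply: submod0 subN.
have [y /(congr1 (fun g : endo P => g w))] := h (of_values (fun k => z *> c k)).
rewrite of_values_comp endoM endo1 => wE; apply: Nw; rewrite -wE.
rewrite endoB endo1 of_valuesE {1}[y w](hbasis X) -sumrB.
apply: (submod_sum subN) => k _; rewrite linear_rscale -rscaleBl.
exact: (submodZ subN).
Qed.

(** [rad_idealP] speaks of right inverses, while [star] turns them into left ones. A right inverse
    of 1 - j is again 1 minus an element of [J], hence right invertible itself, so it is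
    two-sided. *)
Lemma rad_ideal_star e : J e -> J (star e).
Proof.
move=> Je; apply/rad_idealP => x; have U := hs_star_unitary X.
have J1 : J (star x * e) by apply: (tidealMl rad_ideal_ideal).
have [y yE] := rad_ideal_quasi_inv J1.
have [z zE] : exists z, y * z = 1.
  have -> : y = 1 - - (star x * e * y).
    by apply/eqP; rewrite opprK -subr_eq -{1}[y]mul1r -mulrBl yE.
  apply: rad_ideal_quasi_inv; apply: (tidealN rad_ideal_ideal).
  exact: (tidealMr rad_ideal_ideal).
exists (star y).
have -> : 1 - star e * x = star (1 - star x * e).
  by rewrite (involB U) (invol1 U) (involM U) (involK U).
have ze : z = 1 - star x * e by rewrite -[z]mul1r -{1}yE -mulrA zE mulr1.
by rewrite -(involM U) -ze zE (invol1 U).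
Qed.

(** The functionals h(y_k, -) carry the radical of [P] into Jac(A), and the expansion in the [x_ k]
    then exhibits [x] in P Jac(A). This links [rad] to the kernel in a [factorization]. *)
Lemma rad_module_jacobson x : rad x <-> module_jacobson x.
Proof.
split=> [Rx|[s [sJ ->]] N mN].
  exists [seq (x_ k, h (y_ k) x) | k : 'I_(hs_dim X)]; split.
    move=> _ /mapP[k _ ->] /=; apply: rad_jacobson.
    apply: (@rad_map A P A act _ (h (y_ k)) (mul_action A) _ _ _ Rx) => [z w|z b].
      exact: hDr.
    exact: hZr.
  by rewrite big_map big_enum /= {1}[x](hbasis X).
have [subN _ _] := mN; rewrite big_seq; apply: (submod_sum subN) => p /sJ jp.
exact: maximal_jacobson actP _ _ _ mN jp.
Qed.

(* The relative inverse s of a modulo the radical maps x to a preimage of its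
   projection onto the image of a along the complement Y. *)
Lemma relative_inverse (a : endo P) (Ms : seq (set P)) :
  all_maximal act Ms -> inter_all Ms `<=` rad ->
  exists T s, [/\ size T = size Ms, J (a * s * a - a),
    forall x, mask_inter T Ms (x - a (s x)) &
    forall x, mask_inter T Ms (a x) -> rad (a x)].
Proof.
move=> aMs RMs; pose Y : set P := [set y | exists z, y = a z].
have subY : submodule act Y.
  split=> [|x y [z ->] [w ->]|x b [z ->]].
  - by exists 0; rewrite linear0.
  - by exists (z - w); rewrite linearB.
  - by exists (z *> b); rewrite linear_rscale.
have [T [sT YT TR]] := complement actP subY aMs.
have subT := mask_inter_sub T aMs.
have /choice [v vE] : forall k, exists z, mask_inter T Ms (x_ k - a z).
  move=> k; have [_ [y [[z ->] Ty ->]]] := YT (x_ k).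
  by exists z; rewrite addrC addKr.
have sE x : mask_inter T Ms (x - a (of_values v x)).
  rewrite -[a _](endoM a) of_values_comp of_valuesE {1}[x](hbasis X) -sumrB.
  apply: (submod_sum subT) => k _; rewrite -rscaleBl.
  exact: (submodZ subT).
have TaR x : mask_inter T Ms (a x) -> rad (a x).
  by move=> Tx; apply: RMs; apply: TR; split=> //; exists x.
exists T, (of_values v); split=> // z.
have -> : (a * of_values v * a - a) z = a (of_values v (a z) - z).
  by rewrite linearB.
apply: TaR; rewrite linearB -opprB; apply: (submodN subT).
exact: sE.
Qed.

End SpaceRadical.

(** * Isometries reached by the parametrisation *)

Section Transformations.
Variables (A : pzRingType) (P : lmodType A^c) (X : hspace P).
Local Notation E := (endo P).
Local Notation star := (hs_star X).
Local Notation J := (@rad_ideal A P).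
Local Notation U := (hs_star_unitary X).

Definition sum_row : 'M[E]_(1, (1 + 1) + (1 + 1)) :=
  row_mx (row_mx 1%:M 1%:M) 0.

(** Of the four slots the first two carry a pair of isometries and the last two their borders. One
    fixed format thus serves both a product and, with second factor 1, a single isometry. *)
Definition transformation (e : E) : Prop :=
  exists g G : 'M[E]_((1 + 1) + (1 + 1)), [/\ g *m G = 1%:M, G *m g = 1%:M,
    mx_param star (hs_lam X)
      (g - adjmx star sum_row *m (hs_eps X)%:M *m sum_row) &
    e%:M = 1%:M - sum_row *m G *m adjmx star sum_row].

Hypothesis fin : forall n (M M' : 'M[E]_n), M *m M' = 1%:M -> M' *m M = 1%:M.

Let product := @product_transformation E star (hs_lam X) U J (hs_eps X)
  (hs_eps_star X) (rad_ideal_ideal P) (@rad_ideal_star _ _ X)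
  (@rad_ideal_quasi_inv _ _ X) fin.

Let diagM (R : pzRingType) (x y x' y' : 'M[R]_1) :
  block_mx x 0 0 y *m block_mx x' 0 0 y' = block_mx (x *m x') 0 0 (y *m y').
Proof. by rewrite mulmx_block !(mulmx0, mul0mx, addr0, add0r). Qed.

Let sc1B (x y : E) : x%:M - y%:M = (x - y)%:M :> 'M[E]_1.
Proof. by apply/matrixP => k l; rewrite !mxE !ord1. Qed.
Let param1 (l : E) : hs_lam X l -> mx_param star (hs_lam X) (l%:M : 'M_1).
Proof.
move=> hl; split=> [|k]; last by rewrite ord1 mxE.
rewrite (adjmx_scalar U); have := param_max U hl; rewrite mulr1 => ->.
by apply/matrixP => i j; rewrite !mxE !ord1.
Qed.

(** The product construction with [psi = 1] and [t = 0]. *)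
Lemma transformation_of_form (phi s lam mu : E) : hs_iso X phi ->
  let a := 1 - phi in let p := a * s in
  J (a * s * a - a) -> hs_lam X lam -> J (star p * lam * p * mu - star p) ->
  transformation phi.
Proof.
move=> phiP a p aJ lamP pJ; rewrite /transformation.
have iso1 : hs_iso X 1.
  split; rewrite ?(invol1 U) ?mulr1 // mul1r subrr; exact: (param0 U).
have J0 := tideal0 (rad_ideal_ideal P).
have := @product phi 1 s 0 (block_mx lam%:M 0 0 0) (block_mx mu%:M 0 0 0).
cbv zeta; rewrite mulr1 !subrr; apply=> //.
- by rewrite !mulr0 subrr.
- apply: (mx_param_block U); [exact: param1|exact: (mx_param0 U)|].
  by rewrite (adjmx0 U) oppr0.
rewrite mulr0 adjmx_block !(adjmx_scalar U) !(adjmx0 U) (invol0 U) !diagM.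
have s0 : (0 : E)%:M = 0 :> 'M[E]_1 by apply/matrixP => i j; rewrite !mxE mul0rn.
rewrite s0 !mulmx0 -!scalar_mxM opp_block_mx add_block_mx sc1B !subrr.
move=> i j.
case: (split_ordP i) => k ->; case: (split_ordP j) => l ->;
  by rewrite ?(block_mxEul, block_mxEur, block_mxEdl, block_mxEdr) mxE ?ord1.
Qed.

(** Modulo the radical, [p] and [q] are the projections onto the images of [a] and [c] along the
    same complement, whence [p * q = p] and [q * p = q]. The two images are therefore identified
    with each other, and a nondegenerate form on one becomes a pairing between them; placed off the
    diagonal, with minus its adjoint opposite, it is a Lambda-matrix. *)
Lemma transformation_same_mask (phi psi s t : E) (Ms : seq (set P)) T :
  hs_iso X phi -> hs_iso X psi -> all_maximal (@rscale A P) Ms ->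
  let a := 1 - phi in let c := 1 - psi in
  J (a * s * a - a) -> J (c * t * c - c) ->
  (forall x, mask_inter T Ms (x - a (s x))) ->
  (forall x, mask_inter T Ms (x - c (t x))) ->
  (forall x, mask_inter T Ms (a x) -> module_rad (@rscale A P) (a x)) ->
  (forall x, mask_inter T Ms (c x) -> module_rad (@rscale A P) (c x)) ->
  transformation (phi * psi).
Proof.
move=> phiP psiP aMs a c aJ cJ Ts Tt Ta Tc.
have subT := mask_inter_sub T aMs.
have idJ := rad_ideal_ideal P.
(* [k] is the Wall form of [phi]: h(x, k y) = h(s x, a (s y)). *)
pose p := a * s; pose q := c * t; pose k := star s * p.
have pq : J (p * q - p).
  move=> x; have -> : (p * q - p) x = a (s (q x - x)).
    by rewrite (linearB s) (linearB a).
  apply: Ta; have yT : mask_inter T Ms (q x - x).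
    by rewrite -opprB; apply: (submodN subT); apply: Tt.
  have := submodB subT yT (Ts (q x - x)).
  by rewrite opprB addrC subrK.
have qp : J (q * p - q).
  move=> x; have -> : (q * p - q) x = c (t (p x - x)).
    by rewrite (linearB t) (linearB c).
  apply: Tc; have yT : mask_inter T Ms (p x - x).
    by rewrite -opprB; apply: (submodN subT); apply: Ts.
  have := submodB subT yT (Tt (p x - x)).
  by rewrite opprB addrC subrK.
pose lam : 'M[E]_(1 + 1) := block_mx 0 k%:M (- (star k)%:M) 0.
pose mu : 'M[E]_(1 + 1) := block_mx 0 (- (a * star q))%:M (star a)%:M 0.
apply: (@product phi psi s t lam mu) => //.
  apply: (mx_param_block U); try exact: (mx_param0 U).
  by rewrite (adjmx_scalar U).
have [R [pi [piJ _]]] := quotient_ring idJ.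
have piE x y : J (x - y) -> pi x = pi y.
  by move=> /piJ; rewrite rmorphB => /eqP; rewrite subr_eq0 => /eqP.
have starJ x y : J (x - y) -> pi (star x) = pi (star y).
  by move=> h; apply: piE; rewrite -(involB U); apply: rad_ideal_star.
have [phi1 phi2 _] := phiP.
have as1 : star a = - (star phi * a).
  by rewrite /a (involB U) (invol1 U) mulrBr phi1 mulr1 opprB.
have as2 : star a = - (a * star phi).
  by rewrite /a (involB U) (invol1 U) mulrBl phi2 mul1r opprB.
have asa : pi a * pi s * pi a = pi a by rewrite -!rmorphM; apply: piE.
have asas : pi (star a) * pi (star s) * pi (star a) = pi (star a).
  by have := starJ _ _ aJ; rewrite !(involM U) !rmorphM mulrA.
have PQ : pi p * pi q = pi p by rewrite -rmorphM; apply: piE.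
have PQs : pi (star q) * pi (star p) = pi (star p).
  by rewrite -rmorphM -(involM U); apply: starJ.
have QPs : pi (star p) * pi (star q) = pi (star q).
  by rewrite -rmorphM -(involM U); apply: starJ.
have pE : pi p = pi a * pi s by rewrite rmorphM.
have psE : pi (star p) = pi (star s) * pi (star a) by rewrite (involM U) rmorphM.
have e1 : pi (star p) * pi (star s) * pi p * pi (star a) = pi (star p).
  have : pi p * pi (star a) = pi (star a).
    by rewrite pE as2 rmorphN mulrN rmorphM !mulrA asa.
  by rewrite -!mulrA => ->; rewrite psE -!mulrA [pi (star a) * _]mulrA asas.
have e2 : pi (star p) * pi s * pi p * pi a = pi (star p).
  rewrite pE -!mulrA [pi a * _]mulrA asa psE -!mulrA; congr (_ * _).
  by rewrite as1 rmorphN mulNr rmorphM -mulrA [pi a * _]mulrA asa.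
have J0 := tideal0 idJ.
have kE : pi k = pi (star s) * pi p by rewrite rmorphM.
have ksE : pi (star k) = pi (star p) * pi s.
  by rewrite (involM U) (involK U) rmorphM.
have E1 : J (star p * k * q * star a - star p).
  apply/piJ; rewrite rmorphB (rmorphM pi (star p * k * q)).
  rewrite (rmorphM pi (star p * k)) (rmorphM pi (star p)) kE.
  by rewrite mulrA -(mulrA _ (pi p) (pi q)) PQ e1 subrr.
have E2 : J (star q * star k * p * (a * star q) - star q).
  apply/piJ; rewrite rmorphB (rmorphM pi (star q * star k * p)).
  rewrite (rmorphM pi (star q * star k)) (rmorphM pi (star q)) ksE.
  by rewrite (rmorphM pi a (star q)) !mulrA PQs e2 QPs subrr.
have sc1N (x : E) : (- x)%:M = - x%:M :> 'M[E]_1.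
  by apply/matrixP => i j; rewrite !mxE !ord1.
rewrite adjmx_block !(adjmx_scalar U) !(adjmx0 U).
rewrite !mulmx_block !(mulmx0, mul0mx, addr0, add0r) sc1N.
rewrite !(mulmxN, mulNmx) opprK -!scalar_mxM opp_block_mx add_block_mx !sc1B.
rewrite subrr => i j; case: (split_ordP i) => i' ->; case: (split_ordP j) => j' ->;
  by rewrite ?(block_mxEul, block_mxEur, block_mxEdl, block_mxEdr) mxE ?ord1.
Qed.

End Transformations.

(** * Simple artinian rings and division idempotents *)

Definition simple_ring (B : pzRingType) : Prop :=
  forall (I : set B) x, two_sided_ideal I -> I x -> x <> 0 -> I 1.

(** For a proper nonzero ideal [I], both the intersection and the sum of [I] with its image under
    [sigma] are stable, hence 0 and everything. The components of 1 in this decomposition are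
    central idempotents exchanged by [sigma]. *)
Lemma exchange_or_simple (B : pzRingType) (sigma : B -> B) (u : B) (L : set B) :
  simple_artinian_unitary sigma u L ->
  (exists e, [/\ central e, e * e = e & sigma e = 1 - e]) \/ simple_ring B.
Proof.
case=> U _ _ simp; have [|noe] := pselect (exists e, [/\ central e, e * e = e & sigma e = 1 - e]);
  first by left.
right=> I x idI Ix x0.
pose I' : set B := [set b | I (sigma b)].
have idI' : two_sided_ideal I'.
  split; last by move=> a b Ia; rewrite /I' /= (involM U); exact: (tidealMr idI).
  split; last by move=> a b Ia; rewrite /I' /= (involM U); exact: (tidealMl idI).
  split=> [|a b Ia Ib]; first by rewrite /I' /= (invol0 U); exact: (tideal0 idI).
  by rewrite /I' /= (involB U); exact: (tidealB idI).
have stable (K : set B) : (forall a, K a -> K (sigma a)) -> sigma @` K = K.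
  move=> h; apply/seteqP; split=> [_ [a Ka <-]|a Ka]; first exact: h.
  by exists (sigma a); [apply: h|rewrite (involK U)].
have idK : two_sided_ideal (I `&` I').
  split; first split; first split.
  - by split; [exact: (tideal0 idI)|exact: (tideal0 idI')].
  - by move=> a b [Ia Ja] [Ib Jb]; split; [exact: (tidealB idI)|exact: (tidealB idI')].
  - by move=> a b [Ia Ja]; split; [exact: (tidealMr idI)|exact: (tidealMr idI')].
  - by move=> a b [Ia Ja]; split; [exact: (tidealMl idI)|exact: (tidealMl idI')].
have K0 : I `&` I' = [set 0] \/ I `&` I' = setT.
  by apply: simp => //; apply: stable => a [Ia Ja]; split; rewrite /I' /= ?(involK U).
case: K0 => [K0|KT]; last by have [] : (I `&` I') 1 by rewrite KT.
pose S : set B := [set a | exists b c, [/\ I b, I' c & a = b + c]].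
have idS : two_sided_ideal S.
  split; first split; first split.
  - exists 0, 0; rewrite addr0.
    by split; [exact: (tideal0 idI)|exact: (tideal0 idI')|].
  - move=> _ _ [b [c [Ib Ic ->]]] [b' [c' [Ib' Ic' ->]]].
    exists (b - b'), (c - c'); split; [exact: (tidealB idI)|exact: (tidealB idI')|].
    zmod.
  - move=> _ d [b [c [Ib Ic ->]]]; exists (b * d), (c * d).
    by rewrite mulrDl; split; [exact: (tidealMr idI)|exact: (tidealMr idI')|].
  - move=> _ d [b [c [Ib Ic ->]]]; exists (d * b), (d * c).
    by rewrite mulrDr; split; [exact: (tidealMl idI)|exact: (tidealMl idI')|].
have ST : S = setT.
  have [|S0|//] := simp S idS.
    apply: stable => _ [b [c [Ib Ic ->]]]; exists (sigma c), (sigma b).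
    by rewrite (involD U) addrC /I' /= (involK U).
  have : S x by exists x, 0; rewrite addr0; split=> //; exact: (tideal0 idI').
  by rewrite S0 => /x0.
have [e [e' [Ie Ie' e1]]] : S 1 by rewrite ST.
have zero a b : I a -> I' b -> a = b -> a = 0.
  move=> Ia Ib ab; suff : (I `&` I') a by rewrite K0.
  by split; rewrite ?ab // -ab.
have e'E : e' = 1 - e by rewrite e1 addrC addKr.
have ee' : e * e' = 0.
  by apply: (zero _ (e * e')) => //; [exact: (tidealMr idI)|exact: (tidealMl idI')].
case: noe; exists e; split.
- move=> b; apply/eqP; rewrite -subr_eq0; apply/eqP.
  apply: (zero _ (b * e' - e' * b)).
  + by apply: (tidealB idI); [exact: (tidealMr idI)|exact: (tidealMl idI)].
  + by apply: (tidealB idI'); [exact: (tidealMl idI')|exact: (tidealMr idI')].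
  + by rewrite e'E mulrBr mulrBl mulr1 mul1r; zmod.
- by apply/eqP; rewrite -subr_eq0 -opprB oppr_eq0 -{1}[e]mulr1 -mulrBr -e'E ee'.
- have se' : I (sigma e') by [].
  have se : I' (sigma e) by rewrite /I' /= (involK U).
  have : sigma e + sigma e' = e' + e by rewrite -(involD U) -e1 (invol1 U) addrC.
  rewrite -e'E => /eqP; rewrite -subr_eq0 => h.
  have h' : sigma e' - e = e' - sigma e.
    by apply/eqP; rewrite -subr_eq0 -(eqP h); apply/eqP; zmod.
  have h0 : sigma e' - e = 0.
    apply: (zero _ _ _ _ h'); first exact: (tidealB idI).
    exact: (tidealB idI').
  by apply/esym/eqP; rewrite -subr_eq0 -h' h0.
Qed.

Record division_idempotent (B : pzRingType) (e : B) : Prop := DivisionIdempotent {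
  di_idem : e * e = e;
  di_neq0 : e <> 0;
  di_inv : forall d, e * d * e = d -> d <> 0 ->
    exists d', [/\ e * d' * e = d', d * d' = e & d' * d = e]
}.

(** Brauer's lemma. A minimal right ideal [I] of a simple ring does not square to zero; if [x] in
    [I] does not kill [I], left multiplication by [x] is bijective on [I], and the solution of x e =
    x in [I] is the idempotent. *)
Lemma exists_division_idempotent (B : pzRingType) :
  right_artinian B -> simple_ring B -> (1 : B) <> 0 ->
  exists e : B, division_idempotent e.
Proof.
move=> art simp one0.
pose nz (I : set B) := right_ideal I /\ exists2 x, I x & x <> 0.
have [I [[riI [x0 Ix0 x0n]] Imin]] : exists I, nz I /\
    forall K, nz K -> K `<=` I -> I `<=` K.
  apply: contrapT => /forallNP h.
  have /choice [next nextP] : forall I, exists K, nz I ->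
      [/\ nz K, K `<=` I & ~ (I `<=` K)].
    move=> I; have [nI|] := pselect (nz I); last by exists setT.
    have /not_andP[//|/existsNP[K /not_implyP[nK /not_implyP[KI IK]]]] := h I.
    by exists K.
  pose L n := iter n next setT.
  have nL n : nz (L n).
    elim: n => [|n /nextP[]//]; split; last by exists 1.
    by split; first split.
  have [N hN] : exists N, forall n, (N <= n)%N -> L n = L N.
    by apply: art => n; [case: (nL n)|case: (nextP _ (nL n))].
  have [_ _] := nextP _ (nL N); apply.
  by rewrite -[next _]/(L N.+1) hN.
have [[I0 IB] IM] := riI.
have [x Ix [y Iy xy]] : exists2 x, I x & exists2 y, I y & x * y <> 0.
  apply: contrapT => /forall2NP h.
  have xy x y : I x -> I y -> x * y = 0.
    move=> Ix Iy; apply: contrapT => n; case: (h x) => // -[].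
    by exists y.
  pose K : set B := [set z | forall x, I x -> x * z = 0].
  have K1 : K 1.
    apply: (simp K x0) => //; last by move=> x Ix; apply: xy.
    split; first split; first split.
    - by move=> x _; rewrite mulr0.
    - by move=> a b ha hb x Ix; rewrite mulrBr ha // hb // subrr.
    - by move=> a b ha x Ix; rewrite mulrA ha // mul0r.
    - by move=> a b ha x Ix; rewrite mulrA ha //; apply: IM.
  by apply: x0n; rewrite -[x0]mulr1 K1.
have inj z : I z -> x * z = 0 -> z = 0.
  move=> Iz xz; apply: contrapT => zn.
  pose K : set B := [set z | I z /\ x * z = 0].
  have [||] := Imin K _ _ y Iy; last by [].
    split; last by exists z.
    split; last by move=> a b [Ia ha]; split; [apply: IM|rewrite mulrA ha mul0r].
    split; first by split=> //; rewrite mulr0.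
    by move=> a b [Ia ha] [Ib hb]; split; [apply: IB|rewrite mulrBr ha hb subrr].
  by move=> a [].
have xI : forall z, I z -> exists2 w, I w & z = x * w.
  move=> z Iz; apply: (Imin [set z | exists2 w, I w & z = x * w]) => //.
    split; last by exists (x * y) => //; exists y.
    split; last by move=> _ b [w Iw ->]; exists (w * b); rewrite ?mulrA //; apply: IM.
    split; first by exists 0; rewrite ?mulr0.
    by move=> _ _ [w Iw ->] [w' Iw' ->]; exists (w - w'); rewrite ?mulrBr //; apply: IB.
  by move=> _ [w Iw ->]; apply: IM.
have [e Ie xe] := xI x Ix.
have ee : e * e = e.
  apply/eqP; rewrite -subr_eq0; apply/eqP; apply: inj.
    by apply: IB => //; apply: IM.
  by rewrite mulrBr mulrA -!xe subrr.
have en : e <> 0.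
  by move=> e0; apply: xy; rewrite xe e0 mulr0 mul0r.
have right_inv d : e * d * e = d -> d <> 0 -> exists2 d', e * d' * e = d' & d * d' = e.
  move=> de dn.
  have Id : I d by rewrite -de -mulrA; apply: IM.
  have [b be] : exists b, e = d * b.
    apply: (Imin [set z | exists b, z = d * b]) => //.
      split; last by exists d => //; exists 1; rewrite mulr1.
      split; last by move=> _ b [w ->]; exists (w * b); rewrite mulrA.
      split; first by exists 0; rewrite mulr0.
      by move=> _ _ [w ->] [w' ->]; exists (w - w'); rewrite mulrBr.
    by move=> _ [w ->]; apply: IM.
  exists (e * b * e); first by rewrite !mulrA ee -mulrA ee.
  by rewrite !mulrA -{1}de -!mulrA [e * (e * _)]mulrA ee !mulrA de -be ee.
exists e; split=> // d de dn.
have [d' d'e dd'] := right_inv d de dn.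
have d'n : d' <> 0 by move=> d'0; apply: en; rewrite -dd' d'0 mulr0.
have [d'' d''e d'd''] := right_inv d' d'e d'n.
exists d'; split=> //.
have -> : d = d''.
  have de' : d * e = d by rewrite -{1}de -mulrA ee de.
  have ed'' : e * d'' = d'' by rewrite -{1}d''e !mulrA ee d''e.
  by rewrite -[LHS]de' -d'd'' mulrA dd' ed''.
exact: d'd''.
Qed.

(** * Linear algebra over the division ring eBe *)

Section Systems.
Variables (B : pzRingType) (e : B).
Hypotheses (simpB : simple_ring B) (eP : division_idempotent e).
Let ee := di_idem eP.

Lemma corner_neq0 b : b <> 0 -> exists c, e * c * b <> 0.
Proof.
move=> bn; apply: contrapT => /forallNP h.
apply: (di_neq0 eP); suff : [set z | forall c, e * c * z = 0] 1.
  by move=> /(_ 1); rewrite !mulr1.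
apply: (simpB (x := b)) => // [|c]; last by apply: contrapT; apply: h.
split; first split; first split.
- by move=> c; rewrite mulr0.
- by move=> x y hx hy c; rewrite mulrBr hx hy subrr.
- by move=> x y hx c; rewrite mulrA hx mul0r.
- by move=> x y hx c; rewrite mulrA -[e * c * y]mulrA hx.
Qed.

Section SystemModule.
Variables (M : zmodType) (act : M -> B -> M).
Hypothesis actP : right_action act.

Definition functional (psi : M -> B) : Prop :=
  {morph psi : x y / x + y} /\ forall x b, psi (act x b) = psi x * b.

Hypothesis sep : forall x, x <> 0 -> exists2 psi, functional psi & psi x <> 0.

(* xi is a basis of the e-corner of the submodule generated by gs, over the
   division ring eBe, and chi is dual to it. *)
Definition dual_system (gs : seq M) r (xi : 'I_r -> M) (chi : 'I_r -> M -> B) :=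
  [/\ forall j, functional (chi j) /\ forall x, e * chi j x = chi j x,
      forall j, act (xi j) e = xi j,
      forall j k, chi j (xi k) = if j == k then e else 0,
      forall Y, submodule act Y -> (forall g, g \in gs -> Y g) ->
        forall j, Y (xi j) &
      forall g, g \in gs -> g = \sum_j act (xi j) (chi j g)].

Lemma functionalB psi x y : functional psi -> psi (x - y) = psi x - psi y.
Proof.
by case=> pD _; apply/eqP; rewrite eq_sym subr_eq -pD subrK.
Qed.
Lemma functional0 psi : functional psi -> psi 0 = 0.
Proof. by move=> h; rewrite -(subrr 0) (functionalB _ _ h) subrr. Qed.
Lemma functional_sum psi (I : Type) (r : seq I) (Q : pred I) (F : I -> M) :
  functional psi ->
  psi (\sum_(i <- r | Q i) F i) = \sum_(i <- r | Q i) psi (F i).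
Proof.
move=> h; elim/big_rec2: _ => [|i y z _ <-]; first exact: functional0.
by case: h => ->.
Qed.

Lemma dual_system_span gs r (xi : 'I_r -> M) chi Y x : dual_system gs xi chi ->
  (forall y, Y y <-> forall Z, submodule act Z -> (forall g, g \in gs -> Z g) -> Z y) ->
  Y x -> x = \sum_j act (xi j) (chi j x).
Proof.
move=> [fchi xie chixi _ gsE] YE /YE h.
apply: (h [set z | z = \sum_j act (xi j) (chi j z)]) => //; split=> /=.
- by rewrite big1 // => j _; rewrite functional0 ?(act0r actP) //; case: (fchi j).
- move=> z w {1}-> {1}->; rewrite -sumrB; apply: eq_bigr => j _.
  by rewrite functionalB ?(actDr actP) ?(actNr actP) //; case: (fchi j).
- move=> z b {1}->; rewrite (act_suml actP); apply: eq_bigr => j _.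
  by rewrite (actA actP); case: (fchi j) => -[_ ->].
Qed.

(** Gram-Schmidt over eBe: the part [pr g] of a new generator not yet accounted for is either zero
    or is separated from zero by a functional, which can be normalised because nonzero elements of
    eBe are invertible. *)
Lemma exists_dual_system gs : (forall g, g \in gs -> act g e = g) ->
  exists r (xi : 'I_r -> M) chi, dual_system gs xi chi.
Proof.
elim: gs => [|g gs IHgs] gse.
  by exists 0%N, (fun=> 0), (fun _ _ => 0); split=> [[]|[]|[]|Y _ _ []|g] //.
have [|r [xi [chi [fchi xie chixi xiY gsE]]]] := IHgs.
  by move=> g' g'gs; apply: gse; rewrite inE g'gs orbT.
pose pr x := x - \sum_j act (xi j) (chi j x).
have prD x y : pr (x + y) = pr x + pr y.
  rewrite /pr -[RHS]addrACA -opprD -big_split /=; congr (_ - _).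
  apply: eq_bigr => j _; rewrite -(actDr actP); congr (act _ _).
  by case: (fchi j) => -[-> _].
have prZ x b : pr (act x b) = act (pr x) b.
  rewrite /pr (actDl actP) (actNl actP) (act_suml actP); congr (_ - _).
  apply: eq_bigr => j _; rewrite (actA actP); congr (act _ _).
  by case: (fchi j) => -[_ ->].
have chi_pr j x : chi j (pr x) = 0.
  have [fj ej] := fchi j.
  rewrite functionalB // functional_sum // (bigD1 j) //= big1.
    by case: fj => _ ->; rewrite chixi eqxx ej addr0 subrr.
  move=> k /negPf kj; case: fj => _ ->.
  by rewrite chixi eq_sym kj mul0r.
have pr_xi k : pr (xi k) = 0.
  rewrite /pr (bigD1 k) //= big1 => [|j /negPf jk].
    by rewrite chixi eqxx xie addr0 subrr.
  by rewrite chixi jk (act0r actP).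
have [x0|xn] := pselect (pr g = 0).
  exists r, xi, chi; split=> // [Y subY Yg j|g'].
    by apply: xiY => // g' g'gs; apply: Yg; rewrite inE g'gs orbT.
  rewrite inE => /orP[/eqP->|]; last exact: gsE.
  by apply/eqP; rewrite -subr_eq0; apply/eqP.
have xe : act (pr g) e = pr g by rewrite -prZ gse // mem_head.
have [psi fpsi psin] := sep xn.
have [c cn] := corner_neq0 psin.
have [|d [de _ dd]] := di_inv eP _ cn.
  by rewrite !mulrA ee -mulrA; case: fpsi => _ <-; rewrite xe.
(* Composing with [pr] makes [chi0] vanish on the earlier [xi]; the factor [d] makes its value at
   [pr g] equal to [e]. *)
pose chi0 x := d * (e * c * psi (pr x)).
have fchi0 : functional chi0.
  case: (fpsi) => pD pZ; split=> [x y|x b]; rewrite /chi0.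
    by rewrite prD pD !mulrDr.
  by rewrite prZ pZ !mulrA.
have prpr : pr (pr g) = pr g.
  rewrite {1}/pr big1 ?subr0 // => j _.
  by rewrite chi_pr (act0r actP).
have chi0g : chi0 g = e by [].
exists (1 + r)%N, (fun i : 'I_(1 + r) => if fintype.split i is inr j then xi j else pr g),
  (fun i : 'I_(1 + r) => if fintype.split i is inr j then chi j else chi0); split=> [i|i|i k|Y subY Yg i|g'].
- case: (fintype.split i) => [_|j] //; split=> // x.
  by rewrite /chi0 mulrA; congr (_ * _); rewrite -{1}de !mulrA ee de.
- by case: (fintype.split i).
- case: (split_ordP i) => i' ->; case: (split_ordP k) => k' ->;
    rewrite /=.
  + by rewrite !ord1 eqxx /chi0 prpr dd.
  + by rewrite eq_lrshift /chi0 pr_xi functional0 // !mulr0.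
  + by rewrite eq_rlshift chi_pr.
  + by rewrite chixi (inj_eq (@rshift_inj _ _)).
- have xiYj j : Y (xi j).
    by apply: xiY => // g' g'gs; apply: Yg; rewrite inE g'gs orbT.
  case: (fintype.split i) => [_|j] //; apply: (submodB subY); first exact/Yg/mem_head.
  by apply: (submod_sum subY) => j _; apply: (submodZ subY).
- have sumE x : \sum_(i < 1 + r) act (if fintype.split i is inr j then xi j else pr g)
      ((if fintype.split i is inr j then chi j else chi0) x) =
      act (pr g) (chi0 x) + \sum_j act (xi j) (chi j x).
    rewrite big_split_ord /= big_ord1 (unsplitK (inl ord0)); congr (_ + _).
    by apply: eq_bigr => j _; rewrite (unsplitK (inr j)).
  rewrite sumE inE => /orP[/eqP->|g'gs].
    by rewrite chi0g xe /pr subrK.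
  have -> : chi0 g' = 0.
    have pr0 : pr g' = 0 by rewrite /pr -gsE // subrr.
    by rewrite /chi0 pr0 functional0 // !mulr0.
  by rewrite (act0r actP) add0r -gsE.
Qed.

End SystemModule.
End Systems.

Section SpaceSystems.
Variables (B : pzRingType) (e : B).
Hypotheses (simpB : simple_ring B) (eP : division_idempotent e).
Let ee := di_idem eP.

(* Matrix units v_j w_k, with entries in the division ring eBe. *)
Definition matrix_units n (v w : 'I_n -> B) : Prop :=
  [/\ forall j, v j * e = v j, forall j, e * w j = w j,
      forall j k, w j * v k = if j == k then e else 0 &
      1 = \sum_j v j * w j].

(** The ideal BeB contains 1, so finitely many elements b e generate B as a right module; a dual
    system for them gives the matrix units. *)
Lemma exists_matrix_units : exists n (v w : 'I_n -> B), matrix_units v w.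
Proof.
pose K : set B := [set z | exists s : seq (B * B), z = \sum_(p <- s) p.1 * e * p.2].
have [s sE] : K 1.
  apply: (simpB (x := e)); last exact: di_neq0 eP.
    split; first split; first split.
    - by exists [::]; rewrite big_nil.
    - move=> _ _ [s ->] [s' ->]; exists (s ++ [seq (- p.1, p.2) | p <- s']).
      rewrite big_cat big_map /= -sumrN; congr (_ + _); apply: eq_bigr => p _.
      by rewrite !mulNr.
    - move=> _ b [s ->]; exists [seq (p.1, p.2 * b) | p <- s].
      by rewrite big_map mulr_suml; apply: eq_bigr => p _; rewrite mulrA.
    - move=> _ b [s ->]; exists [seq (b * p.1, p.2) | p <- s].
      by rewrite big_map mulr_sumr; apply: eq_bigr => p _; rewrite !mulrA.
  by exists [:: (1, 1)]; rewrite big_seq1 mulr1 mul1r.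
pose gs := [seq p.1 * e | p <- s].
have [||n [v [chi S]]] := @exists_dual_system B e simpB eP B _ (mul_action B) _ gs.
- by move=> x xn; exists id.
- by move=> _ /mapP[p _ ->]; rewrite -mulrA ee.
have [fchi ve chiv _ _] := S.
have chiE j b : chi j b = chi j 1 * b.
  by case: (fchi j) => -[_ h] _; rewrite -{1}[b]mul1r h.
exists n, v, (fun j => chi j 1); split=> // [j|j k|].
- by case: (fchi j).
- by rewrite -chiE.
apply: (dual_system_span (mul_action B) (Y := setT) S) => // y; split=> // _ Z subZ hZ.
rewrite -[y]mul1r sE; apply: (submodZ subZ); rewrite big_seq.
apply: (submod_sum subZ) => p ps; apply: (submodZ subZ); apply: hZ.
by apply/mapP; exists p.
Qed.

Variables (Q : lmodType B^c) (X : hspace Q).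
Local Notation h := (hs_h X).
Local Notation sigma := (hs_inv X).
Local Notation u := (hs_u X).
Local Notation U := (hs_unitary X).

Definition image_basis (a : endo Q) r (xi : 'I_r -> Q) (chi : 'I_r -> Q -> B) :=
  [/\ forall j, functional (@rscale B Q) (chi j) /\
                forall x, e * chi j x = chi j x,
      forall j, xi j *> e = xi j,
      forall j k, chi j (xi k) = if j == k then e else 0,
      forall j, exists z, xi j = a z &
      forall z, a z = \sum_j xi j *> chi j (a z)].

(** The vectors [hs_x k *> v j] generate [Q] and are fixed by [e], so a dual system can be extracted
    from their images under [a]; the functionals h(y_k, -) separate points. *)
Lemma exists_image_basis (a : endo Q) :
  exists r (xi : 'I_r -> Q) chi, image_basis a xi chi.
Proof.
have [n [v [w [ve we wv vw]]]] := exists_matrix_units.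
pose gs := [seq a (hs_x kj.1 *> v kj.2) | kj : 'I_(hs_dim X) * 'I_n].
have [||r [xi [chi S]]] :=
  @exists_dual_system B e simpB eP Q _ (rscale_action Q) _ gs.
- move=> x xn; apply: contrapT => /forall2NP sep; apply: xn.
  rewrite [x](hbasis X) big1 // => k _.
  have [|/contrapT ->] := sep (h (hs_y k)); last by rewrite rscale0.
  by case; split=> [y z|y b]; rewrite ?hDr ?hZr.
- by move=> _ /mapP[kj _ ->]; rewrite -linear_rscale rscaleA ve.
have [fchi xie chixi xiY _] := S.
exists r, xi, chi; split=> // [j|z].
  apply: (xiY [set y | exists z, y = a z]) => [|_ /mapP[kj _ ->]]; last first.
    by exists (hs_x kj.1 *> v kj.2).
  split=> [|_ _ [z ->] [z' ->]|_ b [z ->]].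
  - by exists 0; rewrite linear0.
  - by exists (z - z'); rewrite linearB.
  - by exists (z *> b); rewrite linear_rscale.
apply: (dual_system_span (rscale_action Q) (Y := [set y | exists z, y = a z]) S).
  move=> y; split=> [[{}z ->] Z subZ hZ|]; last apply.
  - rewrite [z](hbasis X) linear_sum; apply: (submod_sum subZ) => k _.
    rewrite -[h _ z]mul1r vw mulr_suml rscale_sumr linear_sum.
    apply: (submod_sum subZ) => j _.
    rewrite -mulrA -rscaleA linear_rscale; apply: (submodZ subZ); apply: hZ.
    by apply/mapP; exists (k, j); rewrite ?mem_enum.
  - split=> [|_ _ [z' ->] [z'' ->]|_ b [z' ->]].
    + by exists 0; rewrite linear0.
    + by exists (z' - z''); rewrite linearB.
    + by exists (z' *> b); rewrite linear_rscale.
  - by move=> _ /mapP[kj _ ->]; exists (hs_x kj.1 *> v kj.2).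
by exists z.
Qed.

(* c' inverts c as a map between the simple modules eB and sigma(e)B. *)
Lemma corner_inverse (c : B) : sigma e * c * e = c -> c <> 0 ->
  exists c', [/\ e * c' * sigma e = c', c * c' = sigma e & c' * c = e].
Proof.
move=> cE cn; have ce : c * e = c by rewrite -{1}cE -mulrA ee cE.
have see : sigma e * sigma e = sigma e by rewrite -(involM U) ee.
have sc : sigma e * c = c by rewrite -{1}cE !mulrA see cE.
have [b bn] := corner_neq0 simpB eP cn.
have [|d [dE _ db]] := di_inv eP _ bn; first by rewrite !mulrA ee -mulrA ce.
have ed : e * d = d by rewrite -{1}dE !mulrA ee dE.
have [t [tc et ts]] : exists t, [/\ t * c = e, e * t = t & t * sigma e = t].
  exists (d * e * b * sigma e).
  by split; rewrite -?mulrA ?see ?sc // ?[e * (d * _)]mulrA ?ed // -[RHS]db !mulrA.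
exists t; split=> //; first by rewrite et ts.
pose g := sigma (c * t).
have gE : e * g * e = g.
  rewrite /g -[e in LHS](involK U) -!(involM U) !mulrA sc -mulrA ts.
  by [].
have gg : g * g = g.
  by rewrite /g -(involM U) mulrA -(mulrA c t c) tc ce.
have gn : g <> 0.
  move=> g0; apply: cn; rewrite -ce -tc mulrA.
  by rewrite -[c * t](involK U) -/g g0 (invol0 U) mul0r.
have [g' [_ gg' _]] := di_inv eP gE gn.
have ge : g * e = g by rewrite -{1}gE -mulrA ee gE.
have gE' : g = e by rewrite -[LHS]ge -[X in g * X = _]gg' mulrA gg gg'.
by rewrite -[LHS](involK U) -/g gE'.
Qed.

Section FormOfMatrix.
Variables (a s : endo Q) (r : nat) (xi : 'I_r -> Q) (chi : 'I_r -> Q -> B).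
Hypotheses (asa : a * s * a = a) (bas : image_basis a xi chi).
Variables (C C' : 'I_r -> 'I_r -> B).
Hypotheses (C_diag : forall k, hs_param X (C k k))
  (C_skew : forall k l, C l k = - (sigma (C k l) * u))
  (C'_left : forall k l, e * C' k l = C' k l)
  (CC' : forall j l, \sum_k C j k * C' k l = if j == l then sigma e else 0).

Let b x y := \sum_j \sum_k sigma (chi j x) * C j k * chi k y.

Let b_dual : dual_hom sigma b.
Proof.
have [fchi _ _ _ _] := bas.
have cD j x y : chi j (x + y) = chi j x + chi j y by case: (fchi j) => -[-> _].
have cZ j x c : chi j (x *> c) = chi j x * c by case: (fchi j) => -[_ ->].
split=> [x|x y|x c].
- split=> [y z|y c]; rewrite /b.
    rewrite -big_split; apply: eq_bigr => j _; rewrite -big_split.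
    by apply: eq_bigr => k _; rewrite cD mulrDr.
  rewrite mulr_suml; apply: eq_bigr => j _; rewrite mulr_suml.
  by apply: eq_bigr => k _; rewrite cZ mulrA.
- apply/funext => z; rewrite /= /b -big_split; apply: eq_bigr => j _.
  rewrite -big_split; apply: eq_bigr => k _.
  by rewrite cD (involD U) !mulrDl.
- apply/funext => z; rewrite /dual_scale /b mulr_sumr; apply: eq_bigr => j _.
  rewrite mulr_sumr; apply: eq_bigr => k _.
  by rewrite cZ (involM U) !mulrA.
Qed.

(** [lam] is the form with Gram matrix [C] in the coordinates [chi] on the image of [a], and [mu]
    solves for it there by means of the inverse matrix [C']. *)
Lemma param_form_of_matrix : exists lam mu : endo Q,
  hs_lam X lam /\ forall p, p = a * s ->
    hs_star X p * lam * p * mu = hs_star X p.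
Proof.
have [fchi xie chixi xia aE] := bas.
have muD x y : \sum_k xi k *> (\sum_l C' k l * h (xi l) (x + y)) =
  \sum_k xi k *> (\sum_l C' k l * h (xi l) x) +
  \sum_k xi k *> (\sum_l C' k l * h (xi l) y).
  rewrite -big_split /=; apply: eq_bigr => k _; rewrite -rscaleDr -big_split /=.
  by congr (_ *> _); apply: eq_bigr => l _; rewrite hDr mulrDr.
have muZ x c : \sum_k xi k *> (\sum_l C' k l * h (xi l) (x *> c)) =
  (\sum_k xi k *> (\sum_l C' k l * h (xi l) x)) *> c.
  rewrite rscale_suml; apply: eq_bigr => k _; rewrite rscaleA mulr_suml.
  by congr (_ *> _); apply: eq_bigr => l _; rewrite hZr mulrA.
exists (hs_op b_dual), (make_endo muD muZ); split.
  apply/(hs_lamP (b := b)) => [x y|]; first by rewrite hs_opE.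
  split=> // [x|x].
    apply/funext => y; rewrite /form_transpose /omega /= /b (invol_sum U) mulr_suml.
    rewrite -sumrN exchange_big; apply: eq_bigr => j _.
    rewrite (invol_sum U) mulr_suml -sumrN; apply: eq_bigr => k _.
    rewrite C_skew !(involM U) (involK U) mulrN mulNr; congr (- _).
    by rewrite !mulrA -!mulrA (u_central U).
  by rewrite /b; apply: (param_quad U) => // k l _; apply: C_skew.
move=> p pE; have pp : p * p = p by rewrite pE mulrA asa.
apply/endoP => y; apply: (h_injr (X := X)) => z.
rewrite !endoM !hs_starEr hs_opE.
have pxi k : p (xi k) = xi k.
  have [t ->] := xia k; rewrite pE.
  by rewrite -[LHS](endoM (a * s) a) asa.
have pzE : p z = \sum_j xi j *> chi j (p z) by rewrite pE endoM -aE.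
have chimu k : chi k (p (make_endo muD muZ y)) = \sum_l C' k l * h (xi l) y.
  rewrite make_endoE linear_sum.
  under eq_bigr do rewrite linear_rscale pxi.
  have [fk _] := fchi k; rewrite (functional_sum _ _ _ fk) (bigD1 k) //=.
  case: fk => _ cZ; rewrite [X in _ + X]big1 => [|l /negPf lk].
    rewrite cZ chixi eqxx addr0 mulr_sumr; apply: eq_bigr => l _.
    by rewrite mulrA C'_left.
  by rewrite cZ chixi eq_sym lk mul0r.
rewrite /b {2}pzE h_suml; apply: eq_bigr => j _; rewrite hZl.
under eq_bigr do rewrite chimu -mulrA mulr_sumr.
rewrite -mulr_sumr exchange_big /=.
have [_ ej] := fchi j; rewrite -{2}ej (involM U) -mulrA; congr (_ * _).
transitivity (\sum_l (if j == l then sigma e else 0) * h (xi l) y).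
  apply: eq_bigr => l _; rewrite -CC' mulr_suml; apply: eq_bigr => k _.
  by rewrite mulrA.
rewrite (bigD1 j) //= eqxx big1 ?addr0 // => l /negPf lj.
by rewrite eq_sym lj mul0r.
Qed.

End FormOfMatrix.

End SpaceSystems.

(** * Commutative corners and split-orthogonal factors *)

Section CornerField.
Variables (B : pzRingType) (e : B).
Hypothesis eP : division_idempotent e.
Hypothesis comm : forall c d, e * c * e = c -> e * d * e = d -> c * d = d * c.
Let ee := di_idem eP.

Let inC (b : B) : bool := e * b * e == b.
Let corner : Type := {b : B | inC b}.
HB.instance Definition _ := Choice.on corner.

Let val (x : corner) : B := sval x.
Let val_inj : injective val.
Proof.
by move=> [x hx] [y hy] /= xy; subst y; rewrite (bool_irrelevance hx hy).
Qed.
Let cE (x : corner) : e * val x * e = val x. Proof. exact/eqP/(svalP x). Qed.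
Let mk (b : B) (h : e * b * e = b) : corner := exist _ b (introT eqP h).
Let mkK b h : val (@mk b h) = b. Proof. by []. Qed.

Let el (x : corner) : e * val x = val x.
Proof. by rewrite -cE !mulrA ee. Qed.
Let er (x : corner) : val x * e = val x.
Proof. by rewrite -cE -!mulrA ee. Qed.

Let zero_in : e * 0 * e = 0. Proof. by rewrite mulr0 mul0r. Qed.
Let opp_in (x : corner) : e * (- val x) * e = - val x.
Proof. by rewrite mulrN mulNr cE. Qed.
Let add_in (x y : corner) : e * (val x + val y) * e = val x + val y.
Proof. by rewrite mulrDr mulrDl !cE. Qed.
Let mul_in (x y : corner) : e * (val x * val y) * e = val x * val y.
Proof. by rewrite mulrA el -mulrA er. Qed.
Let one_in : e * e * e = e. Proof. by rewrite !ee. Qed.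

Let caddA : associative (fun x y => mk (add_in x y)).
Proof. by move=> x y z; apply: val_inj; rewrite !mkK addrA. Qed.
Let caddC : commutative (fun x y => mk (add_in x y)).
Proof. by move=> x y; apply: val_inj; rewrite !mkK addrC. Qed.
Let cadd0 : left_id (mk zero_in) (fun x y => mk (add_in x y)).
Proof. by move=> x; apply: val_inj; rewrite !mkK add0r. Qed.
Let caddN : left_inverse (mk zero_in) (fun x => mk (opp_in x))
  (fun x y => mk (add_in x y)).
Proof. by move=> x; apply: val_inj; rewrite !mkK addNr. Qed.
HB.instance Definition _ := GRing.isZmodule.Build corner caddA caddC cadd0 caddN.

Let cmulA : associative (fun x y => mk (mul_in x y)).
Proof. by move=> x y z; apply: val_inj; rewrite !mkK mulrA. Qed.
Let cmulC : commutative (fun x y => mk (mul_in x y)).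
Proof. by move=> x y; apply: val_inj; rewrite !mkK comm ?cE. Qed.
Let cmul1 : left_id (mk one_in) (fun x y => mk (mul_in x y)).
Proof. by move=> x; apply: val_inj; rewrite !mkK el. Qed.
Let cmulD : left_distributive (fun x y => mk (mul_in x y)) +%R.
Proof. by move=> x y z; apply: val_inj; rewrite !mkK mulrDl. Qed.
Let cone_neq0 : mk one_in != 0.
Proof. by apply/eqP => /(congr1 val); rewrite !mkK; apply: di_neq0 eP. Qed.
HB.instance Definition _ := GRing.Zmodule_isComNzRing.Build corner
  cmulA cmulC cmul1 cmulD cone_neq0.

Let cinv (x : corner) : corner := xget 0 [set y | y * x = 1].
Let cmulV (x : corner) : x != 0 -> cinv x * x = 1.
Proof.
move=> xn; apply: (@xgetPex _ 0 [set y | y * x = 1]).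
have [|d [dE _ dx]] := di_inv eP (cE x).
  by move=> x0; case/eqP: xn; apply: val_inj.
by exists (mk dE); apply: val_inj; rewrite !mkK.
Qed.
Let cinv0 : cinv 0 = 0.
Proof.
rewrite /cinv xgetPN // => y /(congr1 val); rewrite [val (_ * _)]mulr0 => h.
by apply: (di_neq0 eP); rewrite h.
Qed.
HB.instance Definition _ := GRing.ComNzRing_isField.Build corner cmulV cinv0.

Lemma corner_field : exists (L : fieldType) (iota : L -> B), [/\
  injective iota, {morph iota : x y / x + y}, {morph iota : x y / x * y},
  iota 1 = e & forall d, e * d * e = d <-> exists x, iota x = d].
Proof.
exists corner, val; split=> //.
by move=> d; split=> [h|[x <-]]; [exists (mk h)|].
Qed.

End CornerField.

Section SplitOrthogonal.
Variables (B : pzRingType) (Q : lmodType B^c) (X : hspace Q).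
Local Notation sigma := (hs_inv X).
Local Notation u := (hs_u X).
Local Notation Lam := (hs_param X).
Local Notation U := (hs_unitary X).
Hypothesis simpB : simple_ring B.
Variable e : B.
Hypothesis eP : division_idempotent e.
Hypothesis Lam0 : forall c, Lam c -> sigma e * c * e = c -> c = 0.
Let ee := di_idem eP.
Let see : sigma e * sigma e = sigma e.
Proof. by rewrite -(involM U) ee. Qed.

(** [k - sigma k * u] is a minimal element lying in the corner, where Lambda vanishes by [Lam0]. *)
Lemma corner_symmetric k : sigma e * k * e = k -> sigma k * u = k.
Proof.
move=> kE; apply/esym/eqP; rewrite -subr_eq0; apply/eqP.
apply: Lam0; first exact: (param_min U).
rewrite mulrBr mulrBl kE; congr (_ - _).
rewrite -[in RHS]kE !(involM U) (involK U) !mulrA.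
by rewrite -[LHS]mulrA (u_central U) mulrA.
Qed.

(** Since B is simple, sigma(e)Be is nonzero, and by [corner_inverse] each of its nonzero elements
    is invertible between the two corners. *)
Lemma exists_corner_pairing : exists k k', [/\ sigma e * k * e = k,
  e * k' * sigma e = k', k * k' = sigma e & k' * k = e].
Proof.
have seP : division_idempotent (sigma e).
  split=> // [s0|d dE dn]; first by apply: (di_neq0 eP); rewrite -[e](involK U) s0 (invol0 U).
  have [||d' [d'E dd' d'd]] := di_inv eP (d := sigma d).
  - by rewrite -{2}dE !(involM U) (involK U) mulrA.
  - by move=> d0; apply: dn; rewrite -[d](involK U) d0 (invol0 U).
  exists (sigma d'); split.
  - by rewrite -{2}d'E !(involM U) mulrA.
  - by rewrite -[d](involK U) -(involM U) d'd.
  - by rewrite -{1}[d](involK U) -(involM U) dd'.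
have [c cn] := corner_neq0 simpB seP (di_neq0 eP).
have cE : sigma e * (sigma e * c * e) * e = sigma e * c * e.
  by rewrite !mulrA see -mulrA ee.
have [k' [k'E kk' k'k]] := corner_inverse simpB eP cE cn.
by exists (sigma e * c * e), k'.
Qed.

Lemma sym_pass k d : sigma e * k * e = k -> e * d * e = d -> sigma d * k = k * d.
Proof.
move=> kE dE; have sk : sigma e * k = k by rewrite -{1}kE !mulrA see kE.
have de : d * e = d by rewrite -{1}dE -mulrA ee dE.
have : sigma (k * d) * u = k * d.
  by apply: corner_symmetric; rewrite mulrA sk -mulrA de.
by rewrite (involM U) -mulrA corner_symmetric.
Qed.

(** Moving [d] across both [k * c] and [k] with [sym_pass] gives k c d = sigma(d) k c = k d c, and
    [k] cancels. *)
Lemma corner_comm c d : e * c * e = c -> e * d * e = d -> c * d = d * c.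
Proof.
move=> cE dE; have [k [k' [kE k'E _ k'k]]] := exists_corner_pairing.
have ce : c * e = c by rewrite -{1}cE -mulrA ee cE.
have ec : e * c = c by rewrite -{1}cE !mulrA ee cE.
have de : d * e = d by rewrite -{1}dE -mulrA ee dE.
have ed : e * d = d by rewrite -{1}dE !mulrA ee dE.
have sk : sigma e * k = k by rewrite -{1}kE !mulrA see kE.
have kcE : sigma e * (k * c) * e = k * c by rewrite mulrA sk -mulrA ce.
have kcd : k * c * d = k * d * c.
  by rewrite -(sym_pass kcE dE) mulrA sym_pass.
have := congr1 (fun x => k' * x) kcd; rewrite -!mulrA !(mulrA k' k) k'k !mulrA ec ed.
by [].
Qed.

Lemma central_cancel (z : B) : central z -> z <> 0 -> exists z', z * z' = 1.
Proof.
move=> cz zn; suff [z' z1] : [set y | exists b, y = z * b] 1 by exists z'.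
apply: (simpB (x := z)) => //; last by exists 1; rewrite mulr1.
split; first split; first split.
- by exists 0; rewrite mulr0.
- by move=> _ _ [b ->] [c ->]; exists (b - c); rewrite mulrBr.
- by move=> _ c [b ->]; exists (b * c); rewrite mulrA.
- by move=> _ c [b ->]; exists (c * b); rewrite !mulrA cz.
Qed.

(** The central element [sigma z - z] kills the invertible [k], by [sym_pass] applied to [z * e]; in
    a simple ring it must be zero. *)
Lemma involution_central (z : B) : central z -> sigma z = z.
Proof.
move=> cz; have [k [k' [kE _ kk' _]]] := exists_corner_pairing.
have sz : central (sigma z).
  by move=> b; rewrite -[b](involK U) -!(involM U) cz.
have sk : sigma e * k = k by rewrite -{1}kE !mulrA see kE.
have ke : k * e = k by rewrite -{1}kE -mulrA ee kE.
have zk : (sigma z - z) * k = 0.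
  have := sym_pass kE (d := z * e); rewrite mulrA -cz -!mulrA !ee => /(_ erefl).
  rewrite (involM U) -sz -mulrA sk mulrBl => ->.
  by rewrite mulrA -(cz k) -mulrA ke subrr.
apply: contrapT => /eqP; rewrite -subr_eq0 => /eqP zn.
have [||z' zz'] := @central_cancel (sigma z - z) => //.
  by move=> b; rewrite mulrBl mulrBr sz cz.
apply: (di_neq0 eP); rewrite -[e](involK U) -kk' -[k]mul1r -zz'.
have -> : (sigma z - z) * z' * k = z' * ((sigma z - z) * k).
  by rewrite mulrA; congr (_ * _); rewrite mulrBl mulrBr sz cz.
by rewrite zk mulr0 mul0r (invol0 U).
Qed.

(** [u] is central, hence fixed by [sigma], so u u = 1; nonzero central elements are invertible, and
    (u - 1)(u + 1) = 0 leaves two cases. *)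
Lemma unit_sign : (1 : B) <> 0 -> u = 1 \/ u = - 1.
Proof.
move=> one0; have cu : central u by move=> b; rewrite (u_central U).
have uu : u * u = 1 by rewrite -{1}(involution_central cu) (mulVu U).
have [u1|un] := pselect (u - 1 = 0); [left|right].
  by apply/eqP; rewrite -subr_eq0; apply/eqP.
have [|z zz] := central_cancel _ un.
  by move=> b; rewrite mulrBl mulrBr cu mulr1 mul1r.
have h : (u - 1) * (u + 1) = 0 by rewrite mulrDr mulr1 mulrBl uu mul1r; zmod.
have zz' : z * (u - 1) = 1 by rewrite -[RHS]zz mulrBl mulrBr cu mulr1 mul1r.
by apply/eqP; rewrite -subr_eq0 opprK -[u + 1]mul1r -{1}zz' -mulrA h mulr0.
Qed.

Variables (n : nat) (v w : 'I_n -> B).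
Hypothesis MU : matrix_units e v w.

(** In matrix units, the diagonal components of an element of Lambda come from Lambda in the corner
    and vanish. Those off the diagonal are skew in pairs, so the element is its strictly upper part
    minus the twisted conjugate of that part. *)
Lemma param_is_min : Lam = Lambda_min sigma u.
Proof.
have [ve we wv vw] := MU.
apply/seteqP; split=> [l Ll|_ [a _ <-]]; last exact: (param_min U).
pose y (j k : 'I_n) := sigma (w j) * (sigma (v j) * l * v k) * w k.
have yjj j : y j j = 0.
  have c0 : sigma (v j) * l * v j = 0.
    apply: Lam0; first by apply: (param_conj U).
    by rewrite !mulrA -(involM U) ve -mulrA ve.
  by rewrite /y c0 mulr0 mul0r.
have ykj j k : y k j = - (sigma (y j k) * u).
  rewrite /y !(involM U) !(involK U) !mulrA.
  have -> : sigma (w k) * sigma (v k) * sigma l * v j * w j * u =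
            sigma (w k) * sigma (v k) * (sigma l * u) * v j * w j.
    rewrite -[LHS](u_central U) -[sigma l * u](u_central U) !mulrA.
    by rewrite -[sigma (w k) * sigma (v k) * u](u_central U) !mulrA.
  by rewrite (param_max U Ll) !(mulrN, mulNr) opprK.
have lE : l = \sum_j \sum_k y j k.
  transitivity (sigma (\sum_j v j * w j) * l * \sum_k v k * w k).
    by rewrite -vw (invol1 U) mul1r mulr1.
  rewrite (invol_sum U) !mulr_suml; apply: eq_bigr => j _.
  rewrite mulr_sumr; apply: eq_bigr => k _.
  by rewrite /y (involM U) !mulrA.
exists (\sum_(j < n) \sum_(k < n | (j < k)%N) y j k) => //.
rewrite lE (invol_sum U) mulr_suml -sumrB.
transitivity (\sum_(j < n) (\sum_(k < n | (j < k)%N) y j k +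
    \sum_(k < n | (k < j)%N) y j k)).
  rewrite !big_split /=; congr (_ + _).
  rewrite [RHS](exchange_big_dep predT) //=; apply: eq_bigr => j _.
  rewrite (invol_sum U) mulr_suml -sumrN.
  by apply: eq_bigr => k _; rewrite -ykj.
apply: eq_bigr => j _; rewrite [RHS](bigID (fun k : 'I_n => (j < k)%N)) /=.
congr (_ + _); rewrite [RHS](bigID (fun k : 'I_n => k == j)) /=.
rewrite [X in _ = X + _]big1 => [|k /andP[_ /eqP->]]; last exact: yjj.
by rewrite add0r; apply: eq_bigl => k; rewrite -val_eqE /=; case: ltngtP.
Qed.

Lemma corner_coordinates : exists (L : fieldType) (io : L -> B) (pin : B -> L),
  [/\ injective io,
    {morph io : x y / x + y} /\ {morph io : x y / x * y},
    io 1 = e, forall d, e * d * e = d -> io (pin d) = d &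
    forall x, e * io x * e = io x].
Proof.
have [L [io [ioI ioD ioM io1 ioP]]] := corner_field eP corner_comm.
(* Outside the corner [pin] takes the default value 0. *)
have /choice [pin pinE] : forall d, exists x, e * d * e = d -> io x = d.
  move=> d; have [/ioP[x xd]|] := pselect (e * d * e = d); first by exists x.
  by exists 0.
by exists L, io, pin; split=> // x; apply/ioP; exists x.
Qed.

(** With eBe as the field L, matrix units identify B with matrices over L, and [k0] turns [sigma]
    into the adjoint involution of a Gram matrix. By [unit_sign] that matrix is symmetric for u = 1
    and antisymmetric for u = -1; in characteristic 2, [param_is_min] supplies the remaining
    condition. *)
Lemma corner_split_orthogonal :
  simple_artinian_unitary sigma u Lam -> split_orthogonal sigma u Lam.
Proof.
move=> SA; split=> //; have [_ _ one0 _] := SA.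
have [ve we wv vw] := MU.
have [L [io [pin [ioI [ioD ioM] io1 pinE ioE]]]] := corner_coordinates.
have io0 : io 0 = 0 by apply: (addrI (io 0)); rewrite -ioD !addr0.
have io_sum (I : Type) (r : seq I) (P : pred I) (F : I -> L) :
    io (\sum_(i <- r | P i) F i) = \sum_(i <- r | P i) io (F i).
  by elim/big_rec2: _ => // i x y _ <-; rewrite ioD.
have ioN x : io (- x) = - io x.
  by apply: (addrI (io x)); rewrite -ioD !subrr io0.
have iol x : e * io x = io x by rewrite -{1}ioE !mulrA ee ioE.
have ior x : io x * e = io x by rewrite -{1}ioE -!mulrA ee mulrA ioE.
pose th (b : B) : 'M[L]_n := \matrix_(j, k) pin (w j * b * v k).
have thE b j k : io (th b j k) = w j * b * v k.
  by rewrite mxE pinE // !mulrA we -mulrA ve.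
have thA : zmod_morphism th.
  move=> b c; apply/matrixP => j k; apply: ioI.
  have -> : (th b - th c) j k = th b j k - th c j k by rewrite !mxE.
  by rewrite ioD ioN !thE mulrBr mulrBl.
have thM : monoid_morphism th.
  split=> [|b c]; apply/matrixP => j k; apply: ioI; rewrite thE.
    rewrite mulr1 wv; have -> : (1 : 'M[L]_n) j k = (j == k)%:R by rewrite mxE.
    by case: eqP => _; rewrite ?mulr1n ?mulr0n ?io0 ?io1.
  rewrite [in RHS]mxE io_sum.
  transitivity (w j * b * (\sum_l v l * w l) * c * v k).
    by rewrite -vw mulr1 !mulrA.
  rewrite mulr_sumr !mulr_suml; apply: eq_bigr => l _.
  by rewrite ioM !thE !mulrA.
pose theta : {rmorphism B -> 'M[L]_n} := HB.pack th
  (GRing.isZmodMorphism.Build _ _ th thA)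
  (GRing.isMonoidMorphism.Build _ _ th thM).
have n_gt0 : (0 < n)%N.
  rewrite lt0n; apply/eqP => n0; apply: one0; rewrite vw.
  have n_empty (j : 'I_n) : False by case: j => m; rewrite n0.
  by rewrite big1 // => j; case: (n_empty j).
have [k0 [k' [kE k'E kk' k'k]]] := exists_corner_pairing.
have ke : k0 * e = k0 by rewrite -{1}kE -mulrA ee kE.
have ek' : e * k' = k' by rewrite -{1}k'E !mulrA ee k'E.
have sk : sigma e * k0 = k0 by rewrite -{1}kE !mulrA see kE.
(* The products [sigma (v j) * v k] lie in sigma(e)Be; multiplication by [k'] brings them into eBe,
   that is, into L. *)
pose G : 'M[L]_n := \matrix_(j, k) pin (k' * sigma (v j) * v k).
have GE j k : io (G j k) = k' * sigma (v j) * v k.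
  by rewrite mxE pinE // !mulrA ek' -mulrA ve.
have kG j k : k0 * io (G j k) = sigma (v j) * v k.
  by rewrite GE !mulrA kk' -(involM U) ve.
have kinj x y : k0 * io x = k0 * io y -> x = y.
  move/(congr1 (fun z => k' * z)); rewrite !mulrA k'k !iol; exact: ioI.
have Gunit : G \in unitmx.
  pose G' : 'M[L]_n := \matrix_(k, l) pin (w k * sigma (w l) * k0).
  have G'E k l : io (G' k l) = w k * sigma (w l) * k0.
    by rewrite mxE pinE // !mulrA we -mulrA ke.
  have /mulmx1_unit[] // : G *m G' = 1%:M.
  apply/matrixP => j l; apply: ioI; rewrite !mxE io_sum.
  transitivity (k' * sigma (v j) * (\sum_k v k * w k) * sigma (w l) * k0).
    rewrite mulr_sumr !mulr_suml; apply: eq_bigr => k _.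
    by rewrite ioM GE G'E !mulrA.
  rewrite -vw mulr1 -[k' * _ * _]mulrA -(involM U) wv eq_sym.
  case: eqP => _; first by rewrite -mulrA sk k'k io1.
  by rewrite (invol0 U) mulr0 mul0r mulr0n io0.
have adj : adjoint_to sigma theta G.
  split=> // a; have GthE : G *m th (sigma a) = (th a)^T *m G.
    apply/matrixP => j l; apply: kinj; rewrite !mxE !io_sum.
    transitivity (sigma (v j) * sigma a * v l).
      rewrite mulr_sumr.
      transitivity (sigma (v j) * (\sum_k v k * w k) * sigma a * v l).
        rewrite mulr_sumr !mulr_suml; apply: eq_bigr => k _.
        by rewrite ioM thE !mulrA kG.
      by rewrite -vw mulr1.
    have avE : a * v j = \sum_k v k * io (th a k j).
      rewrite -{1}[a]mul1r {1}vw !mulr_suml; apply: eq_bigr => k _.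
      by rewrite thE !mulrA.
    rewrite -(involM U) avE (invol_sum U) mulr_suml mulr_sumr.
    apply: eq_bigr => k _; rewrite (involM U) -mulrA -kG ioM [(th a)^T j k]mxE.
    by rewrite mulrA (sym_pass kE (ioE _)) mulrA.
  by rewrite -mulmxA -GthE mulKmx.
(* The symmetry type of [G] is governed by [sigma u], which [unit_sign] later makes 1 or -1. *)
have Gsym j k : k0 * io (G k j) = k0 * io (G j k) * sigma u.
  rewrite kG -[v j](involK U) -(involM U) -kG (involM U).
  have -> : sigma k0 = k0 * sigma u.
    by rewrite -[in RHS](corner_symmetric kE) -mulrA (muluV U) mulr1.
  by rewrite mulrA (sym_pass kE (ioE _)).
exists L, n, theta; split=> //.
- exists (fun M : 'M[L]_n => \sum_j \sum_k v j * io (M j k) * w k) => [b|M].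
    transitivity ((\sum_j v j * w j) * b * \sum_k v k * w k).
      rewrite !mulr_suml; apply: eq_bigr => j _; rewrite mulr_sumr.
      by apply: eq_bigr => k _; rewrite thE !mulrA.
    by rewrite -vw mul1r mulr1.
  apply/matrixP => j k; apply: ioI; rewrite thE mulr_sumr mulr_suml.
  rewrite (bigD1 j) //= [X in _ + X]big1 ?addr0 => [|l /negPf lj]; last first.
    rewrite mulr_sumr mulr_suml big1 // => i _.
    by rewrite !mulrA wv eq_sym lj !mul0r.
  rewrite mulr_sumr mulr_suml (bigD1 k) //= [X in _ + X]big1 => [|l /negPf lk].
    by rewrite !mulrA wv eqxx -!mulrA wv eqxx ior iol addr0.
  by rewrite -!mulrA wv lk !mulr0.
- exact: involution_central.
have [ch2|ch2] := boolP (2%N \in [pchar L]).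
  by apply: Or33; split=> //; apply: param_is_min.
have [u1|u1] := unit_sign one0; [apply: Or31|apply: Or32]; split=> //; exists G => //.
  apply/matrixP => j k; apply: kinj; rewrite [G^T j k]mxE Gsym u1 (invol1 U).
  by rewrite mulr1.
apply/matrixP => j k; apply: kinj; rewrite [G^T j k]mxE [(- G) j k]mxE Gsym u1.
by rewrite (involN U) (invol1 U) mulrN1 ioN mulrN.
Qed.

End SplitOrthogonal.

(** * The Dickson map as the parity of a rank *)

Section CenterDimension.
Variables (B : pzRingType) (Q : lmodType B^c) (X : hspace Q).
Local Notation sigma := (hs_inv X).
Local Notation u := (hs_u X).
Local Notation Lam := (hs_param X).
Hypothesis simpB : simple_ring B.
Variable e : B.
Hypothesis eP : division_idempotent e.
Hypothesis Lam0 : forall c, Lam c -> sigma e * c * e = c -> c = 0.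
Variables (n : nat) (v w : 'I_n -> B).
Hypothesis MU : matrix_units e v w.
Let ee := di_idem eP.

(** In the coordinates [q] on the source and [xi] on the image of [a], the right ideal a E consists
    of all r by m matrices over L, and L is the center of B through c -> c e. *)
Lemma center_dim_image (a : endo Q) r (xi : 'I_r -> Q) chi m (q : 'I_m -> Q) ka :
  image_basis e a xi chi -> image_basis e (1 : endo Q) q ka ->
  center_dim [set h : {linear Q -> Q} | exists g : {linear Q -> Q},
                forall x, h x = a (g x)] = (r * m)%N.
Proof.
move=> [fchi xie chixi xia aE] [fka qe kaq _ idE].
have {}idE z : z = \sum_l q l *> ka l z by exact: (idE z).
have [ve we wv vw] := MU.
have [L [io [pin [ioI [ioD ioM] io1 pinE ioE]]]] :=
  corner_coordinates simpB eP Lam0.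
have io0 : io 0 = 0 by apply: (addrI (io 0)); rewrite -ioD !addr0.
have io_sum (I : Type) (s : seq I) (P : pred I) (F : I -> L) :
    io (\sum_(i <- s | P i) F i) = \sum_(i <- s | P i) io (F i).
  by elim/big_rec2: _ => // i x y _ <-; rewrite ioD.
have iol x : e * io x = io x by rewrite -{1}ioE !mulrA ee ioE.
have ior x : io x * e = io x by rewrite -{1}ioE -!mulrA ee mulrA ioE.
have cD j x y : chi j (x + y) = chi j x + chi j y by case: (fchi j) => -[-> _].
have cZ j x b : chi j (x *> b) = chi j x * b by case: (fchi j) => -[_ ->].
have ec j x : e * chi j x = chi j x by case: (fchi j).
have kD j x y : ka j (x + y) = ka j x + ka j y by case: (fka j) => -[-> _].
have kZ j x b : ka j (x *> b) = ka j x * b by case: (fka j) => -[_ ->].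
have c_sum j (I : Type) (s : seq I) (P : pred I) (F : I -> Q) :
    chi j (\sum_(i <- s | P i) F i) = \sum_(i <- s | P i) chi j (F i).
  by case: (fchi j) => /functional_sum ->.
pose W : set {linear Q -> Q} := [set h | exists g : {linear Q -> Q},
                forall x, h x = a (g x)].
pose mat (h : {linear Q -> Q}) : 'M[L]_(r, m) :=
  \matrix_(j, l) pin (chi j (h (q l))).
have matE h j l : io (mat h j l) = chi j (h (q l)).
  by rewrite mxE pinE // ec -cZ -linear_rscale qe.
(* The scalar matrix with entry [x]; this is the inverse of the map c -> c e from the center to
   L. *)
pose z (x : L) : B := \sum_k v k * io x * w k.
have ze x : z x * e = io x.
  rewrite /z mulr_suml -[RHS]mul1r vw mulr_suml; apply: eq_bigr => k _.
  have C : io x * (w k * e) = w k * e * io x.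
    apply: (corner_comm simpB eP Lam0); first exact: ioE.
    by rewrite !mulrA we -mulrA ee.
  by rewrite -!mulrA C -[w k * e * io x]mulrA iol.
have zc x : central (z x).
  move=> b; transitivity (\sum_k \sum_l v k * io x * (w k * b * v l) * w l).
    rewrite /z mulr_suml; apply: eq_bigr => k _.
    rewrite -[b in LHS]mulr1 vw !mulr_sumr; apply: eq_bigr => l _.
    by rewrite !mulrA.
  rewrite exchange_big /z mulr_sumr /=; apply: eq_bigr => l _.
  transitivity (\sum_k v k * w k * b * v l * io x * w l).
    apply: eq_bigr => k _; congr (_ * w l).
    have C : io x * (w k * b * v l) = w k * b * v l * io x.
      apply: (corner_comm simpB eP Lam0); first exact: ioE.
      by rewrite !mulrA we -mulrA ve.
    by rewrite -[v k * io x * _]mulrA C !mulrA.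
  by rewrite -!mulr_suml -vw mul1r !mulrA.
have z0 : z 0 = 0 by rewrite /z big1 // => k _; rewrite io0 mulr0 mul0r.
have cE (c : B) : central c -> io (pin (c * e)) = c * e.
  by move=> cc; rewrite pinE // mulrA -cc -!mulrA !ee.
have zpin (c : B) : central c -> z (pin (c * e)) = c.
  move=> cc; rewrite /z cE // -[RHS]mulr1 vw mulr_sumr; apply: eq_bigr => k _.
  by rewrite mulrA -cc -!mulrA we mulrA.
pose Hf (M : 'M[L]_(r, m)) (y : 'I_r -> Q) x :=
  \sum_j \sum_l y j *> (io (M j l) * ka l x).
have HfD M y x x' : Hf M y (x + x') = Hf M y x + Hf M y x'.
  rewrite -big_split; apply: eq_bigr => j _; rewrite -big_split.
  by apply: eq_bigr => l _; rewrite kD mulrDr rscaleDr.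
have HfZ M y x b : Hf M y (x *> b) = Hf M y x *> b.
  rewrite rscale_suml; apply: eq_bigr => j _; rewrite rscale_suml.
  by apply: eq_bigr => l _; rewrite kZ mulrA rscaleA.
pose H M : endo Q := make_endo (HfD M xi) (HfZ M xi).
have HE M x : H M x = \sum_j \sum_l xi j *> (io (M j l) * ka l x) by [].
have WH M : W (H M).
  have /choice [t tE] := xia.
  exists (make_endo (HfD M t) (HfZ M t)) => x.
  rewrite HE make_endoE linear_sum; apply: eq_bigr => j _.
  by rewrite linear_sum; apply: eq_bigr => l _; rewrite linear_rscale -tE.
have recon h : W h -> forall x, h x = H (mat h) x.
  move=> [g gE] x; rewrite HE exchange_big {1}[x]idE linear_sum.
  apply: eq_bigr => l _; rewrite linear_rscale.
  have -> : h (q l) = \sum_j xi j *> chi j (h (q l)) by rewrite gE -aE.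
  rewrite rscale_suml; apply: eq_bigr => j _.
  by rewrite rscaleA -matE.
have matH M : mat (H M) = M.
  apply/matrixP => j l; apply: ioI; rewrite matE HE c_sum.
  have E2 k : io (M j k) * ka k (q l) = if k == l then io (M j l) else 0.
    by rewrite kaq; case: eqP => [->|_]; rewrite ?ior ?mulr0.
  have E1 i : chi j (\sum_k xi i *> (io (M i k) * ka k (q l))) =
              if i == j then io (M j l) else 0.
    rewrite c_sum; under eq_bigr do rewrite cZ chixi.
    rewrite eq_sym; case: eqP => [->|_]; last by rewrite big1 // => k; rewrite mul0r.
    under eq_bigr do rewrite E2.
    rewrite -mulr_sumr -big_mkcond big_pred1_eq.
    exact: iol.
  by rewrite (eq_bigr _ (fun i _ => E1 i)) -big_mkcond big_pred1_eq.
have HZ M x y : H M x *> z y = H (y *: M) x.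
  rewrite !HE rscale_suml; apply: eq_bigr => j _; rewrite rscale_suml.
  apply: eq_bigr => l _; rewrite rscaleA mxE mulrC ioM -mulrA -zc mulrA.
  by rewrite -[io (M j l)]ior -!mulrA [e * _]mulrA -zc ze !mulrA ior.
have H_sum (d : nat) (M : 'I_d -> 'M[L]_(r, m)) x :
    \sum_i H (M i) x = H (\sum_i M i) x.
  transitivity (\sum_i \sum_j \sum_l xi j *> (io (M i j l) * ka l x)) => //.
  rewrite exchange_big HE; apply: eq_bigr => j _.
  rewrite exchange_big; apply: eq_bigr => l _.
  by rewrite summxE io_sum mulr_suml rscale_sumr.
have mat_comb d (es : 'I_d -> {linear Q -> Q}) (c : 'I_d -> B) (h : {linear Q -> Q}) :
    (forall i, central (c i)) -> (forall x, h x = \sum_i es i x *> c i) ->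
    mat h = \sum_i pin (c i * e) *: mat (es i).
  move=> cc hE; apply/matrixP => j l; apply: ioI.
  rewrite matE hE c_sum summxE io_sum; apply: eq_bigr => i _.
  by rewrite [in RHS]mxE mulrC ioM cE // (cc i e) mulrA ior cZ matE.
have dimE d : (exists es, center_basis W es (d := d)) <-> d = (r * m)%N.
  split=> [[es [Wes span ind]]|->].
    (* The members of any basis over the center become rows of a matrix that is both row free and
       row full, which forces [d]; [center_dim] chooses [d] among all possible ones. *)
    pose N : 'M[L]_(d, r * m) := \matrix_i mxvec (mat (es i)).
    have NE (x : 'rV_d) : x *m N = mxvec (\sum_i x 0 i *: mat (es i)).
      rewrite mulmx_sum_row linear_sum; apply: eq_bigr => i _.
      by rewrite rowK linearZ.
    have freeN : row_free N.
      apply: inj_row_free => x xN; apply/rowP => i; rewrite mxE.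
      have H0 y : H 0 y = 0.
        rewrite HE big1 // => j _; rewrite big1 // => l _.
        by rewrite mxE io0 mul0r rscale0.
      have M0 : \sum_k x 0 k *: mat (es k) = 0.
        by rewrite -[LHS]mxvecK -NE xN linear0.
      have zi := ind (fun k => z (x 0 k)) (fun k => zc _).
      apply: ioI; rewrite io0 -ze (zi _ i) ?mul0r // => y.
      rewrite (eq_bigr (fun k => H (x 0 k *: mat (es k)) y)) => [|k _].
        by rewrite H_sum M0.
      by rewrite (recon _ (Wes k)) HZ.
    have fullN : row_full N.
      rewrite -sub1mx; apply/row_subP => i.
      have [c [cc cE']] := span _ (WH (vec_mx (row i 1%:M))).
      apply/submxP; exists (\row_k pin (c k * e)).
      rewrite NE -[LHS]vec_mxK -(matH (vec_mx (row i 1%:M))).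
      congr mxvec; rewrite (mat_comb _ _ _ _ cc cE').
      by apply: eq_bigr => k _; rewrite mxE.
    by rewrite -(eqP freeN) (eqP fullN).
  pose D i : 'M[L]_(r, m) := vec_mx (delta_mx 0 i).
  have DE (x : 'I_(r * m) -> L) : \sum_i x i *: D i = vec_mx (\row_i x i).
    rewrite [\row_i _]row_sum_delta linear_sum; apply: eq_bigr => i _.
    by rewrite linearZ mxE.
  exists (fun i => H (D i)); split=> [i|h Wh|c cc c0 i]; first exact: WH.
    exists (fun i => z (mxvec (mat h) 0 i)); split=> [i|x]; first exact: zc.
    rewrite (recon _ Wh) (eq_bigr _ (fun i _ => HZ (D i) x _)) H_sum DE.
    by congr (H _ x); rewrite -[LHS]mxvecK; congr vec_mx; apply/rowP => k; rewrite mxE.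
  have : mat (H 0) = \sum_i pin (c i * e) *: mat (H (D i)).
    apply: mat_comb => // x; rewrite c0 HE big1 // => j _; rewrite big1 // => l _.
    by rewrite mxE io0 mul0r rscale0.
  under eq_bigr do rewrite matH.
  rewrite matH DE => /(congr1 mxvec); rewrite vec_mxK linear0 => /rowP/(_ i).
  by rewrite !mxE => h; rewrite -(zpin (c i)) // -h z0.
apply: xget_unique => [|d [es Hes]]; first by apply/dimE.
by apply/dimE; exists es.
Qed.

End CenterDimension.

(** The central idempotents split the product into an [E] part, settled by the first identity, and
    an [E'] part, settled by the second, where the two signs cancel. *)
Lemma orthogonal_idempotents_form (R : pzRingType) (E E' Ps P Ss S As A : R) :
  (forall g, E * g = g * E) -> (forall g, E' * g = g * E') ->
  E * E = E -> E * E' = 0 -> E' * E' = E' -> E + E' = 1 ->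
  Ps * Ss * P * As = Ps -> Ps * S * P * A = Ps ->
  Ps * (Ss * E - E' * S) * P * (As * E - E' * A) = Ps.
Proof.
move=> EC E'C EE EE' E'E' EE1 e1 e2.
have E'E : E' * E = 0 by rewrite E'C.
have sw x g : x * E * g = x * g * E by rewrite -mulrA EC mulrA.
have sw' x g : x * E' * g = x * g * E' by rewrite -mulrA E'C mulrA.
rewrite !E'C !(mulrBr, mulrBl) !mulrA.
rewrite !(sw _ P) !(sw' _ P) !(sw _ As) !(sw' _ As) !(sw _ A) !(sw' _ A) e1 e2.
rewrite -!(mulrA _ E) -!(mulrA _ E') EE EE' E'E E'E' !mulr0 subr0 sub0r opprK.
by rewrite -mulrDr EE1 mulr1.
Qed.

(** * Nondegenerate Lambda-forms over a simple artinian factor *)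

Section Factor.
Variables (B : pzRingType) (Q : lmodType B^c) (X : hspace Q).
Local Notation sigma := (hs_inv X).
Local Notation u := (hs_u X).
Local Notation Lam := (hs_param X).
Local Notation U := (hs_unitary X).
Local Notation star := (hs_star X).
Local Notation US := (hs_star_unitary X).

Variables (phi s : endo Q).
Hypotheses (phiP : hs_iso X phi) (asa : (1 - phi) * s * (1 - phi) = 1 - phi).
Local Notation a := (1 - phi).
Local Notation p := (a * s).

(** As [sigma] exchanges the two halves of B, a form on one half can be arbitrary and determines the
    other half. Taking the Wall form on one half and minus its adjoint on the other gives a minimal,
    hence Lambda-, form that is nondegenerate on the image of [a]. *)
Lemma exchange_form (e : B) : central e -> e * e = e -> sigma e = 1 - e ->
  exists lam mu : endo Q, hs_lam X lam /\ star p * lam * p * mu = star p.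
Proof.
move=> ce ee se.
pose m (b : B) (cb : central b) : endo Q := make_endo (g := fun x => x *> b)
  (fun x y => rscaleDl x y b)
  (fun x c => etrans (rscaleA _ _ _) (etrans (congr1 _ (esym (cb _)))
             (esym (rscaleA _ _ _)))).
have cs : central (sigma e) by move=> b; rewrite se mulrBl mulrBr ce mulr1 mul1r.
pose E := m e ce.
have EC (g : endo Q) : E * g = g * E.
  by apply/endoP => x; rewrite !endoM linear_rscale.
have EsE : star E = 1 - E.
  apply/endoP => x; apply: (h_injr (X := X)) => y.
  rewrite hs_starEr endoB endo1 hBr [E y]make_endoE [E x]make_endoE hZl hZr se.
  by rewrite mulrBl mul1r ce.
have [phi1 phi2 _] := phiP.
have as1 : star a = - (star phi * a).
  by rewrite (involB US) (invol1 US) mulrBr phi1 mulr1 opprB.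
have as2 : star a = - (a * star phi).
  by rewrite (involB US) (invol1 US) mulrBl phi2 mul1r opprB.
have asas : star a * star s * star a = star a.
  by rewrite -!(involM US) mulrA asa.
have ps : star p = star s * star a by rewrite (involM US).
have e1 : star p * star s * p * star a = star p.
  have -> : star p * star s * p * star a = star p * star s * (p * star a).
    by rewrite -!mulrA.
  have -> : p * star a = star a by rewrite as2 mulrN mulrA asa.
  by rewrite ps -!mulrA [star a * _]mulrA asas.
have e2 : star p * s * p * a = star p.
  have -> : star p * s * p * a = star p * s * (p * a) by rewrite -!mulrA.
  rewrite asa ps -!mulrA; congr (_ * _).
  by rewrite as1 mulNr -mulrA [a * _]mulrA asa.
exists (star s * E - (1 - E) * s), (star a * E - (1 - E) * a); split.
  have -> : star s * E - (1 - E) * s = star s * E - star (star s * E) * 1.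
    by rewrite mulr1 (involM US) EsE (involK US).
  exact: (param_min US).
have EE : E * E = E.
  by apply/endoP => x; rewrite endoM ![E _]make_endoE rscaleA ee.
have [E' E'E] : exists E', E' = 1 - E by exists (1 - E).
have E'C (g : endo Q) : E' * g = g * E' by rewrite E'E mulrBl mulrBr EC mul1r mulr1.
have EE' : E * E' = 0 by rewrite E'E mulrBr mulr1 EE subrr.
have E'E' : E' * E' = E' by rewrite {2}E'E mulrBr mulr1 E'C EE' subr0.
rewrite -E'E; apply: orthogonal_idempotents_form e1 e2 => //.
by rewrite E'E addrC subrK.
Qed.

(** If Lambda contains a nonzero [c] in sigma(e)Be, the diagonal Gram matrix with entries [c] works.
    Otherwise B is split-orthogonal, the Dickson condition makes the rank of the image even, and an
    alternating antidiagonal matrix works. *)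
Lemma simple_form : simple_artinian_unitary sigma u Lam -> simple_ring B ->
  (split_orthogonal sigma u Lam -> (exists x : Q, x <> 0) -> dickson phi = 0) ->
  exists lam mu : endo Q, hs_lam X lam /\ star p * lam * p * mu = star p.
Proof.
move=> SA simpB Dphi; have [_ [artB _] one0 _] := SA.
have [e eP] := exists_division_idempotent artB simpB one0.
have ee := di_idem eP.
have see : sigma e * sigma e = sigma e by rewrite -(involM U) ee.
have [r [xi [chi bas]]] := exists_image_basis simpB eP X a.
have [[c [Lc [cE cn]]]|noc] :=
    pselect (exists c, Lam c /\ (sigma e * c * e = c /\ c <> 0)).
  have ce : c * e = c by rewrite -{1}cE -mulrA ee cE.
  have [c' [c'E cc' _]] := corner_inverse simpB eP cE cn.
  have ec' : e * c' = c' by rewrite -{1}c'E !mulrA ee c'E.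
  have [||||lam [mu [lamP h]]] := param_form_of_matrix (X := X) asa bas
    (C := fun j k => if j == k then c else 0)
    (C' := fun j k => if j == k then c' else 0).
  - by move=> k; rewrite eqxx.
  - move=> k l; rewrite eq_sym; case: eqP => _; last by rewrite (invol0 U) mul0r oppr0.
    by rewrite (param_max U Lc) opprK.
  - by move=> k l; case: eqP => _ //; rewrite mulr0.
  - move=> j l; rewrite (bigD1 j) //= eqxx big1 => [|k /negPf kj].
      by rewrite addr0; case: eqP => _; rewrite ?mulr0.
    by rewrite eq_sym kj mul0r.
  by exists lam, mu; split=> //; apply: h.
have Lam0 c : Lam c -> sigma e * c * e = c -> c = 0.
  by move=> Lc cE; apply: contrapT => cn; apply: noc; exists c.
have [Q0|noQ] := pselect (exists x : Q, x <> 0); last first.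
  have x0 (x : Q) : x = 0 by apply: contrapT => xn; apply: noQ; exists x.
  exists 0, 0; split; first exact: (param0 US).
  by apply/endoP => x; rewrite [LHS]x0 [RHS]x0.
have [n [v [w MU]]] := exists_matrix_units simpB eP.
have so := corner_split_orthogonal simpB eP Lam0 MU SA.
have [m [q [ka bas1]]] := exists_image_basis simpB eP X 1.
(* The space of maps into the image has dimension r m and the degree is m, so the Dickson invariant
   is r modulo 2. *)
have even_r : ~~ odd r.
  have d1 := center_dim_image simpB eP Lam0 MU bas bas1.
  have d2 := center_dim_image simpB eP Lam0 MU bas1 bas1.
  have m_gt0 : (0 < m)%N.
    rewrite lt0n; apply/eqP => m0; have [x xn] := Q0; apply: xn.
    have [_ _ _ _ idE] := bas1; rewrite -[x]/((1 : endo Q) x) idE.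
    have m_empty (j : 'I_m) : False by case: j => i; rewrite m0.
    by rewrite big1 // => j; case: (m_empty j).
  have dE : dickson phi = (center_dim [set h : {linear Q -> Q} |
      exists g : {linear Q -> Q}, forall x, h x = a (g x)] %/ degree Q)%:R by [].
  have := Dphi so Q0; rewrite dE.
  have -> : degree Q = m.
    rewrite /degree; have -> : [set: {linear Q -> Q}] =
        [set h : {linear Q -> Q} | exists g : {linear Q -> Q},
           forall x, h x = (1 : endo Q) (g x)].
      by apply/seteqP; split=> // h _; exists h.
    rewrite d2; apply: xget_unique => [|k]; first by rewrite /= -mulnn.
    by move=> /= /eqP; rewrite mulnn eqn_exp2r // => /eqP.
  rewrite d1 mulnK // => /(congr1 (fun x : 'Z_2 => val x)) /=.
  by rewrite val_Zp_nat // modn2; case: odd.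
have [k0 [k' [kE k'E kk' k'k]]] := exists_corner_pairing X simpB eP.
have ke : k0 * e = k0 by rewrite -{1}kE -mulrA ee kE.
have ek' : e * k' = k' by rewrite -{1}k'E !mulrA ee k'E.
have ks : sigma k0 * u = k0 := corner_symmetric Lam0 kE.
(* Signs of an antidiagonal matrix, positive in the first half and negative in the second. As [r] is
   even, [rev_ord] has no fixed point, so the diagonal is zero. *)
pose sg (j : 'I_r) (x : B) := if (j < rev_ord j)%N then x else - x.
have rev_lt (j : 'I_r) : (rev_ord j < rev_ord (rev_ord j))%N = ~~ (j < rev_ord j)%N.
  rewrite rev_ordK -leqNgt [RHS]leq_eqVlt; case: eqP => //= jr.
  have er : (j + j.+1)%N = r by rewrite -[X in (X + _)%N]jr /= subnK // ltn_ord.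
  by case/negP: even_r; rewrite -er addnS addnn oddS odd_double.
have [||||lam [mu [lamP h]]] := param_form_of_matrix (X := X) asa bas
    (C := fun j k => if k == rev_ord j then sg j k0 else 0)
    (C' := fun k l => if k == rev_ord l then sg l k' else 0).
- move=> k; have -> : (k == rev_ord k) = false; last exact: (param0 U).
  by apply/eqP => kr; have := rev_lt k; rewrite -!kr !ltnn.
- move=> k l; have -> : (k == rev_ord l) = (l == rev_ord k).
    by apply/eqP/eqP => ->; rewrite rev_ordK.
  case: eqP => [->|_]; last by rewrite (invol0 U) mul0r oppr0.
  by rewrite /sg rev_lt; case: ltnP => _ /=; rewrite ?(involN U) ?mulNr ks ?opprK.
- by move=> k l; case: eqP => _; rewrite ?mulr0 // /sg; case: ifP; rewrite ?mulrN ek'.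
- move=> j l; rewrite (bigD1 (rev_ord j)) //= eqxx big1 => [|k /negPf kj].
    rewrite addr0 (inj_eq rev_ord_inj); case: eqP => [<-|_]; last by rewrite mulr0.
    by rewrite /sg; case: ifP => _; rewrite ?mulrNN kk'.
  by rewrite kj mul0r.
by exists lam, mu; split=> //; apply: h.
Qed.

Lemma factor_form : simple_artinian_unitary sigma u Lam ->
  (split_orthogonal sigma u Lam -> (exists x : Q, x <> 0) -> dickson phi = 0) ->
  exists lam mu : endo Q, hs_lam X lam /\ star p * lam * p * mu = star p.
Proof.
move=> SA D; have [[e [ce ee se]]|simpB] := exchange_or_simple SA.
  exact: exchange_form ce ee se.
exact: simple_form.
Qed.

End Factor.

(** * Reduction to the simple factors of B/Jac(B) *)

Section Coordinates.
Variables (A : pzRingType) (P : lmodType A^c) (X : hspace P).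
Local Notation sigma := (hs_inv X).
Local Notation h := (hs_h X).
Local Notation x_ := (@hs_x _ _ X).
Local Notation y_ := (@hs_y _ _ X).
Local Notation U := (hs_unitary X).

Lemma endo_coords (e : endo P) x y : h x (e y) =
  \sum_k \sum_l sigma (h (y_ k) x) * h (x_ k) (e (x_ l)) * h (y_ l) y.
Proof.
rewrite {1}[x](hbasis X) h_suml; apply: eq_bigr => k _; rewrite hZl.
rewrite {1}[y](hbasis X) linear_sum h_sumr mulr_sumr; apply: eq_bigr => l _.
by rewrite linear_rscale hZr mulrA.
Qed.

Lemma lam_of_coords (C : 'I_(hs_dim X) -> 'I_(hs_dim X) -> A) :
  (forall k, hs_param X (C k k)) ->
  (forall k l : 'I_(hs_dim X), (k < l)%N -> C l k = - (sigma (C k l) * hs_u X)) ->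
  exists2 lam, hs_lam X lam & forall x y, h x (lam y) =
    \sum_k \sum_l sigma (h (y_ k) x) * C k l * h (y_ l) y.
Proof.
move=> Cd Cs.
have Cs' k l : C l k = - (sigma (C k l) * hs_u X).
  case: (ltngtP k l) => [|lk|/val_inj <-]; first exact: Cs.
    rewrite (Cs l k lk) (involN U) (involM U) (involK U) mulNr opprK.
    by rewrite (Vu_central U) -mulrA (mulVu U) mulr1.
  by rewrite (param_max U (Cd k)) opprK.
pose b x y := \sum_k \sum_l sigma (h (y_ k) x) * C k l * h (y_ l) y.
have bd : dual_hom sigma b.
  split=> [x|x y|x a].
  - split=> [y z|y a]; rewrite /b.
      rewrite -big_split; apply: eq_bigr => k _; rewrite -big_split.
      by apply: eq_bigr => l _; rewrite hDr mulrDr.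
    rewrite mulr_suml; apply: eq_bigr => k _; rewrite mulr_suml.
    by apply: eq_bigr => l _; rewrite hZr mulrA.
  - apply/funext => z; rewrite /= /b -big_split; apply: eq_bigr => k _.
    rewrite -big_split; apply: eq_bigr => l _.
    by rewrite hDr (involD U) !mulrDl.
  - apply/funext => z; rewrite /dual_scale /b mulr_sumr; apply: eq_bigr => k _.
    rewrite mulr_sumr; apply: eq_bigr => l _.
    by rewrite hZr (involM U) !mulrA.
exists (hs_op bd); last by move=> x y; rewrite hs_opE.
apply/(hs_lamP (b := b)) => [x y|]; first by rewrite hs_opE.
split=> // [x|x]; last by apply: (param_quad U).
apply/funext => y; rewrite /form_transpose /omega /= /b (invol_sum U) mulr_suml.
rewrite -sumrN exchange_big; apply: eq_bigr => l _.
rewrite (invol_sum U) mulr_suml -sumrN; apply: eq_bigr => k _.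
rewrite (Cs' l k) !(involM U) (involK U) mulrN mulNr; congr (- _).
by rewrite -!mulrA (u_central U) !mulrA.
Qed.

End Coordinates.

Section Residues.
Variables (B : pzRingType) (Q : lmodType B^c) (X : hspace Q).
Variable D : factorization (hs_inv X) (hs_u X) (hs_param X) (@hs_form _ _ X).
Local Notation I := 'I_(fact_size D).
Local Notation pr := (@fact_proj _ _ _ _ _ _ D).
Local Notation mp := (@fact_mproj _ _ _ _ _ _ D).
Local Notation h := (hs_h X).

Let mpD i x y : mp i (x + y) = mp i x + mp i y. Proof. exact: fact_mprojD. Qed.
Let mpZ i x b : mp i (x *> b) = mp i x *> pr i b. Proof. exact: fact_mprojZ. Qed.
Let mp0 i : mp i 0 = 0.
Proof. by apply: (addrI (mp i 0)); rewrite -mpD !addr0. Qed.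
Let mpN i x : mp i (- x) = - mp i x.
Proof. by apply: (addrI (mp i x)); rewrite -mpD !subrr mp0. Qed.
Let mp_sum i (J : Type) (r : seq J) (P : pred J) (F : J -> Q) :
  mp i (\sum_(j <- r | P j) F j) = \sum_(j <- r | P j) mp i (F j).
Proof. by elim/big_rec2: _ => [|j x y _ <-]; rewrite ?mp0 ?mpD. Qed.
Let mp_surj i (y : fact_module i) : exists x, mp i x = y.
Proof.
(* The family is [y] at [i] and 0 elsewhere, so joint surjectivity gives that of each projection. *)
have [x xE] := fact_mproj_surj (dfwith (fun j => (0 : fact_module j)) i y).
by exists x; rewrite xE dfwithin.
Qed.
Let formE i x y : fact_form (mp i x) (mp i y) = pr i (hs_form X x y).
Proof. exact: fact_formE. Qed.

Let factor_unitary i := let: And4 u _ _ _ := fact_simple (f := D) i in u.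

Let factor_dual i : dual_hom (@fact_invol _ _ _ _ _ _ D i) (@fact_form _ _ _ _ _ _ D i).
Proof.
have [dl dD dZ] := hs_dual X; split=> [x|x y|x a].
- have [{}x <-] := mp_surj x; have [xD xZ] := dl x.
  split=> [y z|y b]; have [{}y <-] := mp_surj y.
    have [{}z <-] := mp_surj z.
    by rewrite -mpD !formE xD rmorphD.
  have [b' b'E] := fact_proj_surj (dfwith (fun j => (0 : fact_ring j)) i b).
  have <- : pr i b' = b by rewrite b'E dfwithin.
  by rewrite -mpZ !formE xZ rmorphM.
- apply/funext => z; have [[[{}x <-] [{}y <-]] [{}z <-]] :=
    (mp_surj x, mp_surj y, mp_surj z).
  by rewrite /= -mpD !formE dD rmorphD.
- apply/funext => z; have [[{}x <-] [{}z <-]] := (mp_surj x, mp_surj z).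
  have [b' b'E] := fact_proj_surj (dfwith (fun j => (0 : fact_ring j)) i a).
  have <- : pr i b' = a by rewrite b'E dfwithin.
  by rewrite /dual_scale fact_involE -mpZ !formE dZ rmorphM.
Qed.

Let factor_h i x y : hermitian_form (@fact_invol _ _ _ _ _ _ D i) (fact_unit i)
  (@fact_form _ _ _ _ _ _ D i) (mp i x) (mp i y) = pr i (h x y).
Proof.
rewrite /hermitian_form /form_transpose /omega /= !formE fact_involE.
by rewrite fact_unitE -rmorphM -rmorphD.
Qed.

Let factor_basis i z : z = \sum_k mp i (@hs_x _ _ X k) *>
  hermitian_form (@fact_invol _ _ _ _ _ _ D i) (fact_unit i)
    (@fact_form _ _ _ _ _ _ D i) (mp i (@hs_y _ _ X k)) z.
Proof.
have [{}z <-] := mp_surj z; rewrite {1}[z](hbasis X) mp_sum.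
by apply: eq_bigr => k _; rewrite factor_h mpZ.
Qed.

Definition factor_space i : hspace (@fact_module _ _ _ _ _ _ D i) :=
  Hspace (@factor_unitary i) (@factor_dual i) (@factor_basis i).
Local Notation Y := factor_space.

Lemma factor_spaceE i x y : hs_h (Y i) (mp i x) (mp i y) = pr i (h x y).
Proof. exact: factor_h. Qed.

(** Choose [b] mapping to 0 in the factor [i] and to 1 in the others. For [x] in the kernel, x - x b
    lies in Q Jac(B), which every endomorphism preserves. This makes [induced] independent of the
    preimage it chooses. *)
Lemma factor_ker i (e : endo Q) x : mp i x = 0 -> mp i (e x) = 0.
Proof.
move=> x0.
have [b bE] := fact_proj_surj (dfwith (fun j : I => (1 : fact_ring j)) i 0).
have bi : pr i b = 0 by rewrite bE dfwithin.
have [s [sJ sE]] : module_jacobson (x - x *> b).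
  apply/(fact_mproj_ker D) => j; rewrite mpD mpN mpZ.
  have [<-|/eqP ij] := pselect (i = j); first by rewrite bi x0 rscale0 subrr.
  by rewrite bE dfwithout // rscale1 subrr.
have : module_jacobson (e x - e x *> b).
  exists [seq (e p.1, p.2) | p <- s]; split.
    by move=> _ /mapP[p ps ->]; exact: (sJ p ps).
  rewrite big_map -linear_rscale -linearB sE linear_sum.
  by apply: eq_bigr => p _; rewrite linear_rscale.
move/(fact_mproj_ker D)/(_ i); rewrite mpD mpN mpZ bi rscale0 subr0.
by [].
Qed.

Lemma induced_proj i (e : endo Q) x :
  @induced _ _ _ _ _ _ D e i (mp i x) = mp i (e x).
Proof.
rewrite /induced; apply/eqP; rewrite -subr_eq0 -mpN -mpD -linearB.
apply/eqP; apply: factor_ker; rewrite mpD mpN.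
have := @xgetPex _ 0 [set z | mp i z = mp i x] (ex_intro _ x erefl).
by move=> /= ->; rewrite subrr.
Qed.

Local Notation ind i e := (@induced _ _ _ _ _ _ D (e : endo Q) i).
Let resD i (e : endo Q) x y : ind i e (x + y) = ind i e x + ind i e y.
Proof.
have [[{}x <-] [{}y <-]] := (mp_surj x, mp_surj y).
by rewrite -mpD !induced_proj linearD mpD.
Qed.
Let resZ i (e : endo Q) x a : ind i e (x *> a) = ind i e x *> a.
Proof.
have [{}x <-] := mp_surj x.
have [b' b'E] := fact_proj_surj (dfwith (fun j => (0 : fact_ring j)) i a).
have <- : pr i b' = a by rewrite b'E dfwithin.
by rewrite -mpZ !induced_proj linear_rscale mpZ.
Qed.

Definition residue i (e : endo Q) : endo (@fact_module _ _ _ _ _ _ D i) :=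
  make_endo (@resD i e) (@resZ i e).
Lemma residueE i e x : residue i e (mp i x) = mp i (e x).
Proof. exact: induced_proj. Qed.

Let residue_ext i (e : endo Q) (g : endo (@fact_module _ _ _ _ _ _ D i)) :
  (forall x, mp i (e x) = g (mp i x)) -> residue i e = g.
Proof.
by move=> eg; apply/endoP => x; have [{}x <-] := mp_surj x; rewrite residueE.
Qed.

Lemma residueM i e g : residue i (e * g) = residue i e * residue i g.
Proof. by apply: residue_ext => x; rewrite [RHS]endoM !residueE. Qed.
Lemma residueB i e g : residue i (e - g) = residue i e - residue i g.
Proof.
by apply: residue_ext => x; rewrite [RHS]endoB !residueE endoB mpD mpN.
Qed.
Lemma residue1 i : residue i 1 = 1.
Proof. by apply: residue_ext. Qed.
Lemma residue_star i e : residue i (hs_star X e) = hs_star (Y i) (residue i e).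
Proof.
apply: residue_ext => x; apply: (h_injr (X := Y i)) => z.
have [{}z <-] := mp_surj z.
by rewrite hs_starEr residueE !factor_spaceE hs_starEr.
Qed.
Lemma residue_lam i e : hs_lam X e -> hs_lam (Y i) (residue i e).
Proof.
case=> es eL; split.
  rewrite -residue_star es -[- e]sub0r residueB.
  by rewrite [residue i 0](@residue_ext i _ 0) ?sub0r // => x; rewrite mp0.
move=> x; have [{}x <-] := mp_surj x; rewrite residueE factor_spaceE.
have : exists2 b, hs_param X b & forall j, pr j b = pr j (h x (e x)).
  by exists (h x (e x)).
by move/fact_paramE/(_ i).
Qed.
Lemma residue_iso i e : hs_iso X e -> hs_iso (Y i) (residue i e).
Proof.
have epsE : residue i (hs_eps X) = hs_eps (Y i).
  apply: residue_ext => x; apply: (h_injr (X := Y i)) => z.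
  have [{}z <-] := mp_surj z.
  by rewrite hs_epsE factor_spaceE hs_epsE -formE.
case=> e1 e2 eL; split.
- by rewrite -residue_star -residueM e1 residue1.
- by rewrite -residue_star -residueM e2 residue1.
- by rewrite -residue_star -epsE -!residueM -residueB; apply: residue_lam.
Qed.

(** Hence an identity modulo [J] may be checked in every factor separately. *)
Lemma residue_zero e : (forall i, residue i e = 0) <-> rad_ideal e.
Proof.
split=> [e0 x|Je i].
  apply/(rad_module_jacobson X)/(fact_mproj_ker D) => i.
  by rewrite -residueE e0.
apply: residue_ext => x.
by have /(rad_module_jacobson X)/(fact_mproj_ker D) -> := Je x.
Qed.

Lemma residue_lift (g : forall i : I, endo (@fact_module _ _ _ _ _ _ D i)) :
  exists e, forall i, residue i e = g i.
Proof.
have /choice [w wE] : forall k : 'I_(hs_dim X), exists z : Q, forall i, mp i z = g i (mp i (hs_x k)).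
  by move=> k; apply: fact_mproj_surj.
exists (of_values w) => i; apply: residue_ext => x.
rewrite of_valuesE mp_sum {2}[x](hbasis X) mp_sum linear_sum.
by apply: eq_bigr => k _; rewrite !mpZ linear_rscale wE.
Qed.

(** The Gram matrix is lifted entry by entry: the diagonal inside Lambda through [fact_paramE], the
    upper triangle by surjectivity, and the lower triangle as dictated by skewness. *)
Lemma residue_lam_lift (g : forall i : I, endo (@fact_module _ _ _ _ _ _ D i)) :
  (forall i, hs_lam (Y i) (g i)) ->
  exists2 e, hs_lam X e & forall i, residue i e = g i.
Proof.
move=> gL.
pose c (k l : 'I_(hs_dim X)) (i : I) := hs_h (Y i) (mp i (hs_x k)) (g i (mp i (hs_x l))).
have /choice [d dE] : forall k : 'I_(hs_dim X), exists b, hs_param X b /\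
    forall i, pr i b = c k k i.
  move=> k; have [] : exists2 b, hs_param X b & forall i, pr i b = c k k i.
    by apply/fact_paramE => i; have [_ gi] := gL i; apply: gi.
  by move=> b; exists b.
have /choice [f fE] : forall kl : 'I_(hs_dim X) * 'I_(hs_dim X), exists b, forall i, pr i b = c kl.1 kl.2 i.
  by move=> kl; apply: fact_proj_surj.
pose C (k l : 'I_(hs_dim X)) := if (k == l) then d k else
  if (k < l)%N then f (k, l) else - (hs_inv X (f (l, k)) * hs_u X).
have CE k l i : pr i (C k l) = c k l i.
  rewrite /C; case: eqP => [<-|/eqP kl]; first by case: (dE k).
  case: ifP => kl'; first by rewrite fE.
  rewrite rmorphN rmorphM -fact_unitE -fact_involE fE /c /=.
  have [gs _] := gL i.
  have -> : @fact_invol _ _ _ _ _ _ D i (hs_h (Y i) (mp i (hs_x l)) (g i (mp i (hs_x k)))) *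
      fact_unit i = hs_h (Y i) (g i (mp i (hs_x k))) (mp i (hs_x l)).
    exact: (hC (Y i)).
  by rewrite -hs_starEr gs endoN hNr opprK.
have [||e eL eE] := lam_of_coords (X := X) (C := C).
- by move=> k; rewrite /C eqxx; case: (dE k).
- move=> k l kl; rewrite /C kl [l == k]eq_sym.
  have /negPf -> : k != l by rewrite -val_eqE /= neq_ltn kl.
  by rewrite ltnNge (ltnW kl).
exists e => // i; apply: residue_ext => x; apply: (h_injr (X := Y i)) => z.
have [{}z <-] := mp_surj z; rewrite factor_spaceE eE rmorph_sum.
rewrite [RHS](endo_coords (Y i)); apply: eq_bigr => k _.
rewrite rmorph_sum; apply: eq_bigr => l _.
rewrite !rmorphM CE -fact_involE; congr (_ * _ * _).
  by congr (fact_invol _); rewrite -factor_spaceE.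
by rewrite -factor_spaceE.
Qed.

(** The forms found by [factor_form] on the factors lift to one Lambda-form on [Q], and the relation
    required by [transformation_of_form] holds modulo [J] because it holds in each residue. *)
Lemma dickson_transformation (phi s : endo Q) :
  (forall n (M M' : 'M[endo Q]_n), M *m M' = 1%:M -> M' *m M = 1%:M) ->
  dickson_kernel D phi -> rad_ideal ((1 - phi) * s * (1 - phi) - (1 - phi)) ->
  transformation X phi.
Proof.
move=> fin [/hs_isoP phiP dphi] sJ.
have fac i : exists lm : endo (@fact_module _ _ _ _ _ _ D i) * endo (@fact_module _ _ _ _ _ _ D i),
    let p := (1 - residue i phi) * residue i s in
    hs_lam (Y i) lm.1 /\ hs_star (Y i) p * lm.1 * p * lm.2 = hs_star (Y i) p.
  have [||||lam [mu [lamP h]]] := @factor_form _ _ (Y i) (residue i phi) (residue i s).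
  - exact: residue_iso.
  - have /residue_zero/(_ i) := sJ; rewrite residueB !residueM residueB residue1.
    by move/eqP; rewrite subr_eq0 => /eqP.
  - exact: fact_simple.
  - move=> so ex; exact: (dphi (exist _ i (conj so ex))).
  by exists (lam, mu).
have [lam lamL lamE] := residue_lam_lift (fun i => (svalP (cid (fac i))).1).
have [mu muE] := residue_lift (fun i => (sval (cid (fac i))).2).
apply: (transformation_of_form (s := s) (lam := lam) (mu := mu) fin phiP) => //.
apply/residue_zero => i; rewrite residueB !residueM !residue_star !residueM.
rewrite residueB residue1 lamE muE.
by have [_ ->] := svalP (cid (fac i)); rewrite subrr.
Qed.

End Residues.

(** * Continuity and density over the topological ring *)

Section ContinuousFunctions.
Variables (K : comTopologicalRingType) (T : topologicalType) (t : T).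
Local Notation cts f := {for t, continuous (f : T -> K)}.

Lemma cts_cst (c : K) : cts (fun=> c).
Proof. exact: cvg_cst. Qed.
Lemma ctsD (f g : T -> K) : cts f -> cts g -> cts (fun s => f s + g s).
Proof.
move=> cf cg.
apply: (@continuous_comp _ _ _ (fun s => (f s, g s)) (fun z : K * K => z.1 + z.2)).
  exact: cvg_pair.
exact: add_continuous.
Qed.
Lemma ctsM (f g : T -> K) : cts f -> cts g -> cts (fun s => f s * g s).
Proof.
move=> cf cg.
apply: (@continuous_comp _ _ _ (fun s => (f s, g s)) (fun z : K * K => z.1 * z.2)).
  exact: cvg_pair.
exact: mulr_continuous.
Qed.
Lemma cts_sum (I : Type) (r : seq I) (Q : pred I) (f : I -> T -> K) :
  (forall i, cts (f i)) -> cts (fun s => \sum_(i <- r | Q i) f i s).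
Proof.
move=> cf; elim: r => [|i r IHr].
  by under [X in {for t, continuous X}]eq_fun do rewrite big_nil; apply: cts_cst.
under [X in {for t, continuous X}]eq_fun do rewrite big_cons.
by case: (Q i) => //; apply: ctsD.
Qed.
Lemma cts_prod (I : Type) (r : seq I) (Q : pred I) (f : I -> T -> K) :
  (forall i, cts (f i)) -> cts (fun s => \prod_(i <- r | Q i) f i s).
Proof.
move=> cf; elim: r => [|i r IHr].
  by under [X in {for t, continuous X}]eq_fun do rewrite big_nil; apply: cts_cst.
under [X in {for t, continuous X}]eq_fun do rewrite big_cons.
by case: (Q i) => //; apply: ctsM.
Qed.
Lemma cts_det n (M : T -> 'M[K]_n) : (forall i j, cts (fun s => M s i j)) ->
  cts (fun s => \det (M s)).
Proof.
move=> cM; apply: cts_sum => p; apply: ctsM; first exact: cts_cst.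
exact: cts_prod.
Qed.
Lemma cts_adj n (M : T -> 'M[K]_n) : (forall i j, cts (fun s => M s i j)) ->
  forall i j, cts (fun s => \adj (M s) i j).
Proof.
move=> cM i j; under [X in {for t, continuous X}]eq_fun do rewrite mxE.
apply: ctsM; first exact: cts_cst.
apply: cts_det => k l; under [X in {for t, continuous X}]eq_fun do rewrite !mxE.
exact: cM.
Qed.
Lemma cts_row n (r : T -> 'rV[K]_n) : (forall j, cts (fun s => r s 0 j)) ->
  {for t, continuous r}.
Proof.
move=> cr U [V /= Vn VU]; rewrite nbhs_simpl /=.
suff: \forall s \near t, forall j, V 0 j (r s 0 j).
  by apply: filterS => s h; apply: VU => i j; rewrite !ord1.
by apply: filter_forall => j; apply: (cr j); apply: Vn.
Qed.

Hypothesis inv_continuous :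
  {within [set x : K | invertible x], continuous (@inverse K)}.
Hypothesis units_open : open [set x : K | invertible x].
Lemma cts_inverse (f : T -> K) : invertible (f t) -> cts f ->
  cts (fun s => inverse (f s)).
Proof.
move=> ft cf; apply: (@continuous_comp _ _ _ f (@inverse K)) => //.
have := inv_continuous; rewrite continuous_open_subspace //.
move=> h; apply: h; rewrite inE; exact: ft.
Qed.
Lemma near_invertible (f : T -> K) : invertible (f t) -> cts f ->
  \forall s \near t, invertible (f s).
Proof. by move=> ft cf; apply: cf; apply: open_nbhs_nbhs. Qed.

End ContinuousFunctions.

Section LinearTopology.
Variable K : comTopologicalRingType.

Lemma cts_entry n (t : 'rV[K]_n) j : {for t, continuous (fun s : 'rV[K]_n => s 0 j)}.
Proof.
move=> U Un; rewrite nbhs_simpl /=.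
exists (fun i k => [set x | k = j -> U x]).
  move=> i k /=; have [->|kj] := eqVneq k j.
    by rewrite ord1; apply: filterS Un => x Ux _.
  by apply: filterE => x e; rewrite e eqxx in kj.
by move=> s /(_ 0 j) h; apply: h.
Qed.

Lemma linear_row_continuous n m (g : {linear 'rV[K]_n -> 'rV[K]_m}) : continuous g.
Proof.
move=> t; apply: cts_row => j.
have E s : g s 0 j = \sum_k s 0 k * g (delta_mx 0 k) 0 j.
  rewrite {1}[s]row_sum_delta linear_sum summxE; apply: eq_bigr => k _.
  by rewrite linearZ [LHS]mxE.
under [X in {for t, continuous X}]eq_fun do rewrite E.
apply: cts_sum => k; apply: ctsM; [exact: cts_entry|exact: cts_cst].
Qed.

(** The composite of [r], [L] and [i'] is a linear map between row spaces, hence continuous. This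
    yields both the independence of the topology from the embedding and the continuity of
    multiplication. *)
Lemma closure_linear (M N : lmodType K) n m (i : {linear M -> 'rV[K]_n})
  (r : {linear 'rV[K]_n -> M}) (i' : {linear N -> 'rV[K]_m}) (L : {linear M -> N})
  (S : set M) (S' : set N) x : cancel i r ->
  (forall s, S s -> closure (i' @` S') (i' (L s))) ->
  closure (i @` S) (i x) -> closure (i' @` S') (i' (L x)).
Proof.
move=> ir SS' clx.
pose g : {linear 'rV[K]_n -> 'rV[K]_m} := (i' \o (L \o r) : {linear _ -> _}).
suff: closure (g @` (i @` S)) (g (i x)).
  rewrite {2}/g /= ir => h; apply: closed_closure; apply: closureS h.
  by move=> _ [_ [s Ss <-] <-]; rewrite /g /= ir; apply: SS'.
move=> U /linear_row_continuous; rewrite nbhs_simpl /= => /clx [_ [[s Ss <-] Us]].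
by exists (g (i s)); split=> //; exists (i s) => //; exists s.
Qed.

Lemma dense_row n (F0 : set K) (t : 'rV[K]_n) (U : set 'rV[K]_n) :
  dense F0 -> nbhs t U -> exists2 s, U s & forall j, F0 (s 0 j).
Proof.
move=> dF [V Vn VU].
have h j : exists c, F0 c /\ V 0 j c.
  have /nbhs_interior Vj := Vn 0 j.
  have [] := dF (V 0 j)° _ (open_interior _); first by exists (t 0 j); apply: nbhs_singleton.
  by move=> c [/interior_subset ? ?]; exists c.
have [c hc] := choice h.
exists (\row_j c j); first by apply: VU => i j; rewrite ord1 mxE; case: (hc j).
by move=> j; rewrite mxE; case: (hc j).
Qed.

End LinearTopology.

(* A K-algebra R with a finite dual basis, and a subring of elements that are
   rational over a subring F0 of K. *)
Record rational_form (K : comPzRingType) (F0 : set K) (R : pzRingType)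
    (kap : algebra_over K R) := RationalForm {
  rf_rat : set R;
  rf_rat1 : rf_rat 1;
  rf_ratB : forall a b, rf_rat a -> rf_rat b -> rf_rat (a - b);
  rf_ratM : forall a b, rf_rat a -> rf_rat b -> rf_rat (a * b);
  rf_ratZ : forall c a, F0 c -> rf_rat a -> rf_rat (kap c * a);
  rf_dim : nat;
  rf_w : 'I_rf_dim -> R;
  rf_om : 'I_rf_dim -> R -> K;
  rf_omD : forall j a b, rf_om j (a + b) = rf_om j a + rf_om j b;
  rf_omZ : forall j c a, rf_om j (kap c * a) = c * rf_om j a;
  rf_basis : forall a, a = \sum_j kap (rf_om j a) * rf_w j;
  rf_w_rat : forall j, rf_rat (rf_w j);
  rf_om_rat : forall j a, rf_rat a -> F0 (rf_om j a)
}.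

(** * Algebras with a rational structure: Cramer inverses and approximation *)

Section RationalForms.
Variables (K : comPzRingType) (F0 : set K) (R : pzRingType).
Variables (kap : algebra_over K R) (D : rational_form F0 kap).
Local Notation rat := (rf_rat D).
Local Notation N := (rf_dim D).
Local Notation w := (@rf_w _ _ _ _ D).
Local Notation om := (@rf_om _ _ _ _ D).

Lemma rf_rat0 : rat 0. Proof. by rewrite -(subrr 1); apply: rf_ratB; apply: rf_rat1. Qed.
Lemma rf_ratN a : rat a -> rat (- a).
Proof. by move=> ha; rewrite -[- a]add0r; apply: rf_ratB => //; apply: rf_rat0. Qed.
Lemma rf_ratD a b : rat a -> rat b -> rat (a + b).
Proof. by move=> ha hb; rewrite -[b]opprK; apply/rf_ratB/rf_ratN. Qed.
Lemma rf_rat_sum (I : Type) (r : seq I) (Q : pred I) (F : I -> R) :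
  (forall i, Q i -> rat (F i)) -> rat (\sum_(i <- r | Q i) F i).
Proof. by move=> h; elim/big_ind: _ => //; [exact: rf_rat0|exact: rf_ratD]. Qed.

Lemma rf_om0 j : om j 0 = 0.
Proof. by apply: (addrI (om j 0)); rewrite -rf_omD !addr0. Qed.
Lemma rf_om_sum j (I : Type) (r : seq I) (Q : pred I) (F : I -> R) :
  om j (\sum_(i <- r | Q i) F i) = \sum_(i <- r | Q i) om j (F i).
Proof. by elim/big_rec2: _ => [|i y1 y2 _ <-]; rewrite ?rf_om0 ?rf_omD. Qed.

Definition rf_col (a : R) : 'cV[K]_N := \col_j om j a.
Definition rf_comb (v : 'cV[K]_N) : R := \sum_j kap (v j 0) * w j.
Definition rf_mx (a : R) : 'M[K]_N := \matrix_(j, k) om j (a * w k).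
(** The elements [rf_w] need not be free, so [rf_mx 1] is only an idempotent. Adding the
    complementary idempotent makes the regular representation unital and multiplicative, and its
    determinant then detects invertibility. *)
Definition rf_hat (a : R) : 'M[K]_N := 1%:M - rf_mx 1 + rf_mx a.
(** Cramer's rule for the equation a x = 1, in coordinates. *)
Definition rf_inv_col (a : R) : 'cV[K]_N :=
  inverse (\det (rf_hat a)) *: (\adj (rf_hat a) *m rf_col 1).
Definition rf_inv (a : R) : R := rf_comb (rf_inv_col a).

Lemma rf_inv_colE a j : rf_inv_col a j 0 =
  inverse (\det (rf_hat a)) * \sum_k \adj (rf_hat a) j k * rf_col 1 k 0.
Proof. by rewrite [LHS]mxE; congr (_ * _); rewrite mxE. Qed.

Lemma rf_colK a : rf_comb (rf_col a) = a.
Proof. by rewrite [RHS](rf_basis D); apply: eq_bigr => j _; rewrite mxE. Qed.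

Lemma rf_colM a b : rf_col (a * b) = rf_mx a *m rf_col b.
Proof.
apply/colP => j; rewrite !mxE {1}[b](rf_basis D) mulr_sumr rf_om_sum.
apply: eq_bigr => k _; rewrite !mxE mulrA -(alg_map_central kap) -mulrA rf_omZ.
by rewrite mulrC.
Qed.

Lemma rf_mxM a b : rf_mx (a * b) = rf_mx a *m rf_mx b.
Proof.
apply/matrixP => j k; rewrite [LHS]mxE -mulrA.
have := congr1 (fun v : 'cV_N => v j 0) (rf_colM a (b * w k)).
rewrite [X in X = _]mxE => ->; rewrite !mxE.
by apply: eq_bigr => l _; rewrite !mxE.
Qed.

Lemma rf_mxD a b : rf_mx (a + b) = rf_mx a + rf_mx b.
Proof. by apply/matrixP => j k; rewrite !mxE mulrDl rf_omD. Qed.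
Lemma rf_mxZ c a : rf_mx (kap c * a) = c *: rf_mx a.
Proof. by apply/matrixP => j k; rewrite !mxE -mulrA rf_omZ. Qed.

Lemma rf_mx_comb m (t : 'I_m -> K) (g_ : 'I_m -> R) :
  rf_mx (\sum_k kap (t k) * g_ k) = \sum_k t k *: rf_mx (g_ k).
Proof.
elim/big_rec2: _ => [|k y1 y2 _ <-]; last by rewrite rf_mxD rf_mxZ.
by apply/matrixP => i j; rewrite !mxE mul0r rf_om0.
Qed.

Lemma rf_combM a v : a * rf_comb v = rf_comb (rf_mx a *m v).
Proof.
rewrite /rf_comb mulr_sumr.
transitivity (\sum_k \sum_j kap (om j (a * w k) * v k 0) * w j).
  apply: eq_bigr => k _; rewrite mulrA -(alg_map_central kap) -mulrA.
  rewrite {1}[a * w k](rf_basis D) mulr_sumr; apply: eq_bigr => j _.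
  by rewrite mulrA -rmorphM mulrC.
rewrite exchange_big; apply: eq_bigr => j _.
rewrite -mulr_suml -rmorph_sum; congr (kap _ * _); rewrite [RHS]mxE.
by apply: eq_bigr => k _; rewrite mxE.
Qed.

Lemma rf_hat1 : rf_hat 1 = 1%:M. Proof. exact: subrK. Qed.

Lemma rf_mx1l a : rf_mx 1 *m rf_mx a = rf_mx a.
Proof. by rewrite -rf_mxM mul1r. Qed.
Lemma rf_mx1r a : rf_mx a *m rf_mx 1 = rf_mx a.
Proof. by rewrite -rf_mxM mulr1. Qed.

Lemma rf_mx_hat a : rf_mx 1 *m rf_hat a = rf_mx a.
Proof. by rewrite mulmxDr mulmxBr mulmx1 !rf_mx1l subrr add0r. Qed.

Lemma rf_hatM a b : rf_hat (a * b) = rf_hat a *m rf_hat b.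
Proof.
rewrite [rf_hat a *m _]mulmxDl mulmxBl mul1mx rf_mx_hat.
rewrite [rf_mx a *m _]mulmxDr mulmxBr mulmx1 rf_mx1r subrr add0r -rf_mxM.
by rewrite /rf_hat addrK.
Qed.

(** One-sided inverses of square matrices over a commutative ring are two-sided, and [rf_hat] is
    faithful. Applied to matrix algebras, this is the finiteness used to invert bordered
    matrices. *)
Lemma rf_mulV1 (a b : R) : a * b = 1 -> b * a = 1.
Proof.
move=> ab; have : rf_hat a *m rf_hat b = 1%:M by rewrite -rf_hatM ab rf_hat1.
move/mulmx1C; rewrite -rf_hatM -rf_hat1 => /addrI e.
by rewrite -[LHS]mulr1 -[RHS]mulr1 -[LHS]rf_colK rf_colM e -rf_colM rf_colK.
Qed.

Lemma rf_det a b : a * b = 1 -> invertible (\det (rf_hat a)).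
Proof.
move=> ab; have e : \det (rf_hat a) * \det (rf_hat b) = 1.
  by rewrite -det_mulmx -rf_hatM ab rf_hat1 det1.
by exists (\det (rf_hat b)); split=> //; rewrite mulrC.
Qed.

Lemma mul_inverse (B : pzRingType) (c : B) : invertible c ->
  c * inverse c = 1 /\ inverse c * c = 1.
Proof. by move=> h; have := xgetPex 0 h. Qed.

Lemma rf_mulV a : invertible (\det (rf_hat a)) -> a * rf_inv a = 1.
Proof.
move=> /mul_inverse[da _]; rewrite rf_combM -rf_mx_hat -mulmxA.
rewrite /rf_inv_col -scalemxAr mulmxA mul_mx_adj mul_scalar_mx scalerA.
by rewrite [inverse _ * _]mulrC da scale1r -rf_colM mul1r rf_colK.
Qed.

Hypotheses (F1 : F0 1) (FB : forall c d, F0 c -> F0 d -> F0 (c - d))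
           (FM : forall c d, F0 c -> F0 d -> F0 (c * d)).
Hypothesis FV : forall c, F0 c -> invertible c -> F0 (inverse c).

Let F00 : F0 0. Proof. by rewrite -(subrr 1); apply: FB. Qed.
Let FN c : F0 c -> F0 (- c).
Proof. by move=> hc; rewrite -[- c]add0r; apply: FB. Qed.
Let FD c d : F0 c -> F0 d -> F0 (c + d).
Proof. by move=> hc hd; rewrite -[d]opprK; apply/FB/FN. Qed.
Let F_sum (I : Type) (r : seq I) (Q : pred I) (F : I -> K) :
  (forall i, F0 (F i)) -> F0 (\sum_(i <- r | Q i) F i).
Proof. by move=> h; elim/big_ind: _. Qed.
Let F_sign n : F0 ((-1) ^+ n).
Proof.
by elim: n => [|n IHn]; rewrite ?expr0 // exprS; apply: FM => //; apply: FN.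
Qed.
Let F_det n (M : 'M[K]_n) : (forall i j, F0 (M i j)) -> F0 (\det M).
Proof.
move=> h; apply: F_sum => s; apply: FM; last by elim/big_ind: _.
exact: F_sign.
Qed.

(** The determinant and the cofactors of a rational element lie in [F0], and so does the inverse of
    the determinant by [FV]. *)
Lemma rf_inv_rat a : rat a -> invertible (\det (rf_hat a)) -> rat (rf_inv a).
Proof.
move=> ra ia; have hF i j : F0 (rf_hat a i j).
  rewrite !mxE; apply: FD; [apply: FB|].
  - by case: (i == j).
  - by apply: (@rf_om_rat _ _ _ _ D); apply: rf_ratM; [apply: rf_rat1|apply: rf_w_rat].
  - by apply: (@rf_om_rat _ _ _ _ D); apply: rf_ratM => //; apply: rf_w_rat.
apply: rf_rat_sum => j _; apply: rf_ratZ; last exact: rf_w_rat.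
rewrite !mxE; apply: FM; first by apply: FV => //; apply: F_det.
apply: F_sum => k; rewrite !mxE; apply: FM; last by apply: (@rf_om_rat _ _ _ _ D); apply: rf_rat1.
apply: FM; last first.
  by apply: F_det => i l; rewrite [row' _ _ i l]mxE [col' _ _ _ l]mxE; apply: hF.
exact: F_sign.
Qed.

End RationalForms.

Section Approximation.
Variables (K : comTopologicalRingType) (F0 : set K) (R : pzRingType).
Variables (kap : algebra_over K R) (D : rational_form F0 kap).
Local Notation rat := (rf_rat D).
Local Notation N := (rf_dim D).
Hypotheses (F1 : F0 1) (FB : forall c d, F0 c -> F0 d -> F0 (c - d))
           (FM : forall c d, F0 c -> F0 d -> F0 (c * d)).
Hypothesis FV : forall c, F0 c -> invertible c -> F0 (inverse c).
Hypothesis F_dense : dense F0.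
Hypothesis inv_continuous :
  {within [set x : K | invertible x], continuous (@inverse K)}.
Hypothesis units_open : open [set x : K | invertible x].

(** The entries of [rf_hat (g s)] are affine in [s], so its determinant is continuous and remains a
    unit near [t]; there Cramer's formula is continuous, and density provides a nearby [s] with
    entries in [F0]. The functions [ell] are affine in the coordinates of the inverse. *)
Lemma rational_approximation m n (t : 'rV[K]_m) (g0 G : R) (g_ : 'I_m -> R)
    (ell : 'I_n -> R -> K) (c : 'I_n -> K) (d : 'I_n -> 'I_N -> K)
    (U : set 'rV[K]_n) :
  let g (s : 'rV[K]_m) := g0 + \sum_k kap (s 0 k) * g_ k in
  (forall i w, ell i (rf_comb w) = c i + \sum_j w j 0 * d i j) ->
  rat g0 -> (forall k, rat (g_ k)) -> g t * G = 1 ->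
  nbhs (\row_i ell i G) U ->
  exists (s : 'rV[K]_m) (G' : R), [/\ forall k, F0 (s 0 k), rat G', g s * G' = 1, G' * g s = 1 &
                   U (\row_i ell i G')].
Proof.
move=> g ellE rg0 rg_ gG UG.
have hatE s i j : rf_hat D (g s) i j =
    rf_hat D g0 i j + \sum_k s 0 k * rf_mx D (g_ k) i j.
  rewrite /rf_hat /g rf_mxD rf_mx_comb addrA [LHS]mxE summxE; congr (_ + _).
  by apply: eq_bigr => k _; rewrite [LHS]mxE.
have chat i j : {for t, continuous (fun s => rf_hat D (g s) i j)}.
  under [X in {for t, continuous X}]eq_fun do rewrite hatE.
  apply: ctsD; first exact: cts_cst.
  apply: cts_sum => k; apply: ctsM; [exact: cts_entry|exact: cts_cst].
have ct : {for t, continuous (fun s => \det (rf_hat D (g s)))} by apply: cts_det.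
have it := rf_det D gG.
have GE : rf_inv D (g t) = G.
  rewrite -[LHS]mul1r -(rf_mulV1 D gG) -mulrA (rf_mulV it) mulr1 //.
pose v s := \row_i (c i + \sum_j rf_inv_col D (g s) j 0 * d i j).
have vE s : v s = \row_i ell i (rf_inv D (g s)).
  by apply/rowP => i; rewrite !mxE ellE.
have cv : {for t, continuous v}.
  apply: cts_row => i; under [X in {for t, continuous X}]eq_fun do rewrite mxE.
  apply: ctsD; first exact: cts_cst.
  apply: cts_sum => j; apply: ctsM; last exact: cts_cst.
  have E : (fun s => rf_inv_col D (g s) j 0) =
    fun s => inverse (\det (rf_hat D (g s))) *
             \sum_k \adj (rf_hat D (g s)) j k * rf_col D 1 k 0.
    by apply/funext => s; apply: rf_inv_colE.
  rewrite E; apply: ctsM; first exact: cts_inverse.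
  by apply: cts_sum => k; apply: ctsM; [exact: cts_adj|exact: cts_cst].
have Uv : nbhs (v t) U by rewrite vE GE.
have near_t := near_invertible (f := fun s => \det (rf_hat D (g s))) units_open it ct.
have near_v : \forall s \near t, U (v s) by apply: cv.
have [s [Us is_] Fs] := dense_row F_dense (filterI near_v near_t).
have rg : rat (g s).
  apply: rf_ratD => //; apply: rf_rat_sum => k _; exact: rf_ratZ.
have gG' := rf_mulV is_.
exists s, (rf_inv D (g s)); split=> //.
- exact: rf_inv_rat.
- exact: (rf_mulV1 D).
- by rewrite -vE.
Qed.
End Approximation.

Section MatrixForm.
Variables (K : comPzRingType) (F0 : set K) (R : pzRingType).
Variables (kap : algebra_over K R) (D : rational_form F0 kap) (n : nat).

Definition mx_scalar (c : K) : 'M[R]_n := (kap c)%:M.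
Fact mx_scalar_zmod : zmod_morphism mx_scalar.
Proof. by move=> c d; rewrite /mx_scalar rmorphB raddfB. Qed.
Fact mx_scalar_monoid : monoid_morphism mx_scalar.
Proof. by split=> [|c d]; rewrite /mx_scalar ?rmorph1 ?rmorphM ?scalar_mxM. Qed.
HB.instance Definition _ := GRing.isZmodMorphism.Build K 'M[R]_n mx_scalar
  mx_scalar_zmod.
HB.instance Definition _ := GRing.isMonoidMorphism.Build K 'M[R]_n mx_scalar
  mx_scalar_monoid.
Lemma mx_scalarE c (M : 'M[R]_n) i j : (mx_scalar c * M) i j = kap c * M i j.
Proof. by rewrite -mulmxE mul_scalar_mx mxE. Qed.
Fact mx_scalar_central c : central (mx_scalar c).
Proof.
move=> M; apply/matrixP => i j; rewrite mx_scalarE (alg_map_central kap).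
rewrite -mulmxE mxE (bigD1 j) //= big1 => [|k kj].
  by rewrite addr0 !mxE eqxx.
by rewrite !mxE (negPf kj) mulr0.
Qed.
Definition mx_algebra : algebra_over K 'M[R]_n := AlgebraOver mx_scalar_central.

Local Notation I := ('I_n * 'I_n * 'I_(rf_dim D))%type.
Let N := #|{: I}|.
Let mw (p : 'I_N) : 'M[R]_n :=
  let: (i, j, k) := enum_val p in (\matrix_(i', j') if (i' == i) && (j' == j) then rf_w k else 0).
Let mom (p : 'I_N) (M : 'M[R]_n) : K :=
  let: (i, j, k) := enum_val p in rf_om k (M i j).

(** Makes inversion and approximation available for matrices over the endomorphism ring; the
    coordinates of a matrix are those of its entries. *)
Lemma mx_rational_form : {DM : rational_form F0 mx_algebra |
  forall M, rf_rat DM M <-> forall i j, rf_rat D (M i j)}.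
Proof.
pose rat := [set M : 'M[R]_n | forall i j, rf_rat D (M i j)].
suff [DM DME] : {DM : rational_form F0 mx_algebra | rf_rat DM = rat}.
  by exists DM => M; rewrite DME.
have r1 : rat 1.
  move=> i j; rewrite mxE; case: (i == j); [exact: rf_rat1|exact: rf_rat0].
have rB M M' : rat M -> rat M' -> rat (M - M').
  by move=> h h' i j; rewrite !mxE; apply: rf_ratB.
have rM M M' : rat M -> rat M' -> rat (M * M').
  move=> h h' i j; rewrite -mulmxE mxE; apply: rf_rat_sum => k _; exact: rf_ratM.
have rZ c M : F0 c -> rat M -> rat (mx_algebra c * M).
  by move=> hc h i j; rewrite mx_scalarE; apply: rf_ratZ.
have oD p M M' : mom p (M + M') = mom p M + mom p M'.
  by rewrite /mom; case: (enum_val p) => -[i j] k; rewrite mxE rf_omD.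
have oZ p c M : mom p (mx_algebra c * M) = c * mom p M.
  by rewrite /mom; case: (enum_val p) => -[i j] k; rewrite mx_scalarE rf_omZ.
have bas M : M = \sum_p mx_algebra (mom p M) * mw p.
  pose G (q : I) := mx_algebra (rf_om q.2 (M q.1.1 q.1.2)) *
    \matrix_(i, j) if (i == q.1.1) && (j == q.1.2) then rf_w q.2 else 0.
  transitivity (\sum_(q : I) G q); last first.
    rewrite (eq_bigl (mem predT)) // (big_enum_val G); apply: eq_bigr => p _.
    by rewrite /G /mom /mw; case: (enum_val p) => -[i j] k.
  transitivity (\sum_(ij : 'I_n * 'I_n) \sum_k G (ij, k)); last first.
    by rewrite pair_bigA; apply: eq_bigr => -[ij k] _.
  apply/matrixP => a b; rewrite summxE (bigD1 (a, b)) //= [X in _ = _ + X]big1 => [|[i j] ij].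
    rewrite addr0 summxE [LHS](rf_basis D); apply: eq_bigr => k _.
    by rewrite mx_scalarE mxE !eqxx.
  rewrite summxE big1 // => k _; rewrite mx_scalarE mxE /=.
  case: ifP => [/andP[/eqP ai /eqP bj]|]; last by rewrite mulr0.
  by rewrite ai bj eqxx in ij.
have wr p : rat (mw p).
  rewrite /mw; case: (enum_val p) => -[i j] k i' j'; rewrite mxE.
  by case: ifP => _; [exact: rf_w_rat|exact: rf_rat0].
have or p M : rat M -> F0 (mom p M).
  by rewrite /mom; case: (enum_val p) => -[i j] k h; apply: rf_om_rat.
by exists (RationalForm r1 rB rM rZ oD oZ bas wr or).
Qed.
End MatrixForm.

(** * Density of isometries defined over F *)

Section Span.
Variables (K : comPzRingType) (R : pzRingType) (kap : algebra_over K R).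

Definition combinations (Q : set R) : set R :=
  [set a | exists m (t : 'rV[K]_m) (q : 'I_m -> R),
     (forall k, Q (q k)) /\ a = \sum_k kap (t 0 k) * q k].

Lemma combinations0 Q : combinations Q 0.
Proof.
by exists 0%N, 0, (fun=> 0); rewrite big_ord0; split=> // -[].
Qed.
Lemma combinationsZ (Q : set R) c a : Q a -> combinations Q (kap c * a).
Proof.
move=> Qa; exists 1%N, (const_mx c), (fun=> a); split=> //.
by rewrite big_ord1 mxE.
Qed.
Lemma combinationsD Q a b :
  combinations Q a -> combinations Q b -> combinations Q (a + b).
Proof.
move=> [m [t [q [Qq ->]]]] [m' [t' [q' [Qq' ->]]]].
exists (m + m')%N, (row_mx t t'), (fun k => match fintype.split k with inl i => q i | inr i => q' i end).
split=> [k|]; first by case: (fintype.split k).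
rewrite big_split_ord; congr (_ + _); apply: eq_bigr => k _.
  by rewrite row_mxEl -[lshift _ k]/(unsplit (inl k)) unsplitK.
by rewrite row_mxEr -[rshift _ k]/(unsplit (inr k)) unsplitK.
Qed.
Lemma combinations_sum Q (I : Type) (r : seq I) (P : pred I) (F : I -> R) :
  (forall i, P i -> combinations Q (F i)) -> combinations Q (\sum_(i <- r | P i) F i).
Proof. by move=> h; elim/big_ind: _ => //; [exact: combinations0|exact: combinationsD]. Qed.
End Span.

Lemma combinations_map (K : comPzRingType) (R R' : pzRingType)
  (kap : algebra_over K R) (kap' : algebra_over K R') (Q : set R) (Q' : set R')
  (g : R -> R') a :
  {morph g : x y / x + y} -> (forall c x, g (kap c * x) = kap' c * g x) ->
  (forall x, Q x -> Q' (g x)) -> combinations kap Q a -> combinations kap' Q' (g a).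
Proof.
move=> gD gZ QQ' [m [t [q [Qq ->]]]].
have g0 : g 0 = 0 by apply: (addrI (g 0)); rewrite -gD !addr0.
exists m, t, (fun k => g (q k)); split=> [k|]; first exact: QQ'.
by elim/big_rec2: _ => // k y1 y2 _ <-; rewrite gD gZ.
Qed.

Section Density.
Variables (K : comTopologicalRingType) (F0 : set K).
Hypotheses (F1 : F0 1) (FB : forall c d, F0 c -> F0 d -> F0 (c - d))
           (FM : forall c d, F0 c -> F0 d -> F0 (c * d)).
Hypothesis FV : forall c, F0 c -> invertible c -> F0 (inverse c).
Hypothesis F_dense : dense F0.
Hypothesis inv_continuous :
  {within [set x : K | invertible x], continuous (@inverse K)}.
Hypothesis units_open : open [set x : K | invertible x].

Variables (A B : pzRingType) (P : lmodType A^c) (Q : lmodType B^c).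
Variables (X0 : hspace P) (X : hspace Q) (ext : {rmorphism endo P -> endo Q}).
Local Notation star0 := (hs_star X0).
Local Notation star := (hs_star X).
Let U0 := hs_star_unitary X0.
Let U := hs_star_unitary X.
Hypothesis ext_inj : injective ext.
Hypothesis ext_star : forall e, star (ext e) = ext (star0 e).
Hypothesis ext_eps : hs_eps X = ext (hs_eps X0).

Variables (kap : algebra_over K (endo Q)) (D : rational_form F0 kap).
Hypothesis ratE : rf_rat D = range ext.
Hypothesis starZ : forall c e, star (kap c * e) = kap c * star e.
Hypothesis lamZ : forall c l, F0 c -> hs_lam X0 l ->
  exists2 l', hs_lam X0 l' & ext l' = kap c * ext l.
Hypothesis lam_comb : forall l, hs_lam X l ->
  combinations kap (ext @` hs_lam X0) l.

Lemma mulmx_inverse n (M M' : 'M[endo Q]_n) : M *m M' = 1%:M -> M' *m M = 1%:M.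
Proof.
have [DM _] := mx_rational_form D n.
exact: (rf_mulV1 DM).
Qed.

Local Notation param0_ n := (@mx_param _ star0 (hs_lam X0) n).
Local Notation param_ n := (@mx_param _ star (hs_lam X) n).

Let adj_ext m n (M : 'M_(m, n)) : adjmx star (map_mx ext M) = map_mx ext (adjmx star0 M).
Proof. by apply/matrixP => i j; rewrite !mxE ext_star. Qed.

(** A Lambda-matrix is its diagonal, treated by [lam_comb], plus V - V^* with V its strictly upper
    triangle. The map V -> V - V^* is K-linear and V is a combination of rational matrices. *)
Lemma mx_param_comb n (M : 'M[endo Q]_n) : param_ n M ->
  combinations (mx_algebra kap n) (map_mx ext @` param0_ n) M.
Proof.
move=> [Ms Md]; have [DM DME] := mx_rational_form D n.
pose diag r (e : endo Q) : 'M[endo Q]_n :=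
  \matrix_(i, j) if (i == r) && (j == r) then e else 0.
have [V VE] : exists V : 'M[endo Q]_n, forall i j, V i j = if (i < j)%N then M i j else 0.
  by exists (\matrix_(i, j) if (i < j)%N then M i j else 0) => i j; rewrite mxE.
have -> : M = \sum_r diag r (M r r) + (V - adjmx star V).
  apply/matrixP => i j; have Mji : star (M j i) = - M i j.
    by have := congr1 (fun N : 'M_n => N i j) Ms; rewrite !mxE.
  have skE : (V - adjmx star V) i j = V i j - star (V j i) by rewrite !mxE.
  rewrite [RHS]mxE summxE skE !VE; case: (ltngtP i j) => [ij|ij|/val_inj ij].
  - rewrite big1 => [|r _]; first by rewrite (invol0 U) add0r subr0.
    by rewrite mxE; case: ifP => // /andP[/eqP e /eqP e']; rewrite e e' ltnn in ij.
  - rewrite big1 => [|r _]; first by rewrite Mji !add0r opprK.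
    by rewrite mxE; case: ifP => // /andP[/eqP e /eqP e']; rewrite e e' ltnn in ij.
  rewrite -ij (bigD1 i) //= big1 => [|r ri].
    by rewrite mxE eqxx (invol0 U) subr0 !addr0.
  by rewrite mxE eq_sym (negPf ri).
apply: combinationsD.
  apply: combinations_sum => r _.
  apply: (combinations_map (g := diag r)) (lam_comb (Md r)).
  - by move=> x y; apply/matrixP => i j; rewrite !mxE; case: ifP; rewrite ?addr0.
  - move=> c x; apply/matrixP => i j; rewrite mx_scalarE !mxE.
    by case: ifP; rewrite ?mulr0.
  - move=> _ [l [ls lL] <-].
    exists (\matrix_(i, j) if (i == r) && (j == r) then l else 0); last first.
      by apply/matrixP => i j; rewrite !mxE; case: ifP; rewrite ?rmorph0.
    split=> [|i].
      by apply/matrixP => i j; rewrite !mxE andbC; case: ifP; rewrite ?(invol0 U0) ?oppr0.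
    by rewrite mxE; case: ifP => _ //; apply: (param0 U0).
pose skew (N : 'M[endo Q]_n) := N - adjmx star N.
rewrite -/(skew V); apply: (combinations_map (kap := mx_algebra kap n) (g := skew) (Q := rf_rat DM)).
- by move=> x y; rewrite /skew (adjmxD U); zmod.
- move=> c x; apply/matrixP => i j; rewrite mx_scalarE.
  have skE N : skew N i j = N i j - star (N j i) by rewrite !mxE.
  by rewrite !skE !mx_scalarE starZ mulrBr.
- move=> N /DME; rewrite ratE => rN.
  have [N0 N0E] : exists N0, map_mx ext N0 = N.
    have h (p : 'I_n * 'I_n) : exists e, ext e = N p.1 p.2.
      by have [e _ eE] := rN p.1 p.2; exists e.
    have [e eE] := choice h.
    by exists (\matrix_(i, j) e (i, j)); apply/matrixP => i j; rewrite !mxE eE.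
  exists (N0 - adjmx star0 N0); first exact: (mx_param_min U0).
  by rewrite /skew -N0E adj_ext map_mxB.
rewrite [V](rf_basis DM); apply: combinations_sum => j _.
exact/combinationsZ/rf_w_rat.
Qed.

Let rat_ext n (M : 'M[endo Q]_n) : (forall i j, rf_rat D (M i j)) ->
  exists M0, map_mx ext M0 = M.
Proof.
rewrite ratE => rM.
have h (p : 'I_n * 'I_n) : exists e, ext e = M p.1 p.2.
  by have [e _ eE] := rM p.1 p.2; exists e.
have [e eE] := choice h.
by exists (\matrix_(i, j) e (i, j)); apply/matrixP => i j; rewrite !mxE eE.
Qed.

Let map_ext_inj m n : injective (@map_mx _ _ ext m n).
Proof.
move=> M N e; apply/matrixP => i j; apply: ext_inj.
by have := congr1 (fun M' : 'M_(m, n) => M' i j) e; rewrite !mxE.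
Qed.

Let sum_row_ext : map_mx ext (sum_row P) = sum_row Q.
Proof. by rewrite !map_row_mx map_scalar_mx map_mx0 /= rmorph1. Qed.

Let mx11B (E : pzRingType) (M : 'M[E]_1) : (1%:M - M) 0 0 = 1 - M 0 0.
Proof. by rewrite !mxE. Qed.

Let scaled_param n c (M : 'M[endo Q]_n) : F0 c -> (map_mx ext @` param0_ n) M ->
  (map_mx ext @` param0_ n) (mx_algebra kap n c * M).
Proof.
move=> Fc [l [ls ld] <-].
have [i j|N NE] := rat_ext (M := mx_algebra kap n c * map_mx ext l).
  by rewrite mx_scalarE mxE; apply: rf_ratZ => //; rewrite ratE; exists (l i j).
have NijE i j : ext (N i j) = kap c * ext (l i j).
  by have := congr1 (fun M : 'M_n => M i j) NE; rewrite mx_scalarE !mxE.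
exists N => //; split=> [|i].
  apply/matrixP => i j; apply: ext_inj.
  have lji : star0 (l j i) = - l i j.
    by have := congr1 (fun M : 'M_n => M i j) ls; rewrite !mxE.
  by rewrite !mxE -ext_star NijE starZ ext_star lji !rmorphN NijE mulrN.
have [l' l'P l'E] := lamZ Fc (ld i).
by rewrite -(_ : l' = N i i) //; apply: ext_inj; rewrite NijE.
Qed.

Let sum_param n m (F : 'I_m -> 'M[endo Q]_n) :
  (forall k, (map_mx ext @` param0_ n) (F k)) ->
  (map_mx ext @` param0_ n) (\sum_k F k).
Proof.
move=> h; elim/big_ind: _ => // [|_ _ [l lP <-] [l' lP' <-]].
  by exists 0; [exact: (mx_param0 U0)|rewrite map_mx0].
by exists (l + l'); [exact: (mx_paramD U0)|rewrite map_mxD].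
Qed.

(** The matrix [g] of [phi] is approximated inside its affine family by rational parameters. The
    approximating matrices are still admissible over the base and have rational inverses, so
    [transformation_iso] over [P] turns them into isometries close to [phi]. *)
Lemma transformation_dense (phi : endo Q) V : transformation X phi ->
  nbhs (\row_i rf_om i phi : 'rV[K]_(rf_dim D)) V ->
  exists2 phi0, hs_iso X0 phi0 & V (\row_i rf_om i (ext phi0)).
Proof.
move=> [g [G [gG Gg gP phiE]]].
pose si := sum_row Q; pose sj := adjmx star si; pose s0 := sum_row P.
have sjE : sj = map_mx ext (adjmx star0 s0) by rewrite -adj_ext sum_row_ext.
pose e0 := adjmx star0 s0 *m (hs_eps X0)%:M *m s0.
have e0E : adjmx star si *m (hs_eps X)%:M *m si = map_mx ext e0.
  by rewrite /e0 !map_mxM map_scalar_mx sum_row_ext -adj_ext sum_row_ext ext_eps.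
have [m [t [q [qP qE]]]] := mx_param_comb gP.
(* [g] is the member with parameter [t] of an affine family whose members with parameters in [F0]
   come from admissible matrices over [P]. *)
have gE : g = map_mx ext e0 + \sum_k mx_algebra kap _ (t 0 k) * q k.
  by rewrite -qE -/si e0E addrC subrK.
have [DM DME] := mx_rational_form D ((1 + 1) + (1 + 1)).
pose tr (M : 'M[endo Q]_((1 + 1) + (1 + 1))) : endo Q :=
  1 - (si *m M *m sj) 0 0.
have phiE' : phi = tr G.
  by have := congr1 (fun M : 'M_1 => M 0 0) phiE; rewrite mx11B [LHS]mxE.
rewrite phiE' => Vn.
have ratD e : rf_rat D (ext e) by rewrite ratE; exists e.
have := @rational_approximation K F0 _ _ DM F1 FB FM FV F_dense inv_continuous
  units_open m _ t (map_mx ext e0) G q (fun i M => rf_om i (tr M))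
  (fun i => rf_om i 1)
  (fun i j => rf_om i (- (si *m rf_w j *m sj) 0 0)) V.
case=> //.
- move=> i v; rewrite /tr rf_omD; congr (_ + _).
  rewrite /rf_comb mulmx_sumr mulmx_suml summxE -sumrN rf_om_sum.
  apply: eq_bigr => j _; rewrite -rf_omZ; congr (rf_om _ _).
  have c_row (c : K) (M : 'M[endo Q]_((1 + 1) + (1 + 1))) :
      si *m (mx_algebra kap _ c * M) *m sj = kap c *: (si *m M *m sj).
    rewrite -mulmxE mul_scalar_mx !scalemxAl; congr (_ *m sj).
    apply/matrixP => k l; rewrite [LHS]mxE [RHS]mxE; apply: eq_bigr => r _.
    by rewrite [(kap c *: M) r l]mxE [(kap c *: si) k r]mxE !mulrA (alg_map_central kap).
  by rewrite c_row mxE mulrN.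
- by apply/DME => i j; rewrite mxE.
- by move=> k; case: (qP k) => l _ <-; apply/DME => i j; rewrite mxE.
- by rewrite -gE.
move=> s [G' [sF /DME rG gG' Gg' VG']].
have [G0 G0E] := rat_ext rG.
have lam_s : exists2 l, param0_ _ l & map_mx ext l = \sum_k mx_algebra kap _ (s 0 k) * q k.
  have [l lP lE] := sum_param (fun k => scaled_param (sF k) (qP k)).
  by exists l.
have [l lP lE] := lam_s.
pose g0 := e0 + l.
have g0E : map_mx ext g0 = map_mx ext e0 + \sum_k mx_algebra kap _ (s 0 k) * q k.
  by rewrite map_mxD lE.
have gG0 : g0 *m G0 = 1%:M.
  by apply: map_ext_inj; rewrite map_mxM g0E G0E map_scalar_mx rmorph1.
have Gg0 : G0 *m g0 = 1%:M.
  by apply: map_ext_inj; rewrite map_mxM g0E G0E map_scalar_mx rmorph1.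
pose phi0 := (1%:M - s0 *m G0 *m adjmx star0 s0) 0 0.
have phi0E : 1%:M - s0 *m G0 *m adjmx star0 s0 = phi0%:M.
  by apply/matrixP => i j; rewrite !ord1 [RHS]mxE.
have := transformation_iso U0 (Ep := (hs_eps X0)%:M) (i := s0) _ gG0 Gg0.
rewrite phi0E; case.
- by rewrite (adjmx_scalar U0) -raddfD hs_eps_star.
- by rewrite /g0 addrC addKr.
have sc_inj (a b : endo P) : a%:M = b%:M :> 'M_1 -> a = b.
  by move/(congr1 (fun M : 'M_1 => M 0 0)); rewrite !mxE.
rewrite !(adjmx_scalar U0) -!scalar_mxM => /sc_inj i1 /sc_inj i2.
rewrite -raddfB => -[_ /(_ 0)]; rewrite mxE => i3.
exists phi0; first by split.
suff -> : ext phi0 = tr G' by [].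
rewrite /phi0 /tr !mx11B rmorphB rmorph1; congr (_ - _).
by rewrite -G0E sjE /si -sum_row_ext -!map_mxM [RHS]mxE.
Qed.
End Density.

(** * Scalar extension of unitary rings and quadratic spaces *)

Lemma tens0l (F T : comPzRingType) (j : {rmorphism F -> T}) (M : lmodType F) t :
  tens j (0 : M) t = 0.
Proof. by apply: (addrI (tens j 0 t)); rewrite -tensDl !addr0. Qed.

Section ExtUnitary.
Variables (F K : comPzRingType) (j : {rmorphism F -> K}).
Variables (A : pzRingType) (iota : algebra_over F A).
Variables (sigma : A -> A) (u : A) (Lambda : set A).
Hypothesis unitaryA : unitary_algebra sigma u Lambda iota.
Local Notation AK := (ext_ring j iota).
Local Notation sigmaK := (ext_invol j iota sigma).
Local Notation uK := (ext_unit j iota u).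
Local Notation LambdaK := (ext_param j iota Lambda).
Local Notation tA a t := (tens j (a : alg_module iota) t : AK).

Let uA : unitary_ring sigma u Lambda. Proof. by case: unitaryA. Qed.
Let sigmaZ c a : sigma (iota c * a) = iota c * sigma a.
Proof. by case: unitaryA. Qed.

Let sE := ext_involE j unitaryA.
Let sD a b : sigmaK (a + b) = sigmaK a + sigmaK b.
Proof.
by apply: tens_mapD => c x y; rewrite (involD uA); congr (_ + _); apply: sigmaZ.
Qed.
Let s0 : sigmaK 0 = 0.
Proof. by apply: (addrI (sigmaK 0)); rewrite -sD !addr0. Qed.

Lemma ext_involution : involution sigmaK.
Proof.
split=> // [a b||a].
- elim/tensor_ind: a => [|a a' ha ha'|a t]; first by rewrite !(mul0r, mulr0, s0).
    by rewrite sD mulrDl mulrDr sD ha ha'.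
  elim/tensor_ind: b => [|b b' hb hb'|b s]; first by rewrite !(mul0r, mulr0, s0).
    by rewrite sD mulrDl mulrDr sD hb hb'.
  by rewrite ext_mulE !sE ext_mulE (involM uA) mulrC.
- by rewrite -[1]/(tA 1 1) sE (invol1 uA).
- elim/tensor_ind: a => [|a a' ha ha'|a t]; first by rewrite !s0.
    by rewrite !sD ha ha'.
  by rewrite !sE (involK uA).
Qed.

Lemma ext_param0 : LambdaK 0.
Proof. by exists [::]; rewrite big_nil. Qed.
Lemma ext_paramD a b : LambdaK a -> LambdaK b -> LambdaK (a + b).
Proof.
move=> [s [hs ->]] [s' [hs' ->]]; exists (s ++ s'); rewrite big_cat; split=> // p.
by rewrite mem_cat => /orP[/hs|/hs'].
Qed.
Lemma ext_param_tens a t : Lambda a -> LambdaK (tA a t).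
Proof.
by move=> la; exists [:: (a, t)]; rewrite big_seq1; split=> // p; rewrite inE => /eqP ->.
Qed.
Lemma ext_param_ind (Q : AK -> Prop) : Q 0 -> (forall a b, Q a -> Q b -> Q (a + b)) ->
  (forall a t, Lambda a -> Q (tA a t)) -> forall a, LambdaK a -> Q a.
Proof.
move=> Q0 QD Qt _ [s [hs ->]]; rewrite big_seq; elim/big_ind: _ => // p ps.
exact/Qt/hs.
Qed.
Lemma ext_paramN a : LambdaK a -> LambdaK (- a).
Proof.
elim/ext_param_ind: a / => [|a b ha hb|a t la].
- by rewrite oppr0; apply: ext_param0.
- by rewrite opprD; apply: ext_paramD.
have -> : - tA a t = tA (- a) t.
  by apply: (addrI (tA a t)); rewrite subrr -tensDl subrr tens0l.
by apply/ext_param_tens/(paramN uA).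
Qed.

Let uKc : central uK.
Proof.
move=> a; elim/tensor_ind: a => [|a b ha hb|a t]; first by rewrite mulr0 mul0r.
  by rewrite mulrDr mulrDl ha hb.
by rewrite !ext_mulE (u_central uA) mul1r mulr1.
Qed.

Let ext_param_min a : LambdaK (a - sigmaK a * uK).
Proof.
elim/tensor_ind: a => [|a b ha hb|a t].
- by rewrite s0 mul0r subr0; apply: ext_param0.
- by rewrite sD mulrDl opprD addrACA; apply: ext_paramD.
have -> : tA a t - sigmaK (tA a t) * uK = tA (a - sigma a * u) t.
  rewrite sE ext_mulE mulr1; apply: (addIr (tA (sigma a * u) t)).
  by rewrite subrK -tensDl subrK.
exact/ext_param_tens/(param_min uA).
Qed.

Let ext_param_max a : LambdaK a -> sigmaK a * uK = - a.
Proof.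
elim/ext_param_ind: a / => [|a b ha hb|a t la].
- by rewrite s0 mul0r oppr0.
- by rewrite sD mulrDl ha hb opprD.
rewrite sE ext_mulE mulr1 (param_max uA la).
by apply: (addrI (tA a t)); rewrite -tensDl !subrr tens0l.
Qed.

Let ext_param_conj a x : LambdaK x -> LambdaK (sigmaK a * x * a).
Proof.
have [iD iM i1 iK] := ext_involution.
elim/tensor_ind: a x => [|a b ha hb|a t] x lx.
- by rewrite mulr0; apply: ext_param0.
- rewrite sD !mulrDl !mulrDr.
  (* The two cross terms in the conjugate by a sum make up a minimal element. *)
  have e : sigmaK b * x * a = - (sigmaK (sigmaK a * x * b) * uK).
    have e1 : sigmaK x * (a : AK) * uK = - (x * (a : AK)).
      by rewrite -mulrA -uKc mulrA ext_param_max // mulNr.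
    by rewrite !iM iK -[_ * uK]mulrA e1 mulrN opprK mulrA.
  have -> : sigmaK a * x * a + sigmaK a * x * b + (sigmaK b * x * a + sigmaK b * x * b)
      = sigmaK a * x * a + sigmaK b * x * b +
        (sigmaK a * x * b - sigmaK (sigmaK a * x * b) * uK) by rewrite -e; zmod.
  apply: ext_paramD; last exact: ext_param_min.
  by apply: ext_paramD; [exact: ha|exact: hb].
elim/ext_param_ind: x / lx => [|x y hx hy|x s lx].
- by rewrite mulr0 mul0r; apply: ext_param0.
- by rewrite mulrDr mulrDl; apply: ext_paramD.
by rewrite sE !ext_mulE; apply/ext_param_tens/(param_conj uA).
Qed.

Lemma ext_unitary_ring : unitary_ring sigmaK uK LambdaK.
Proof.
split; [exact: ext_involution|exact: uKc| |split].
- by rewrite sE ext_mulE (mulVu uA) mulr1.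
- split; first exact: ext_param0.
  by move=> a b la lb; apply/ext_paramD/ext_paramN.
- by move=> _ [a _ <-].
- exact: ext_param_max.
- by move=> a x; apply: ext_param_conj.
Qed.
End ExtUnitary.

Lemma tens0r (F T : comPzRingType) (j : {rmorphism F -> T}) (M : lmodType F) (m : M) :
  tens j m 0 = 0.
Proof. by apply: (addrI (tens j m 0)); rewrite -tensDr !addr0. Qed.

Lemma sum_diag (V : zmodType) n (G : 'I_n -> 'I_n -> V) :
  \sum_k \sum_l G k l =
  \sum_k G k k + \sum_(k < n) \sum_(l < n | (k < l)%N) (G k l + G l k).
Proof.
transitivity (\sum_(k < n) (G k k + \sum_(l < n | (k < l)%N) G k l
                + \sum_(l < n | (l < k)%N) G k l)).
  apply: eq_bigr => k _; rewrite (bigD1 k) //= -addrA; congr (_ + _).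
  rewrite (bigID (fun l : 'I_n => (k < l)%N)) /=; congr (_ + _).
    by apply: eq_bigl => l; rewrite neq_ltn orbC; case: ltngtP.
  by apply: eq_bigl => l; rewrite neq_ltn -leqNgt; case: ltngtP.
rewrite !big_split /= -addrA; congr (_ + _).
under [X in _ = X]eq_bigr do rewrite big_split /=.
by rewrite big_split /=; congr (_ + _); rewrite (exchange_big_dep predT).
Qed.

Section RankOne.
Variables (A : pzRingType) (P : lmodType A^c) (X : hspace P).
Local Notation h := (hs_h X).
Local Notation sigma := (hs_inv X).
Local Notation u := (hs_u X).
Local Notation Lambda := (hs_param X).
Let uA := hs_unitary X.

Definition rank_one_fun (y y' : P) (a : A) (z : P) : P := y *> (a * h y' z).
Fact rank_one_funD y y' a z w :
  rank_one_fun y y' a (z + w) = rank_one_fun y y' a z + rank_one_fun y y' a w.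
Proof. by rewrite /rank_one_fun (hDr X) mulrDr rscaleDr. Qed.
Fact rank_one_funZ y y' a z b :
  rank_one_fun y y' a (z *> b) = rank_one_fun y y' a z *> b.
Proof. by rewrite /rank_one_fun (hZr X) mulrA rscaleA. Qed.
Definition rank_one y y' a : endo P :=
  make_endo (rank_one_funD y y' a) (@rank_one_funZ y y' a).
Lemma rank_oneE y y' a z : rank_one y y' a z = y *> (a * h y' z).
Proof. by []. Qed.
Lemma rank_oneD y y' a b : rank_one y y' (a + b) = rank_one y y' a + rank_one y y' b.
Proof. by apply/endoP => z; rewrite endoD !rank_oneE mulrDl rscaleDr. Qed.
Lemma rank_one0 y y' : rank_one y y' 0 = 0.
Proof. by apply: (addrI (rank_one y y' 0)); rewrite -rank_oneD !addr0. Qed.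
Lemma rank_oneN y y' a : rank_one y y' (- a) = - rank_one y y' a.
Proof. by apply: (addrI (rank_one y y' a)); rewrite -rank_oneD !subrr rank_one0. Qed.
(** The factor [sigma u] makes [a] the coefficient of the associated sesquilinear form, so that [a]
    in Lambda yields a Lambda-operator ([rank_one_param]). *)
Lemma h_rank_one x z y y' a :
  h x (rank_one y y' (sigma u * a) z) = sigma (h y x) * a * h y' z.
Proof. by rewrite rank_oneE (hZr X) (hCV X) !mulrA. Qed.
Lemma rank_one_star y y' a : hs_star X (rank_one y y' (sigma u * a)) =
  rank_one y' y (sigma u * (sigma a * u)).
Proof.
apply/endoP => w; apply: (h_injr (X := X)) => z; rewrite hs_starEr.
rewrite -[LHS](hC X) !h_rank_one !(involM uA) (involK uA) -!mulrA.
by rewrite (u_central uA).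
Qed.
Lemma rank_one_param y a : Lambda a -> hs_lam X (rank_one y y (sigma u * a)).
Proof.
move=> la; split=> [|z]; last by rewrite h_rank_one; apply: (param_conj uA).
by rewrite rank_one_star (param_max uA la) mulrN rank_oneN.
Qed.
End RankOne.

Section ExtSpace.
Variables (F K : comPzRingType) (j : {rmorphism F -> K}).
Variables (A : pzRingType) (iota : algebra_over F A).
Variables (sigma : A -> A) (u : A) (Lambda : set A).
Hypothesis unitaryA : unitary_algebra sigma u Lambda iota.
Variables (P : lmodType A^c) (f : P -> P -> A).
Hypothesis fd : dual_hom sigma f.
Local Notation h := (hermitian_form sigma u f).
Variables (n : nat) (x_ y_ : 'I_n -> P).
Hypothesis basis : forall z, z = \sum_k x_ k *> h (y_ k) z.

Local Notation AK := (ext_ring j iota).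
Local Notation PK := (ext_module j iota P).
Local Notation sigmaK := (ext_invol j iota sigma).
Local Notation uK := (ext_unit j iota u).
Local Notation LambdaK := (ext_param j iota Lambda).
Local Notation fK := (ext_form j iota f).
Local Notation tA a t := (tens j (a : alg_module iota) t : AK).
Local Notation tP x t := (tens j (x : res_module iota P) t : PK).

Let uA : unitary_ring sigma u Lambda. Proof. by case: unitaryA. Qed.
Let UK := ext_unitary_ring j unitaryA.
Let sE := ext_involE j unitaryA.
Let tPD (x y : P) t : tP (x + y) t = tP x t + tP y t.
Proof. exact: (@tensDl F K j (res_module iota P)). Qed.
Let fE x k y k' : fK (tP x k) (tP y k') = tA (f x y) (k * k').
Proof. exact: (ext_formE j unitaryA). Qed.

Definition base_space : hspace P := Hspace uA fd basis.
Local Notation X0 := base_space.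

Let f_bilinear : bilinear_map (f : res_module iota P -> res_module iota P -> alg_module iota).
Proof.
case: unitaryA => _ sZ _; case: fd => fr fD fZ; split=> [z c x1 x2|z c x1 x2].
- rewrite -[c *: x1]/((x1 : P) *> iota c) fD fZ /= /dual_scale.
  by have := sZ c 1; rewrite !(invol1 uA, mulr1) => ->.
- rewrite -[c *: x1]/((x1 : P) *> iota c) (fr z).1 (fr z).2.
  by rewrite -alg_map_central.
Qed.
Let fDl (x y z : PK) : fK (x + y) z = fK x z + fK y z.
Proof. exact: tens_map2Dl. Qed.
Let fDr (x y z : PK) : fK z (x + y) = fK z x + fK z y.
Proof. exact: tens_map2Dr. Qed.
Let f0l z : fK 0 z = 0. Proof. by apply: (addrI (fK 0 z)); rewrite -fDl !addr0. Qed.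
Let f0r z : fK z 0 = 0. Proof. by apply: (addrI (fK z 0)); rewrite -fDr !addr0. Qed.

Lemma ext_dual_hom : dual_hom sigmaK fK.
Proof.
have fZr x y a : fK x (y *> a) = fK x y * a.
  elim/tensor_ind: x => [|x x' hx hx'|x s]; first by rewrite !f0l mul0r.
    by rewrite !fDl mulrDl hx hx'.
  elim/tensor_ind: y => [|y y' hy hy'|y t]; first by rewrite rscale0l !f0r mul0r.
    by rewrite rscaleDl !fDr mulrDl hy hy'.
  elim/tensor_ind: a => [|a a' ha ha'|a r]; first by rewrite rscale0 !f0r mulr0.
    by rewrite rscaleDr !fDr mulrDr ha ha'.
  by case: fd => /(_ x)[_ fZ] _ _; rewrite ext_rscaleE !fE ext_mulE fZ mulrA.
split=> [x|x y|x a].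
- by split=> [y z|y a]; [exact: fDr|exact: fZr].
- by apply/funext => z; apply: fDl.
apply/funext => y; rewrite /dual_scale.
elim/tensor_ind: x => [|x x' hx hx'|x s]; first by rewrite rscale0l !f0l mulr0.
  by rewrite rscaleDl !fDl mulrDr hx hx'.
elim/tensor_ind: y => [|y y' hy hy'|y t]; first by rewrite !f0r mulr0.
  by rewrite !fDr mulrDr hy hy'.
elim/tensor_ind: a => [|a a' ha ha'|a r].
- by rewrite rscale0 f0l (invol0 UK) mul0r.
- by rewrite rscaleDr !fDl (involD UK) mulrDl ha ha'.
case: fd => _ _ fZ; rewrite ext_rscaleE sE !fE ext_mulE fZ /dual_scale.
by rewrite -mulrA [s * _]mulrC -mulrA [t * s]mulrC.
Qed.

Lemma ext_hermitianE x s y t : hermitian_form sigmaK uK fK (tP x s) (tP y t) =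
  tA (h x y) (s * t).
Proof.
rewrite /hermitian_form /form_transpose /omega /= !fE sE ext_mulE mulr1.
by rewrite [t * s]mulrC -tensDl.
Qed.

Let hK := hermitian_form sigmaK uK fK.
Let hKDr x y z : hK z (x + y) = hK z x + hK z y.
Proof.
rewrite /hK /hermitian_form /form_transpose /omega /= fDr fDl (involD UK) mulrDl.
by rewrite addrACA.
Qed.
Let hK0r z : hK z 0 = 0. Proof. by apply: (addrI (hK z 0)); rewrite -hKDr !addr0. Qed.

Lemma ext_basis z : z = \sum_k (tP (x_ k) 1) *> hermitian_form sigmaK uK fK (tP (y_ k) 1) z.
Proof.
elim/tensor_ind: z => [|z z' hz hz'|z t].
- by rewrite big1 // => k _; rewrite -/hK hK0r rscale0.
- rewrite {1}hz {1}hz' -big_split; apply: eq_bigr => k _.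
  by rewrite -/hK hKDr rscaleDr.
have tP_sum m (G : 'I_m -> P) : tP (\sum_k G k) t = \sum_k tP (G k) t.
  elim/big_rec2: _ => [|k a b _ <-]; first exact: (@tens0l F K j (res_module iota P)).
  exact: tPD.
rewrite {1}[z]basis tP_sum; apply: eq_bigr => k _.
by rewrite ext_hermitianE mul1r ext_rscaleE mul1r.
Qed.

Definition ext_space : hspace PK := Hspace UK ext_dual_hom ext_basis.
Local Notation XK := ext_space.

Lemma ext_hE x s y t : hs_h XK (tP x s) (tP y t) = tA (hs_h X0 x y) (s * t).
Proof. exact: ext_hermitianE. Qed.

Lemma ext_endoE (e : endo P) x t : ext_endo j iota e (tP x t) = tP (e x) t.
Proof. exact: ext_mapE. Qed.

Fact ext_endo_zmod : zmod_morphism (ext_endo j iota : endo P -> endo PK).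
Proof.
move=> e e'; apply/endoP => z; rewrite endoB.
elim/tensor_ind: z => [|z z' hz hz'|z t]; first by rewrite !linear0 addr0.
  by rewrite !linearD hz hz' ?opprD addrACA.
rewrite !ext_endoE endoB; apply: (addIr (tP (e' z) t)); rewrite subrK.
by rewrite -tPD subrK.
Qed.
Fact ext_endo_monoid : monoid_morphism (ext_endo j iota : endo P -> endo PK).
Proof.
split=> [|e e']; apply/endoP => z.
  elim/tensor_ind: z => [|z z' hz hz'|z t]; first by rewrite !linear0.
    by rewrite !linearD hz hz'.
  by rewrite ext_endoE.
elim/tensor_ind: z => [|z z' hz hz'|z t]; first by rewrite !linear0.
  by rewrite !linearD hz hz'.
by rewrite endoM !ext_endoE.
Qed.
Definition ext_endo_ring : endo P -> endo PK := ext_endo j iota.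
HB.instance Definition _ := GRing.isZmodMorphism.Build (endo P) (endo PK)
  ext_endo_ring ext_endo_zmod.
HB.instance Definition _ := GRing.isMonoidMorphism.Build (endo P) (endo PK)
  ext_endo_ring ext_endo_monoid.
Local Notation ext := ext_endo_ring.

Lemma ext_adjoint e z w : hs_h XK z (ext (hs_star X0 e) w) = hs_h XK (ext e z) w.
Proof.
elim/tensor_ind: z => [|z z' hz hz'|z t].
- by rewrite linear0 !(h0l XK).
- by rewrite linearD !(hDl XK) hz hz'.
elim/tensor_ind: w => [|w w' hw hw'|w s].
- by rewrite linear0 !(h0r XK).
- by rewrite linearD !(hDr XK) hw hw'.
by rewrite !ext_endoE !ext_hE hs_starEr.
Qed.

Lemma ext_star e : hs_star XK (ext e) = ext (hs_star X0 e).
Proof.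
by apply/endoP => w; apply: (h_injr (X := XK)) => z; rewrite hs_starEr ext_adjoint.
Qed.

Lemma ext_eps : hs_eps XK = ext (hs_eps X0).
Proof.
apply/endoP => w; apply: (h_injr (X := XK)) => z; rewrite hs_epsE.
elim/tensor_ind: z => [|z z' hz hz'|z t].
- by rewrite (h0l XK) -[LHS]/(fK 0 w) f0l.
- by rewrite (hDl XK) -hz -hz'; apply: fDl.
elim/tensor_ind: w => [|w w' hw hw'|w s].
- by rewrite linear0 (h0r XK); apply: f0r.
- by rewrite linearD (hDr XK) -hw -hw'; apply: fDr.
by rewrite ext_endoE ext_hE hs_epsE; apply: fE.
Qed.


Lemma ext_adjointE e z w : hs_h XK z (hs_star XK e w) = hs_h XK (e z) w.
Proof. exact: hs_starEr. Qed.

Definition endo_scalar_fun (c : K) (z : PK) : PK := z *> ext_scalar j iota c.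
Fact endo_scalar_funD c z w :
  endo_scalar_fun c (z + w) = endo_scalar_fun c z + endo_scalar_fun c w.
Proof. exact: rscaleDl. Qed.
Fact endo_scalar_funZ c z (a : AK) :
  endo_scalar_fun c (z *> a) = endo_scalar_fun c z *> a.
Proof. by rewrite /endo_scalar_fun !rscaleA ext_scalar_central. Qed.
Definition endo_scalar (c : K) : endo PK :=
  make_endo (endo_scalar_funD c) (@endo_scalar_funZ c).
Fact endo_scalar_zmod : zmod_morphism endo_scalar.
Proof.
by move=> c d; apply/endoP => z; rewrite endoB /= /endo_scalar_fun rmorphB rscaleBr.
Qed.
Fact endo_scalar_monoid : monoid_morphism endo_scalar.
Proof.
split=> [|c d]; apply/endoP => z; rewrite /= /endo_scalar_fun.
  by rewrite rmorph1 rscale1.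
by rewrite rscaleA -rmorphM mulrC.
Qed.
HB.instance Definition _ := GRing.isZmodMorphism.Build K (endo PK)
  endo_scalar endo_scalar_zmod.
HB.instance Definition _ := GRing.isMonoidMorphism.Build K (endo PK)
  endo_scalar endo_scalar_monoid.
Fact endo_scalar_central c : central (endo_scalar c).
Proof.
move=> e; apply/endoP => z; rewrite !endoM /= /endo_scalar_fun.
by rewrite linear_rscale.
Qed.
Definition endo_algebra : algebra_over K (endo PK) := AlgebraOver endo_scalar_central.
Local Notation kap := endo_algebra.
Local Notation sc := (ext_scalar j iota).

Lemma endo_algebraE c (e : endo PK) z : (kap c * e) z = e z *> sc c.
Proof. by []. Qed.

Variables (m : nat) (alpha : 'I_m -> A) (beta : 'I_m -> A -> F).
Hypotheses (betaD : forall l (a b : A), beta l (a + b) = beta l a + beta l b)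
  (betaZ : forall l c (a : A), beta l (iota c * a) = c * beta l a)
  (alphaE : forall a, a = \sum_l iota (beta l a) * alpha l).
Hypothesis j_inj : injective j.

Definition ext_coord l : AK -> K := 
  tens_lift (fun (a : alg_module iota) t => j (beta l a) * t).
Let coord_balanced l : balanced j (fun (a : alg_module iota) t => j (beta l a) * t).
Proof.
split=> [a b t|a t t'|c a t].
- by rewrite betaD rmorphD mulrDl.
- by rewrite mulrDr.
- by rewrite -[c *: a]/(iota c * a) betaZ rmorphM mulrCA mulrA.
Qed.
Lemma ext_coordD l (a b : AK) : ext_coord l (a + b) = ext_coord l a + ext_coord l b.
Proof. exact: tens_liftD. Qed.
Lemma ext_coordE l a t : ext_coord l (tA a t) = j (beta l a) * t.
Proof. exact: tens_liftE. Qed.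
Let coord0 l : ext_coord l 0 = 0.
Proof. by apply: (addrI (ext_coord l 0)); rewrite -ext_coordD !addr0. Qed.
Lemma ext_coordZ l c (a : AK) : ext_coord l (sc c * a) = c * ext_coord l a.
Proof.
elim/tensor_ind: a => [|a b ha hb|a t]; first by rewrite mulr0 !coord0 mulr0.
  by rewrite mulrDr !ext_coordD mulrDr ha hb.
by rewrite ext_mulE mul1r !ext_coordE mulrCA.
Qed.
Lemma ext_coord_basis (a : AK) : a = \sum_l sc (ext_coord l a) * tA (alpha l) 1.
Proof.
elim/tensor_ind: a => [|a b ha hb|a t].
- by rewrite big1 // => l _; rewrite coord0 rmorph0 mul0r.
- rewrite {1}ha {1}hb -big_split; apply: eq_bigr => l _.
  by rewrite ext_coordD rmorphD mulrDl.
have tA_sum (G : 'I_m -> A) : tA (\sum_k G k) t = \sum_k tA (G k) t.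
  elim/big_rec2: _ => [|k a' b _ <-]; first exact: (@tens0l F K j (alg_module iota)).
  exact: (@tensDl F K j (alg_module iota)).
rewrite {1}[a]alphaE tA_sum; apply: eq_bigr => l _.
rewrite ext_coordE ext_mulE mul1r mulr1 -(@tensZ F K j (alg_module iota)).
by [].
Qed.

(** The coordinates of a in the dual basis of A over F can be read off from a tensor 1, because F
    embeds in K. *)
Lemma tensA_inj (a b : A) : tA a 1 = tA b 1 -> a = b.
Proof.
move=> e; rewrite [a]alphaE [b]alphaE; apply: eq_bigr => l _.
congr (iota _ * _); apply: j_inj.
by have := congr1 (ext_coord l) e; rewrite !ext_coordE !mulr1.
Qed.

Lemma ext_endo_inj : injective ext.
Proof.
move=> e e' ee'; apply/endoP => z; apply: (h_injr (X := X0)) => w.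
apply: tensA_inj; have := congr1 (fun g : endo PK => hs_h XK (tP w 1) (g (tP z 1))) ee'.
by rewrite /= !ext_endoE !ext_hE !mulr1.
Qed.

Lemma ext_rank_one y y' a t : kap t * ext (rank_one X0 y y' a) =
  rank_one XK (tP y 1) (tP y' 1) (tA a t).
Proof.
apply/endoP => z; rewrite endo_algebraE rank_oneE.
elim/tensor_ind: z => [|z w hz hw|z s].
- by rewrite linear0 rscale0l (h0r XK) mulr0 rscale0.
- by rewrite linearD rscaleDl hz hw (hDr XK) -rscaleDr -mulrDr.
rewrite ext_endoE ext_rscaleE ext_hE ext_mulE ext_rscaleE rank_oneE !mul1r.
by rewrite rscale1 mulrC.
Qed.

Definition scale_fun (c : F) (e : endo P) (z : P) : P := e z *> iota c.
Fact scale_funD c e z w : scale_fun c e (z + w) = scale_fun c e z + scale_fun c e w.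
Proof. by rewrite /scale_fun linearD rscaleDl. Qed.
Fact scale_funZ c e z (a : A) : scale_fun c e (z *> a) = scale_fun c e z *> a.
Proof. by rewrite /scale_fun linear_rscale !rscaleA (alg_map_central iota). Qed.
Definition scale_endo c e : endo P := make_endo (scale_funD c e) (@scale_funZ c e).
Lemma scale_endoE c e z : scale_endo c e z = e z *> iota c.
Proof. by []. Qed.
Lemma ext_scale_endo c e : ext (scale_endo c e) = kap (j c) * ext e.
Proof.
apply/endoP => z; rewrite endo_algebraE.
elim/tensor_ind: z => [|z w hz hw|z s].
- by rewrite !linear0 rscale0l.
- by rewrite !linearD rscaleDl hz hw.
rewrite !ext_endoE ext_rscaleE rscale1 mulrC.
exact: (@tensZ F K j (res_module iota P)).
Qed.

Let I := ('I_n * 'I_n * 'I_m)%type.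
Let F0 : set K := range j.

(** Rank-one operators built from [x_], [y_] and [alpha] are defined over F. Together with the
    K-coordinates of the entries h(y_k, e x_k') they form a dual basis of the endomorphism ring of
    P_K. *)
Lemma ext_rational_form : {D : rational_form F0 kap | rf_rat D = range ext}.
Proof.
pose w (p : I) := ext (rank_one X0 (x_ p.1.1) (y_ p.1.2) (alpha p.2)).
pose om (p : I) (e : endo PK) :=
  ext_coord p.2 (hs_h XK (tP (y_ p.1.1) 1) (e (tP (x_ p.1.2) 1))).
pose w' (p : 'I_#|{: I}|) := w (enum_val p).
pose om' (p : 'I_#|{: I}|) := om (enum_val p).
have r1 : range ext 1 by exists 1; rewrite // rmorph1.
have rB a b : range ext a -> range ext b -> range ext (a - b).
  by move=> [a' _ <-] [b' _ <-]; exists (a' - b'); rewrite // rmorphB.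
have rM a b : range ext a -> range ext b -> range ext (a * b).
  by move=> [a' _ <-] [b' _ <-]; exists (a' * b'); rewrite // rmorphM.
have rZ c a : F0 c -> range ext a -> range ext (kap c * a).
  move=> [c' _ <-] [a' _ <-].
  by exists (scale_endo c' a'); rewrite // ext_scale_endo.
have oD p a b : om' p (a + b) = om' p a + om' p b.
  by rewrite /om' /om endoD (hDr XK) ext_coordD.
have oZ p c a : om' p (kap c * a) = c * om' p a.
  by rewrite /om' /om endo_algebraE (hZr XK) -ext_scalar_central ext_coordZ.
have bas a : a = \sum_p kap (om' p a) * w' p.
  transitivity (\sum_(p : I) kap (om p a) * w p); last first.
    by rewrite (eq_bigl (mem predT)) // (big_enum_val (fun p => kap (om p a) * w p)).
  apply/endoP => z; rewrite endo_sum.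
  transitivity (\sum_(kl : 'I_n * 'I_n) \sum_l (kap (om (kl, l) a) * w (kl, l)) z); last first.
    by rewrite pair_bigA; apply: eq_bigr => -[kl l] _.
  transitivity (\sum_k \sum_k' \sum_l (kap (om (k, k', l) a) * w (k, k', l)) z); last first.
    by rewrite pair_bigA; apply: eq_bigr => -[k k'] _.
  rewrite exchange_big /= {1}[z](hbasis XK) linear_sum; apply: eq_bigr => k' _.
  rewrite linear_rscale {1}[a _](hbasis XK) rscale_suml; apply: eq_bigr => k _.
  rewrite rscaleA {1}[hs_h XK _ (a _)]ext_coord_basis mulr_suml rscale_sumr.
  apply: eq_bigr => l _.
  rewrite [RHS](congr1 (fun e : endo PK => e z) (ext_rank_one _ _ _ _)).
  rewrite rank_oneE /om /=.
  congr (_ *> (_ * _)).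
  rewrite ext_mulE mul1r mulr1 //.
have wr p : range ext (w' p) by exists (rank_one X0 (x_ (enum_val p).1.1) (y_ (enum_val p).1.2) (alpha (enum_val p).2)).
have or p a : range ext a -> F0 (om' p a).
  move=> [e _ <-]; rewrite /om' /om ext_endoE ext_hE ext_coordE !mulr1.
  by eexists.
by exists (RationalForm r1 rB rM rZ oD oZ bas wr or).
Qed.

Lemma ext_starZ c e : hs_star XK (kap c * e) = kap c * hs_star XK e.
Proof.
have scE : sigmaK (sc c) = sc c by rewrite sE (invol1 uA).
apply/endoP => w; apply: (h_injr (X := XK)) => z; rewrite hs_starEr !endo_algebraE.
rewrite (hZl XK) (hZr XK) hs_starEr -[hs_inv XK _]/(sigmaK (sc c)) scE.
exact: ext_scalar_central.
Qed.

Let sigma_iota c a : sigma (iota c * a) = iota c * sigma a.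
Proof. by case: unitaryA. Qed.
Let Lambda_iota c a : Lambda a -> Lambda (iota c * a).
Proof. by case: unitaryA => _ _; apply. Qed.

Lemma ext_lamZ c l : F0 c -> hs_lam X0 l ->
  exists2 l', hs_lam X0 l' & ext l' = kap c * ext l.
Proof.
move=> [c' _ <-] [ls ld]; exists (scale_endo c' l); last exact: ext_scale_endo.
split=> [|z]; last first.
  rewrite scale_endoE (hZr X0) -(alg_map_central iota); exact: (Lambda_iota c' (ld z)).
apply/endoP => w; apply: (h_injr (X := X0)) => z.
rewrite hs_starEr scale_endoE (hZl X0) endoN (hNr X0) scale_endoE (hZr X0).
have := sigma_iota c' 1; rewrite mulr1 (invol1 uA) mulr1 => e.
rewrite -[hs_inv X0 _]/(sigma (iota c')) e (alg_map_central iota) -mulNr.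
by congr (_ * _); rewrite -(hNr X0) -endoN -ls hs_starEr.
Qed.

(** Expand [l] into rank-one operators along its Gram matrix. Diagonal entries lie in Lambda_K,
    which consists of sums of tensors over Lambda; the rest is V - V^*, and V is a combination of
    operators defined over F. *)
Lemma ext_lam_comb l : hs_lam XK l -> combinations kap (ext @` hs_lam X0) l.
Proof.
move=> [ls ld]; pose x k := tP (x_ k) 1; pose y k := tP (y_ k) 1.
pose C k k' := hs_h XK (x k) (l (x k')).
pose R k k' := rank_one XK (y k) (y k') (sigmaK uK * C k k').
have lE : l = \sum_k \sum_k' R k k'.
  apply/endoP => z; rewrite endo_sum; transitivity (\sum_k \sum_k' R k k' z); last first.
    by apply: eq_bigr => k _; rewrite endo_sum.
  rewrite exchange_big /= {1}[z](hbasis XK) linear_sum; apply: eq_bigr => k' _.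
  rewrite linear_rscale {1}[l _](hbasis_left XK) rscale_suml.
  apply: eq_bigr => k _; rewrite /rank_one_fun rscaleA; congr (_ *> (_ * _)).
  by rewrite (hCV XK) -(Vu_central UK).
have RC k k' : R k' k = - hs_star XK (R k k').
  rewrite rank_one_star -rank_oneN -mulrN; congr (rank_one _ _ _ (_ * _)).
  by rewrite /C [sigmaK _ * _](hC XK) -(hs_starEr XK) ls endoN (hNr XK) opprK.
have [D ratE] := ext_rational_form.
pose V := \sum_(k < n) \sum_(k' < n | (k < k')%N) R k k'.
have -> : l = \sum_k R k k + (V - hs_star XK V).
  have U := hs_star_unitary XK.
  rewrite lE sum_diag; congr (_ + _); rewrite (invol_sum U) -sumrB.
  apply: eq_bigr => k _; rewrite (invol_sum U) -sumrB; apply: eq_bigr => k' _.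
  by rewrite [R k' k]RC.
apply: combinationsD.
  apply: combinations_sum => k _; rewrite /R.
  have := ld (x k); rewrite -/(C k k).
  apply: (ext_param_ind (Q := fun a => combinations kap (ext @` hs_lam X0)
    (rank_one XK (y k) (y k) (sigmaK uK * a)))).
  - by rewrite mulr0 rank_one0; apply: combinations0.
  - by move=> a b ha hb; rewrite mulrDr rank_oneD; apply: combinationsD.
  move=> a t la; rewrite sE ext_mulE mul1r -ext_rank_one.
  apply: combinationsZ; exists (rank_one X0 (y_ k) (y_ k) (sigma u * a)) => //.
  exact: rank_one_param.
rewrite [V](rf_basis D).
have sk (a b : endo PK) : a + b - hs_star XK (a + b) = (a - hs_star XK a) + (b - hs_star XK b).
  by rewrite (involD (hs_star_unitary XK)) opprD addrACA.
elim/big_rec: _ => [|i a _ ha].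
  by rewrite (invol0 (hs_star_unitary XK)) subr0; apply: combinations0.
rewrite sk; apply: combinationsD ha.
rewrite ext_starZ -mulrBr; apply: combinationsZ.
have := @rf_w_rat _ _ _ _ D i; rewrite ratE => -[e _ <-]; rewrite ext_star -rmorphB.
exists (e - hs_star X0 e) => //.
by have := param_min (hs_star_unitary X0) e; rewrite mulr1.
Qed.

Let actK (z : PK) (c : K) : PK := z *> sc c.
Let actKP : right_action actK.
Proof.
split=> *; rewrite /actK.
- exact: rscaleDl.
- by rewrite rmorphD rscaleDr.
- by rewrite rscaleA -rmorphM.
- by rewrite rmorph1 rscale1.
Qed.

Let ext_generates : {g : 'I_#|{: 'I_n * 'I_m}| -> PK | generates actK g}.
Proof.
exists (fun p => tP (x_ (enum_val p).1 *> alpha (enum_val p).2) 1) => z.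
pose co (p : 'I_n * 'I_m) := ext_coord p.2 (hs_h XK (tP (y_ p.1) 1) z).
exists (fun p => co (enum_val p)).
pose G (p : 'I_n * 'I_m) := actK (tP (x_ p.1 *> alpha p.2) 1) (co p).
transitivity (\sum_p G p); last first.
  by rewrite (eq_bigl (mem predT)) // (big_enum_val G).
transitivity (\sum_k \sum_l G (k, l)); last first.
  by rewrite pair_bigA; apply: eq_bigr => -[k l] _.
rewrite {1}[z](hbasis XK); apply: eq_bigr => k _.
rewrite {1}[hs_h XK _ _]ext_coord_basis rscale_sumr; apply: eq_bigr => l _.
rewrite /G /actK -[tP _ 1]/(tP (x_ k *> alpha l) (1 : K)).
have -> : tP (x_ k *> alpha l) 1 = tP (x_ k) 1 *> tA (alpha l) 1.
  by rewrite ext_rscaleE mulr1.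
by rewrite rscaleA -ext_scalar_central.
Qed.

(** If z c were outside [N], then N + P_K c would be all of P_K. As P_K is finitely generated over K
    and P_K c lies in its K-radical, Nakayama over K would give N = P_K. *)
Let maximal_rad N z c : maximal_submodule (@rscale AK PK) N -> jacobson c ->
  N (z *> sc c).
Proof.
move=> [subN [x0 Nx0] maxN] jc; apply: contrapT => Nzc; apply: Nx0.
have [g gP] := ext_generates.
have KN : submodule actK N.
  by case: subN => N0 NB NZ; split=> // x b; apply: NZ.
apply: (nakayama gP KN) => x.
pose Z := [set w | exists y v, N y /\ w = y + v *> sc c].
have subZ : submodule (@rscale AK PK) Z.
  split=> [|_ _ [y [v [Ny ->]]] [y' [v' [Ny' ->]]]|_ b [y [v [Ny ->]]]].
  - by exists 0, 0; split; [exact: (submod0 subN)|rewrite rscale0l addr0].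
  - exists (y - y'), (v - v'); split; first exact: (submodB subN).
    by rewrite rscaleBl opprD addrACA.
  - exists (y *> b), (v *> b); split; first exact: (submodZ subN).
    by rewrite rscaleDl !rscaleA ext_scalar_central.
have NZ : N `<=` Z by move=> y Ny; exists y, 0; rewrite rscale0l addr0.
have Zzc : exists w, Z w /\ ~ N w.
  by exists (z *> sc c); split=> //; exists 0, z; rewrite add0r; split=> //; exact: (submod0 subN).
have [y [v [Ny ->]]] := maxN Z subZ NZ Zzc x.
exists y => //; rewrite [y + _]addrC addrK => M mM.
exact: (maximal_jacobson actKP v mM jc).
Qed.

(** All maximal A_K-submodules contain the multiples of P_K by Jac(K), and decreasing chains above
    these multiples stop because P_K is finitely generated over the semilocal ring K. *)
Lemma ext_finite_rad : semilocal K ->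
  exists2 Ms, all_maximal (@rscale AK PK) Ms &
              inter_all Ms `<=` module_rad (@rscale AK PK).
Proof.
move=> slK; have [g gP] := ext_generates.
apply: (finite_rad (act := @rscale AK PK) (R0 := [set w | exists z c, jacobson c /\ w = z *> sc c])).
  by move=> N mN _ [z [c [jc ->]]]; apply: maximal_rad.
move=> Y subY decY RY.
apply: (dcc_semilocal actKP slK gP (Y := Y)) => // [k|k x b jb].
  by case: (subY k) => Y0 YB YZ; split=> // x b; apply: YZ.
by apply: RY; exists x, b.
Qed.

End ExtSpace.

(** * Subgroups whose index is a power of 2 *)

Section Cosets.
Variables (R : pzRingType) (O H : set R) (inv : R -> R).
Variables (I : finType) (mask : R -> I).
Hypotheses (O1 : O 1) (OM : forall a b, O a -> O b -> O (a * b))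
  (OV : forall a, O a -> [/\ O (inv a), a * inv a = 1 & inv a * a = 1])
  (HO : H `<=` O) (H1 : H 1) (HM : forall a b, H a -> H b -> H (a * b))
  (maskP : forall a b, O a -> O b -> mask a = mask b -> H (a * b)).

Let OI a : O a -> O (inv a). Proof. by case/OV. Qed.
Let VK a x : O a -> x * a * inv a = x.
Proof. by case/OV => _ e _; rewrite -mulrA e mulr1. Qed.
Let KV a x : O a -> x * inv a * a = x.
Proof. by case/OV => _ _ e; rewrite -mulrA e mulr1. Qed.
Let invVK a : O a -> inv (inv a) = a.
Proof. by move=> Oa; rewrite -[LHS]mul1r -[1](VK 1 Oa) mul1r VK //; apply: OI. Qed.

(** An element shares its mask with itself, so all squares lie in [H]. With closure under products
    this makes [H] a normal subgroup: the inverse of a is its own square times a, and a h a^-1 = (a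
    h)^2 h^-1 a^-2. *)
Let HX a : O a -> H (a * a). Proof. by move=> Oa; apply: maskP. Qed.
Let HV a : H a -> H (inv a).
Proof.
move=> Ha; rewrite -[inv a](KV _ (HO Ha)).
by apply: HM => //; apply/HX/OI/HO.
Qed.
Let HJ a h : O a -> H h -> H (a * h * inv a).
Proof.
move=> Oa Hh; have Oh := HO Hh.
have -> : a * h * inv a = (a * h) * (a * h) * inv h * (inv a * inv a).
  by rewrite !mulrA VK // VK.
by apply: HM; [apply: HM; [apply/HX/OM|apply: HV]|apply/HX/OI].
Qed.
Let HJV a h : O a -> H h -> H (inv a * h * a).
Proof. by move=> Oa Hh; rewrite -{2}(invVK Oa); apply: HJ => //; apply: OI. Qed.

Let square_del x a y : O x -> O a -> H (x * (a * a) * y) -> H (x * y).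
Proof.
move=> Ox Oa h; rewrite -[x * y](_ : x * (inv a * inv a) * inv x * (x * (a * a) * y) = _).
  by apply: HM => //; apply/HJ/HX => //; apply: OI.
by rewrite !mulrA; do 4?[rewrite VK //|rewrite KV //].
Qed.

Let swap a b c : O a -> O b -> O c -> H (a * b * c) -> H (b * a * c).
Proof.
move=> Oa Ob Oc h.
have -> : b * a * c = (b * a) * (b * a) * (inv a * (inv b * inv b) * a) *
   (inv a * inv a) * (a * b * c).
  by rewrite !mulrA; do 9?[rewrite VK //|rewrite KV //].
apply: HM => //; apply: HM; last exact/HX/OI.
by apply: HM; [apply/HX/OM|apply: HJV => //; apply/HX/OI].
Qed.

Let skew a b c : O a -> O b -> O c -> H (b * c) -> H (a * b * (a * c)).
Proof.
move=> Oa Ob Oc h; rewrite -[_ * _](_ : a * b * (a * b) * (inv b * inv b) * (b * c) = _).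
  by apply: HM => //; apply: HM; [apply/HX/OM|apply/HX/OI].
by rewrite !mulrA; do 9?[rewrite VK //|rewrite KV //].
Qed.

Let skewV a b c : O a -> O b -> O c -> H (a * b * (a * c)) -> H (b * c).
Proof.
move=> Oa Ob Oc h.
rewrite -[_ * _](_ : (b * b) * (inv b * inv a * (inv b * inv a)) * (a * b * (a * c)) = _).
  apply: HM => //; apply: HM; first exact: HX.
  by apply/HX/OM; apply: OI.
by rewrite !mulrA; do 9?[rewrite VK //|rewrite KV //].
Qed.

(** Representatives of a subgroup of order 2^k in the quotient by [H]. As the quotient has exponent
    2, congruence of a and b modulo [H] is written as membership of a b. *)
Let transversal k := exists s : seq R, [/\ size s = (2 ^ k)%N,
  forall i, (i < 2 ^ k)%N -> O (nth 0 s i),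
  forall i l, (i < 2 ^ k)%N -> (l < 2 ^ k)%N -> H (nth 0 s i * nth 0 s l) -> i = l &
  forall i l, (i < 2 ^ k)%N -> (l < 2 ^ k)%N ->
    exists2 p, (p < 2 ^ k)%N & H (nth 0 s i * nth 0 s l * nth 0 s p)].

Let transversal0 : transversal 0.
Proof.
exists [:: 1]; split=> // [[]//|[|i] [|l]//|[|i] [|l]//] _ _.
by exists 0%N => //=; rewrite !mulr1.
Qed.

(** Adjoining a new coset [a] doubles the subgroup. A product of [a] with two old representatives
    stays outside [H], since by closedness [a] would otherwise lie in an old coset. *)
Let transversalS k s a : O a -> size s = (2 ^ k)%N ->
  (forall i, (i < 2 ^ k)%N -> O (nth 0 s i)) ->
  (forall i l, (i < 2 ^ k)%N -> (l < 2 ^ k)%N -> H (nth 0 s i * nth 0 s l) -> i = l) ->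
  (forall i l, (i < 2 ^ k)%N -> (l < 2 ^ k)%N ->
    exists2 p, (p < 2 ^ k)%N & H (nth 0 s i * nth 0 s l * nth 0 s p)) ->
  (forall i, (i < 2 ^ k)%N -> ~ H (a * nth 0 s i)) -> transversal k.+1.
Proof.
move=> Oa szs Os inj closed new; exists (s ++ [seq a * x | x <- s]).
have e : (2 ^ k.+1 = 2 ^ k + 2 ^ k)%N by rewrite expnS mul2n addnn.
have lo i : (i < 2 ^ k)%N -> nth 0 (s ++ [seq a * x | x <- s]) i = nth 0 s i.
  by rewrite nth_cat szs => ->.
have hi i : (i < 2 ^ k)%N -> nth 0 (s ++ [seq a * x | x <- s]) (2 ^ k + i) = a * nth 0 s i.
  by move=> ik; rewrite nth_cat szs ltnNge leq_addr /= addKn (nth_map 0) ?szs.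
have casesP i : (i < 2 ^ k.+1)%N -> (i < 2 ^ k)%N \/ exists2 i', (i' < 2 ^ k)%N & i = (2 ^ k + i')%N.
  rewrite e; case: (ltnP i (2 ^ k)) => [|ki ik]; first by left.
  by right; exists (i - 2 ^ k)%N; [rewrite ltn_subLR|rewrite subnKC].
have mixed i l : (i < 2 ^ k)%N -> (l < 2 ^ k)%N -> ~ H (a * nth 0 s i * nth 0 s l).
  move=> ik lk h; have [p pk hp] := closed _ _ ik lk; apply: (new _ pk).
  pose x := nth 0 s i * nth 0 s l; rewrite -/x in hp.
  have Oi := Os _ ik; have Ol := Os _ lk; have Op := Os _ pk.
  have Ox : O x by apply: OM.
  apply: (square_del Oa Ox); rewrite -[_ * _](_ : a * x * (x * nth 0 s p) = _).
    by apply: HM => //; rewrite /x mulrA.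
  by rewrite !mulrA.
split.
- by rewrite size_cat size_map szs e.
- move=> i /casesP[ik|[i' ik ->]]; first by rewrite lo //; apply: Os.
  by rewrite hi //; apply/OM/Os.
- move=> i l /casesP[ik|[i' ik ->]] /casesP[lk|[l' lk ->]].
  + by rewrite !lo //; apply: inj.
  + rewrite hi // lo // mulrA => h; case: (mixed _ _ ik lk).
    by apply: swap => //; apply: Os.
  + by rewrite hi // lo // => h; case: (mixed _ _ ik lk).
  + rewrite !hi // => h; congr (_ + _)%N; apply: inj => //.
    by apply: (skewV Oa) h; apply: Os.
- move=> i l /casesP[ik|[i' ik ->]] /casesP[lk|[l' lk ->]].
  all: have [p pk hp] := closed _ _ ik lk.
  all: have Oi := Os _ ik; have Ol := Os _ lk; have Op := Os _ pk.
  + by exists p; rewrite ?e ?ltn_addr // !lo.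
  + exists (2 ^ k + p)%N; rewrite ?e ?ltn_add2l // !hi // lo //.
    apply: swap => //; [exact: OM|exact: OM|].
    by rewrite -[a * _ * _]mulrA; apply: skew => //; [exact: OM|apply: swap].
  + exists (2 ^ k + p)%N; rewrite ?e ?ltn_add2l // !hi // lo //.
    rewrite -[a * _ * _]mulrA; apply: skew => //; exact: OM.
  + exists p; rewrite ?e ?ltn_addr // !hi // lo //.
    rewrite -mulrA -[a * _ * nth 0 s p]mulrA; apply: skew => //; first exact: OM.
    by rewrite mulrA.
Qed.

(** Distinct representatives have distinct masks, by [maskP]. *)
Let transversal_bound k : transversal k -> (2 ^ k <= #|I|)%N.
Proof.
move=> [s [szs Os inj _]]; rewrite -(card_ord (2 ^ k)).
apply: (@leq_card _ _ (fun i : 'I_(2 ^ k) => mask (nth 0 s i))) => i l e.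
apply: val_inj; apply: (inj _ _ (ltn_ord i) (ltn_ord l)).
by apply: (maskP _ _ e); apply: Os.
Qed.

(** The bound yields a transversal that cannot be doubled; every element is then congruent to one of
    its entries, so its entries represent all cosets. *)
Lemma coset_card : exists n,
  ([set [set r * h | h in H] | r in O] #= `I_(2 ^ n))%card.
Proof.
have [k [tk nk]] : exists k, transversal k /\ ~ transversal k.+1.
  apply: contrapT => h; have all_k k : transversal k.
    elim: k => [|k IHk]; first exact: transversal0.
    by apply: contrapT => nk; apply: h; exists k.
  have := transversal_bound (all_k #|I|); rewrite leqNgt.
  by rewrite (ltn_expl #|I| (isT : (1 < 2)%N)).
have [s [szs Os inj closed]] := tk; exists k.
have cover r : O r -> exists2 i, (i < 2 ^ k)%N & H (r * nth 0 s i).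
  move=> Or; apply: contrapT => h; apply: nk.
  by apply: (transversalS Or szs) => // i ik hi; apply: h; exists i.
pose coset r := [set r * h | h in H].
have coset_sub r r' : O r -> O r' -> H (r * r') -> coset r `<=` coset r'.
  move=> Or Or' h _ [g Hg <-]; exists (inv r' * (r * r') * r' * (inv r' * inv r') * g).
    by apply: HM => //; apply: HM; [apply: HJV|apply/HX/OI].
  have e : r' * inv r' = 1 by case: (OV Or').
  by rewrite !mulrA e mul1r; do 3?[rewrite VK //|rewrite KV //].
have HC r r' : O r -> O r' -> H (r * r') -> H (r' * r).
  by move=> Or Or' h; have := swap Or Or' O1; rewrite !mulr1; apply.
have cosetE r r' : O r -> O r' -> H (r * r') -> coset r = coset r'.
  move=> Or Or' h; apply/seteqP; split; apply: coset_sub => //; exact: HC.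
have -> : [set coset r | r in O] = [set coset (nth 0 s i) | i in `I_(2 ^ k)].
  apply/seteqP; split=> _ [r Or <-]; last first.
    by exists (nth 0 s r) => //; apply: Os.
  have [i ik h] := cover r Or; exists i => //.
  by apply/esym/cosetE => //; apply: Os.
apply: inj_card_eq => i l; rewrite !inE /= => ik lk e; apply: inj => //.
have [g Hg gE] : coset (nth 0 s l) (nth 0 s i).
  by rewrite -e; exists 1; rewrite ?mulr1.
have Ol := Os _ lk.
rewrite -gE -[_ * _](_ : nth 0 s l * g * inv (nth 0 s l) * (nth 0 s l * nth 0 s l) = _).
  by apply: HM; [apply: HJ|apply: HX].
by rewrite !mulrA KV.
Qed.
End Cosets.

(** * The closure as a subgroup, and the theorem *)

Section IsometryGroup.
Variables (A : pzRingType) (P : lmodType A^c) (X : hspace P).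
Local Notation star := (hs_star X).
Let U := hs_star_unitary X.

Lemma hs_iso1 : hs_iso X 1.
Proof.
split; rewrite (invol1 U) ?mul1r // mulr1 subrr; exact: (param0 U).
Qed.
Lemma hs_isoM a b : hs_iso X a -> hs_iso X b -> hs_iso X (a * b).
Proof.
move=> [a1 a2 aL] [b1 b2 bL]; split; rewrite (involM U).
- by rewrite mulrA -(mulrA (star b)) a1 mulr1.
- by rewrite mulrA -(mulrA a) b2 mulr1.
have -> : star b * star a * hs_eps X * (a * b) - hs_eps X =
    star b * (star a * hs_eps X * a - hs_eps X) * b +
    (star b * hs_eps X * b - hs_eps X).
  by rewrite mulrBr mulrBl !mulrA addrA subrK.
by apply: (paramD U) => //; apply: (param_conj U).
Qed.
Lemma hs_isoV a : hs_iso X a -> hs_iso X (star a).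
Proof.
move=> [a1 a2 aL]; split; rewrite ?(involK U) //.
have -> : a * hs_eps X * star a - hs_eps X =
    - (star (star a) * (star a * hs_eps X * a - hs_eps X) * star a).
  rewrite (involK U) mulrBr mulrBl !mulrA a2 mul1r -[_ * a * star a]mulrA a2 mulr1.
  by rewrite opprB.
by apply/(paramN U)/(param_conj U).
Qed.
End IsometryGroup.

Section Closure.
Variables (K : comTopologicalRingType) (F0 : set K) (A : pzRingType).
Variables (iota : algebra_over K A) (P : lmodType A^c).
Variables (kap : algebra_over K (endo P)) (D : rational_form F0 kap).
Hypothesis kapE : forall c (e : endo P) x, (kap c * e) x = e x *> iota c.
Local Notation EM := (endo_module iota P).
Local Notation N := (rf_dim D).

Let endo_scaleE (c : K) (e : EM) : c *: e = kap c * (e : endo P).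
Proof. by apply/endoP => x; rewrite kapE. Qed.

Let emb (e : EM) : 'rV[K]_N := \row_k rf_om k (e : endo P).
Let emb_linear : linear emb.
Proof.
by move=> c e e'; apply/rowP => k; rewrite !mxE rf_omD endo_scaleE rf_omZ.
Qed.
Let ret (v : 'rV[K]_N) : EM := \sum_k kap (v 0 k) * rf_w k.
Let ret_linear : linear ret.
Proof.
move=> c v w; rewrite endo_scaleE mulr_sumr -big_split; apply: eq_bigr => k _.
by rewrite !mxE rmorphD rmorphM mulrDl mulrA.
Qed.
HB.instance Definition _ := GRing.isLinear.Build K EM 'rV[K]_N *:%R emb emb_linear.
HB.instance Definition _ := GRing.isLinear.Build K 'rV[K]_N EM *:%R ret ret_linear.
Definition rf_emb : {linear EM -> 'rV[K]_N} := emb.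
Definition rf_ret : {linear 'rV[K]_N -> EM} := ret.
Lemma rf_embK : cancel rf_emb rf_ret.
Proof.
move=> e; rewrite [RHS](rf_basis D); apply: eq_bigr => k _.
by rewrite mxE.
Qed.
Lemma rf_embE e : rf_emb e = \row_k rf_om k e. Proof. by []. Qed.

(** The closure may be computed in the embedding given by the rational form, whichever split
    embedding was used to define it. *)
Lemma fgp_closureP (S : set EM) (e : EM) :
  fgp_closure S e <-> closure (rf_emb @` S) (rf_emb e).
Proof.
split=> [[n [i [r [ir cl]]]]|cl]; last by exists N, rf_emb, rf_ret; split=> //; apply: rf_embK.
apply: (@closure_linear K EM EM n N i r rf_emb idfun S S) => // s Ss.
by apply: subset_closure; exists s.
Qed.

Let mull (a : endo P) (e : EM) : EM := a * (e : endo P).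
Let mull_linear a : linear (mull a).
Proof.
move=> c e e'; rewrite /mull !endo_scaleE mulrDr !mulrA.
by rewrite (alg_map_central kap).
Qed.
HB.instance Definition _ a := GRing.isLinear.Build K EM EM *:%R (mull a) (mull_linear a).
Let mulr_ (a : endo P) (e : EM) : EM := (e : endo P) * a.
Let mulr_linear a : linear (mulr_ a).
Proof. by move=> c e e'; rewrite /mulr_ !endo_scaleE mulrDl !mulrA. Qed.
HB.instance Definition _ a := GRing.isLinear.Build K EM EM *:%R (mulr_ a) (mulr_linear a).

(** Left and right multiplications are linear and hence continuous, so the limit can be taken in one
    factor at a time. *)
Lemma fgp_closureM (S : set EM) (a b : endo P) :
  (forall s t : endo P, S s -> S t -> S (s * t)) ->
  fgp_closure S a -> fgp_closure S b -> fgp_closure S (a * b).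
Proof.
move=> SM /fgp_closureP Sa /fgp_closureP Sb; apply/fgp_closureP.
apply: (@closure_linear K EM EM N N rf_emb rf_ret rf_emb (mull a) S S b rf_embK _ Sb).
move=> s Ss.
apply: (@closure_linear K EM EM N N rf_emb rf_ret rf_emb (mulr_ s) S S a rf_embK _ Sa).
by move=> t St; apply: subset_closure; exists (mulr_ s t) => //; apply: SM.
Qed.

Lemma fgp_closure_sub (S : set EM) a : S a -> fgp_closure S a.
Proof. by move=> Sa; apply/fgp_closureP/subset_closure; exists a. Qed.
End Closure.

(** By unimodularity the coordinate functionals of a split embedding into a free module are of the
    form h(y_k, -). *)
Lemma projective_basis (A : pzRingType) (sigma : A -> A) (u : A) (P : lmodType A^c)
  (f : P -> P -> A) : quadratic_space sigma f -> unimodular sigma u f ->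
  exists n (x_ y_ : 'I_n -> P),
    forall z, z = \sum_k x_ k *> hermitian_form sigma u f (y_ k) z.
Proof.
move=> [[n [i [r ir]]] _] uf.
pose phi (k : 'I_n) (z : P) : A := i z 0 k.
have phiP k : dual (phi k).
  split=> [x y|x a]; first by rewrite /phi linearD mxE.
  by rewrite /phi linear_rscale mxE.
have /choice[y_ yE] : forall k, exists y, hermitian_form sigma u f y = phi k.
  by move=> k; have [y [yE _]] := uf _ (phiP k); exists y.
exists n, (fun k => r (delta_mx 0 k)), y_ => z.
rewrite -{1}[z]ir {1}[i z]row_sum_delta linear_sum; apply: eq_bigr => k _.
by rewrite linearZ yE.
Qed.

Lemma algebra_basis (F : comPzRingType) (A : pzRingType) (iota : algebra_over F A) :
  fg_projective (alg_module iota) ->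
  exists m (alpha : 'I_m -> A) (beta : 'I_m -> A -> F),
  [/\ forall l (a b : A), beta l (a + b) = beta l a + beta l b,
      forall l c (a : A), beta l (iota c * a) = c * beta l a &
      forall a, a = \sum_l iota (beta l a) * alpha l].
Proof.
move=> [m [i [r ir]]].
exists m, (fun l => r (delta_mx 0 l)), (fun l (a : A) => i (a : alg_module iota) 0 l).
split=> [l a b|l c a|a].
- by rewrite (linearD i) mxE.
- by rewrite -[iota c * a]/(c *: (a : alg_module iota)) linearZ mxE.
rewrite -{1}[a]ir {1}[i a]row_sum_delta linear_sum; apply: eq_bigr => k _.
by rewrite linearZ.
Qed.

Theorem theorem3p4
  (K : comTopologicalRingType) (S : {pred K}) (F : subComPzRingType S)
  (A : pzRingType) (iota : algebra_over F A)
  (sigma : A -> A) (u : A) (Lambda : set A)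
  (P : lmodType A^c) (f : P -> P -> A)
  (semilocalK : semilocal K) (hausdorffK : hausdorff_space K)
  (unitaryA : unitary_algebra sigma u Lambda iota)
  (spaceP : quadratic_space sigma f) (unimodularP : unimodular sigma u f)
  (no_F2 : ~ exists h : {rmorphism K -> 'F_2}, forall y, exists x, h x = y)
  (units_open : open [set x : K | invertible x])
  (inv_continuous : {within [set x : K | invertible x], continuous (@inverse K)})
  (F_dense : dense (range (val : F -> K)))
  (F_units : forall c : F, invertible (val c : K) <-> invertible c)
  (A_projective : fg_projective (alg_module iota))
  (Lambda_summand : is_summand (Lambda : set (alg_module iota))) :
  let j : {rmorphism F -> K} := val in
  let A_K := ext_ring j iota in
  let sigma_K : A_K -> A_K := ext_invol j iota sigma in
  let u_K : A_K := ext_unit j iota u in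
  let Lambda_K : set A_K := ext_param j iota Lambda in
  let P_K : lmodType A_K^c := ext_module j iota P in
  let f_K : P_K -> P_K -> A_K := ext_form j iota f in
  let O_f := isometry_group sigma u Lambda f in
  let O_fK := isometry_group sigma_K u_K Lambda_K f_K in
  let closure_O_f : set {linear P_K -> P_K} :=
    O_fK `&` fgp_closure (M := endo_module (ext_algebra j iota) P_K)
               [set ext_endo j iota phi | phi in O_f] in
  (forall D : factorization sigma_K u_K Lambda_K f_K,
     dickson_kernel D `<=` closure_O_f) /\
  (exists n : nat, (left_cosets O_fK closure_O_f #= `I_(2 ^ n))%card).
Proof.
move=> j A_K sigma_K u_K Lambda_K P_K f_K O_f O_fK H.
have [n [x_ [y_ basis]]] := projective_basis spaceP unimodularP.
have [m [alpha [beta [betaD betaZ alphaE]]]] := algebra_basis A_projective.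
have fd := spaceP.2; have j_inj : injective j := val_inj.
pose X0 : hspace P := base_space unitaryA fd basis.
pose XK : hspace P_K := ext_space j unitaryA fd basis.
have [D ratE] := ext_rational_form j unitaryA fd basis betaD betaZ alphaE.
pose EK := endo P_K; pose SK : set EK := [set ext_endo j iota phi | phi in O_f].
have kapE c (e : EK) x : (endo_algebra j iota P c * e) x = e x *> ext_algebra j iota c by [].
have F1 : range j 1 by exists 1; rewrite // rmorph1.
have FB c d : range j c -> range j d -> range j (c - d).
  by move=> [c' _ <-] [d' _ <-]; exists (c' - d'); rewrite // rmorphB.
have FM c d : range j c -> range j d -> range j (c * d).
  by move=> [c' _ <-] [d' _ <-]; exists (c' * d'); rewrite // rmorphM.
have FV c : range j c -> invertible c -> range j (inverse c).
  (* A unit of K coming from F is a unit of F, and uniqueness of inverses identifies its inverse in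
     K with the image of the one in F. *)
  move=> [c' _ <-] ic; have [d [cd _]] := (F_units c').1 ic; exists d => //.
  have [_ e] := mul_inverse ic.
  by rewrite -[LHS]mul1r -e -mulrA -rmorphM cd rmorph1 mulr1.
have dense_trans (phi : EK) : transformation XK phi -> hs_iso XK phi -> H phi.
  move=> tphi iphi; split; first exact/(hs_isoP XK).
  apply/(fgp_closureP D kapE) => V Vn.
  have [phi0 iphi0 Vphi0] := transformation_dense F1 FB FM FV F_dense inv_continuous
    units_open (ext_endo_inj unitaryA fd basis betaD betaZ alphaE j_inj)
    (ext_star j unitaryA fd basis) (ext_eps j unitaryA fd basis) ratE
    (ext_starZ unitaryA fd basis) (@ext_lamZ _ _ j _ _ _ _ _ unitaryA _ _ fd _ _ _ basis)
    (@ext_lam_comb _ _ j _ _ _ _ _ unitaryA _ _ fd _ _ _ basis _ _ _ betaD betaZ alphaE) tphi Vn.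
  exists (rf_emb D kapE (ext_endo j iota phi0)); split=> //.
  by exists (ext_endo j iota phi0) => //; exists phi0 => //; apply/(hs_isoP X0).
have fin := mulmx_inverse D.
have [Ms aMs RMs] := ext_finite_rad j unitaryA fd basis betaD betaZ alphaE semilocalK.
have rel (phi : EK) := relative_inverse XK (1 - phi) aMs RMs.
split=> [Df phi dphi|].
  have iphi : hs_iso XK phi by apply/hs_isoP; case: dphi.
  have [T [s [_ sJ _ _]]] := rel phi.
  apply: dense_trans => //.
  exact: (dickson_transformation (X := XK) fin dphi sJ).
have OK1 : O_fK (1 : EK) by apply/(hs_isoP XK)/hs_iso1.
have OKM (a b : EK) : O_fK a -> O_fK b -> O_fK (a * b : EK).
  by move=> /(hs_isoP XK) ia /(hs_isoP XK) ib; apply/(hs_isoP XK)/hs_isoM.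
have OKV (a : EK) : O_fK a ->
    [/\ O_fK (hs_star XK a), a * hs_star XK a = 1 & hs_star XK a * a = 1].
  move=> /(hs_isoP XK) ia; have [a1 a2 _] := ia.
  by split=> //; apply/(hs_isoP XK)/hs_isoV.
have SKM (s t : EK) : SK s -> SK t -> SK (s * t : EK).
  move=> [s0 Os0 <-] [t0 Ot0 <-]; exists ((s0 : endo P) * (t0 : endo P)).
    by apply/(hs_isoP X0)/hs_isoM; apply/(hs_isoP X0).
  exact: (rmorphM (ext_endo_ring j iota (P := P))).
have HM (a b : EK) : H a -> H b -> H (a * b : EK).
  move=> [Oa ca] [Ob cb]; split; first exact: OKM.
  exact: (fgp_closureM D kapE SKM ca cb).
have H1 : H (1 : EK).
  split=> //; apply: (fgp_closure_sub D kapE); exists (1 : endo P).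
    exact/(hs_isoP X0)/hs_iso1.
  exact: (rmorph1 (ext_endo_ring j iota (P := P))).
(* To each endomorphism is attached a mask, as a Boolean tuple of fixed length, together with a
   relative inverse adapted to it. *)
have /choice[w wP] : forall phi : EK, exists w : (size Ms).-tuple bool * EK,
    [/\ rad_ideal ((1 - phi) * w.2 * (1 - phi) - (1 - phi)),
        forall x, mask_inter w.1 Ms (x - (1 - phi) (w.2 x)) &
        forall x, mask_inter w.1 Ms ((1 - phi) x) ->
          module_rad (@rscale A_K P_K) ((1 - phi) x)].
  move=> phi; have [T [s [sT sJ Ts TR]]] := rel phi.
  by exists (Tuple (introT eqP sT), s).
have maskP (a b : EK) : O_fK a -> O_fK b -> (w a).1 = (w b).1 -> H (a * b : EK).
  move=> /(hs_isoP XK) ia /(hs_isoP XK) ib eT; apply: dense_trans; last exact: hs_isoM.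
  have [aJ aT aR] := wP a; have [bJ] := wP b; rewrite -eT => bT bR.
  exact: (transformation_same_mask (X := XK) fin ia ib aMs aJ bJ aT bT aR bR).
have HO : H `<=` O_fK by move=> a [].
have := coset_card OK1 OKM OKV HO H1 HM maskP.
exact.
Qed.
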